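(* The Offensive Alliance and Exact Offensive Alliance problems are W[1]-hard when parameterized by any of the following parameters: the feedback vertex set number of the input graph; the treewidth of the input graph; the pathwidth of the input graph; the treedepth of the input graph.
   Context: All graphs are finite, simple and undirected. For $S\subseteq V(G)$, $N(S)$ is the open neighbourhood of $S$, $S^c=V(G)\setminus S$, and $d_S(v)$ is the number of neighbours of $v$ in $S$. A non-empty set $S\subseteq V(G)$ is an offensive alliance if $d_S(v)\ge d_{S^c}(v)+1$ for every $v\in N(S)$. Offensive Alliance: given a graph $G$ and integer $r\ge 1$, is there an offensive alliance $S$ with $1\le |S|\le r$? Exact Offensive Alliance: given $G$ and $r\ge1$, is there an offensive alliance $S$ with $|S|=r$? The feedback vertex set number is the minimum size of a set $S\subseteq V(G)$ such that $G-S$ is a forest. Treedepth is the minimum height of a rooted forest whose transitive closure (ancestor–descendant pairs as edges) contains $G$ as a subgraph. *)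

(* Defs.v *)
From HB Require Import structures.
From mathcomp Require Import all_boot matrix.
From mathcomp Require Import boolp.

Set Implicit Arguments.
Unset Strict Implicit.
Unset Printing Implicit Defensive.

(* The least [n] with [P n]; it is only applied to properties that hold for
   some [n] (the default value 0 is never used). *)
Definition least (P : nat -> Prop) : nat :=
  if pselect (exists n, `[< P n >]) is left exP then ex_minn exP else 0.

Record sgraph := SGraph {
  num_vertices : nat;
  adj : 'M[bool]_num_vertices;
  adj_sym : [forall u, forall v, adj u v == adj v u];
  adj_irr : [forall u, ~~ adj u u] }.

Definition edge (G : sgraph) : rel 'I_(num_vertices G) := fun u v => @adj G u v.

Section GraphParameters.
Variables (V : finType) (e : rel V).

Definition acyclic_on (A : {set V}) : Prop :=
  forall c : seq V, {subset c <= A} -> ucycle e c -> size c < 3.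

Definition connected_on (A : {set V}) : Prop :=
  {in A &, forall u v, connect [rel a b | [&& a \in A, b \in A & e a b]] u v}.

Definition is_tree : Prop :=
  [/\ 0 < #|V|, symmetric e, irreflexive e, connected_on setT
    & acyclic_on setT].

Definition feedback_vertex_set (S : {set V}) : Prop := acyclic_on (~: S).

End GraphParameters.

(* The conditions on the bags of a tree decomposition of (V, e) whose
   underlying tree is (I, t). *)
Definition decomposition (V : finType) (e : rel V) (I : finType) (t : rel I)
    (bag : I -> {set V}) : Prop :=
  [/\ forall v, exists i, v \in bag i,
      forall u v, e u v -> exists i, (u \in bag i) && (v \in bag i)
    & forall v, connected_on t [set i | v \in bag i]].

Definition width_le (V : finType) (I : finType) (bag : I -> {set V}) (w : nat) :=
  forall i, #|bag i| <= w.+1.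

Definition path_rel (m : nat) : rel 'I_m :=
  [rel i j : 'I_m | (i.+1 == j :> nat) || (j.+1 == i :> nat)].

(* A rooted forest is given by its parent function; a root has parent [None].
   [up par k x] is the ancestor of [x] that is [k] levels above [x]. *)
Definition up (I : Type) (par : I -> option I) (k : nat) (x : I) : option I :=
  iter k (obind par) (Some x).

Definition ancestor (I : Type) (par : I -> option I) (x y : I) : Prop :=
  exists2 k, 0 < k & up par k x = Some y.

(* Every upward chain leaves the forest after at most [h] steps: [par] has no
   cycle and every root-to-leaf path has at most [h] vertices. *)
Definition forest_height_le (I : Type) (par : I -> option I) (h : nat) : Prop :=
  forall x, up par h x = None.

Definition fvs_number (G : sgraph) : nat :=
  least (fun k => exists2 S : {set 'I_(num_vertices G)},
                    feedback_vertex_set (@edge G) S & #|S| = k).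

Definition treewidth (G : sgraph) : nat :=
  least (fun w => exists (m : nat) (t : rel 'I_m) (bag : 'I_m -> {set 'I_(num_vertices G)}),
    [/\ is_tree t, decomposition (@edge G) t bag & width_le bag w]).

Definition pathwidth (G : sgraph) : nat :=
  least (fun w => exists (m : nat) (bag : 'I_m -> {set 'I_(num_vertices G)}),
    decomposition (@edge G) (@path_rel m) bag /\ width_le bag w).

Definition treedepth (G : sgraph) : nat :=
  least (fun h => exists (m : nat) (par : 'I_m -> option 'I_m)
                         (f : 'I_(num_vertices G) -> 'I_m),
    [/\ forest_height_le par h, injective f
      & forall u v, edge u v ->
          ancestor par (f u) (f v) \/ ancestor par (f v) (f u)]).

Section Alliance.
Variables (V : finType) (e : rel V).

(* Vertices outside [S] with a neighbour in [S]. *)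
Definition open_nbhd (S : {set V}) : {set V} :=
  [set v | (v \notin S) && [exists u in S, e u v]].

Definition deg_in (S : {set V}) (v : V) : nat := #|[set u in S | e v u]|.

Definition offensive_alliance (S : {set V}) : Prop :=
  S != set0 /\ forall v, v \in open_nbhd S -> deg_in S v >= deg_in (~: S) v + 1.

End Alliance.

(* A random access machine with structured control flow, uniform cost, and
   addition and truncated subtraction as its only arithmetic operations (so
   that T steps increase the bit length of the stored numbers by O(T) only;
   this is the usual RAM, polynomially equivalent to Turing machines).  The
   memory consists of arrays of natural numbers, [Rd a e] being cell [e] of
   array [a].  A program is a fixed finite object, so the evaluation of each
   expression that it contains takes O(1) machine steps and is charged as part
   of its command.  The output is a word written one bit at a time, hence is
   never longer than the running time. *)
Inductive expr :=
| Cst of nat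
| Rd of nat & expr
| Add of expr & expr
| Sub of expr & expr.

Inductive cmd :=
| Skip
| Wr of nat & expr & expr            (* Wr a i e : a[i] := e *)
| Emit of expr                       (* output the bit (e != 0) *)
| Seq of cmd & cmd
| If of expr & cmd & cmd
| While of expr & cmd.

Definition memory := nat -> nat -> nat.

Fixpoint eval (m : memory) (x : expr) : nat :=
  match x with
  | Cst n => n
  | Rd a i => m a (eval m i)
  | Add x1 x2 => eval m x1 + eval m x2
  | Sub x1 x2 => eval m x1 - eval m x2
  end.

Definition update (m : memory) (a i n : nat) : memory :=
  fun b j => if (b == a) && (j == i) then n else m b j.

(* [exec c m w t m' w']: started with memory [m] and output [w], the command
   [c] halts after [t] steps with memory [m'] and output [w']. *)
Inductive exec :
  cmd -> memory -> bitseq -> nat -> memory -> bitseq -> Prop :=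
| ExSkip m w : exec Skip m w 1 m w
| ExWr a i x m w :
    exec (Wr a i x) m w 1 (update m a (eval m i) (eval m x)) w
| ExEmit x m w : exec (Emit x) m w 1 m (rcons w (eval m x != 0))
| ExSeq c1 c2 m w t1 m1 w1 t2 m2 w2 :
    exec c1 m w t1 m1 w1 -> exec c2 m1 w1 t2 m2 w2 ->
    exec (Seq c1 c2) m w (t1 + t2) m2 w2
| ExIf x c1 c2 m w t m' w' :
    exec (if eval m x != 0 then c1 else c2) m w t m' w' ->
    exec (If x c1 c2) m w t.+1 m' w'
| ExWhileEnd x c m w : eval m x = 0 -> exec (While x c) m w 1 m w
| ExWhile x c m w t1 m1 w1 t2 m2 w2 :
    eval m x != 0 ->
    exec c m w t1 m1 w1 -> exec (While x c) m1 w1 t2 m2 w2 ->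
    exec (While x c) m w (t1 + t2).+1 m2 w2.

(* The bits of the input word are in array 0 and its length is in cell 0 of
   array 1. *)
Definition init_memory (x : bitseq) : memory :=
  fun a i => match a, i with
             | 0, _ => nat_of_bool (nth false x i)
             | 1, 0 => size x
             | _, _ => 0
             end.

Definition outputs_in (p : cmd) (x : bitseq) (t : nat) (y : bitseq) : Prop :=
  exists m, exec p (init_memory x) [::] t m y.

(* Unary representation, closed by a delimiter. *)
Definition enc_nat (n : nat) : bitseq := rcons (nseq n true) false.

Definition enc_nats (s : seq nat) : bitseq := flatten (map enc_nat s).

Definition computable (f : nat -> nat) : Prop :=
  exists p, forall n, exists t, outputs_in p (enc_nat n) t (enc_nat (f n)).

(* Languages over {0,1} are the special case [instance := bitseq],
   [encode := id]. *)
Record param_problem := ParamProblem {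
  instance : Type;
  encode : instance -> bitseq;
  encode_inj : injective encode;
  yes : instance -> Prop;
  param : instance -> nat }.

Definition fpt_reducible (P Q : param_problem) : Prop :=
  exists (R : instance P -> instance Q) (p : cmd) (f g : nat -> nat) (c : nat),
    [/\ computable f, computable g,
        forall x, yes x <-> yes (R x),
        forall x, exists2 t, t <= f (param x) * (size (encode x)).+1 ^ c
                           & outputs_in p (encode x) t (encode (R x))
      & forall x, param (R x) <= g (param x)].

(* A circuit lists its nodes in topological order: a gate refers to earlier
   nodes by their positions, and the last node is the output. *)
Inductive gate :=
| Input
| Not of nat
| And of seq nat
| Or of seq nat.

Definition circuit := seq gate.

Definition gate_args (g : gate) : seq nat :=
  match g with Input => [::] | Not i => [:: i] | And s => s | Or s => s end.

Definition is_input (g : gate) : bool := if g is Input then true else false.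

Definition is_large (g : gate) : bool := 2 < size (gate_args g).

Definition wf_circuit (C : circuit) : bool :=
  (0 < size C) &&
  all (fun i => all (fun j => j < i) (gate_args (nth Input C i)))
      (iota 0 (size C)).

(* Computes a value for each node from the list of the values of the earlier
   nodes. *)
Definition sweep (T : Type) (F : seq T -> gate -> T) (C : circuit) : seq T :=
  foldl (fun vals g => rcons vals (F vals g)) [::] C.

Definition circuit_value (a : nat -> bool) (C : circuit) : bool :=
  last false (sweep (fun vals g =>
    match g with
    | Input => a (size vals)
    | Not i => ~~ nth false vals i
    | And s => all (nth false vals) s
    | Or s => has (nth false vals) s
    end) C).

(* Number of edges on a longest path that ends in the output. *)
Definition circuit_depth (C : circuit) : nat :=
  last 0 (sweep (fun vals g =>
    \max_(i <- gate_args g) (nth 0 vals i).+1) C).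

(* Largest number of large gates on a path that ends in the output. *)
Definition circuit_weft (C : circuit) : nat :=
  last 0 (sweep (fun vals g =>
    is_large g + \max_(i <- gate_args g) nth 0 vals i) C).

Definition weight (a : nat -> bool) (C : circuit) : nat :=
  count (fun i => is_input (nth Input C i) && a i) (iota 0 (size C)).

Record wcs_instance (t d : nat) := WcsInstance {
  wcs_circuit : circuit;
  wcs_weight : nat;
  wcs_wf : wf_circuit wcs_circuit;
  wcs_weft : circuit_weft wcs_circuit <= t;
  wcs_depth : circuit_depth wcs_circuit <= d }.

Definition gate_code (g : gate) : seq nat :=
  match g with
  | Input => [:: 0]
  | Not i => [:: 1; i]
  | And s => [:: 2, size s & s]
  | Or s => [:: 3, size s & s]
  end.

Definition wcs_code t d (x : wcs_instance t d) : seq nat :=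
  wcs_weight x :: flatten (map gate_code (wcs_circuit x)).

Definition wcs_encode t d (x : wcs_instance t d) : bitseq :=
  enc_nats (wcs_code x).

Definition wcs_yes t d (x : wcs_instance t d) : Prop :=
  exists a, weight a (wcs_circuit x) = wcs_weight x /\
            circuit_value a (wcs_circuit x).

Lemma enc_nats_inj : injective enc_nats.
Proof.
have enc_cat (m n : nat) u v :
    enc_nat m ++ u = enc_nat n ++ v -> m = n /\ u = v.
  rewrite /enc_nat !cat_rcons.
  elim: m n => [|m IH] [|n] //= [] => [->//|/IH[-> ->]//].
elim=> [|m s IH] [|n s'] //.
- by rewrite /enc_nats /=; case: n.
- by rewrite /enc_nats /=; case: m.
by move/enc_cat => [-> /IH ->].
Qed.

Lemma gate_codes_inj : injective (fun C : circuit => flatten (map gate_code C)).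
Proof.
have cat_inj (s s' u v : seq nat) :
    size s = size s' -> s ++ u = s' ++ v -> s = s' /\ u = v.
  by move=> ss /eqP; rewrite eqseq_cat // => /andP[/eqP-> /eqP->].
elim=> [|g C IH] [|g' C'] //=; first by case: g'.
  by case: g.
case: g => [|i|s|s]; case: g' => [|i'|s'|s'] //= [].
- by move/IH->.
- by move=> -> /IH->.
- by move=> ss /(cat_inj _ _ _ _ ss)[-> /IH->].
- by move=> ss /(cat_inj _ _ _ _ ss)[-> /IH->].
Qed.

Lemma wcs_encode_inj t d : injective (@wcs_encode t d).
Proof.
move=> [C k w1 w2 w3] [C' k' w1' w2' w3'] /enc_nats_inj [/= ek /gate_codes_inj eC].
subst k' C'; congr WcsInstance; exact: bool_irrelevance.
Qed.

(* Weighted Circuit Satisfiability for circuits of weft at most [t] and depth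
   at most [d], parameterized by the weight. *)
Definition WCS (t d : nat) : param_problem :=
  ParamProblem (@wcs_encode_inj t d) (@wcs_yes t d) (@wcs_weight t d).

Definition W_class (t : nat) (P : param_problem) : Prop :=
  exists d, fpt_reducible P (WCS t d).

Definition W_hard (t : nat) (Q : param_problem) : Prop :=
  forall P, W_class t P -> fpt_reducible P Q.

Record alliance_instance := AllianceInstance {
  al_graph : sgraph;
  al_size : nat;
  al_size_gt0 : 0 < al_size }.

Definition adj_code (G : sgraph) : seq nat :=
  [seq nat_of_bool (edge u v) | u <- enum 'I_(num_vertices G), v <- enum 'I_(num_vertices G)].

Definition al_encode (x : alliance_instance) : bitseq :=
  enc_nats [:: al_size x, num_vertices (al_graph x) & adj_code (al_graph x)].

Lemma al_encode_inj : injective al_encode.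
Proof.
move=> [[n A sA iA] r r0] [[n' A' sA' iA'] r' r0'] /enc_nats_inj [/= er en].
subst r' n' => eA.
have {}eA : A = A'.
  have mem_all i j : (i, j) \in [seq (u, v) | u <- enum 'I_n, v <- enum 'I_n].
    by apply/allpairsP; exists (i, j); rewrite !mem_enum.
  have code (B : 'M[bool]_n) sB iB : adj_code (@SGraph n B sB iB) =
      [seq nat_of_bool (B p.1 p.2) |
         p <- [seq (u, v) | u <- enum 'I_n, v <- enum 'I_n]].
    by rewrite map_allpairs.
  rewrite !code in eA; apply/matrixP => i j.
  by have /= := (eq_in_map _ _ _).2 eA _ (mem_all i j); case: (A i j) (A' i j) => [] [].
subst A'; rewrite (bool_irrelevance sA' sA) (bool_irrelevance iA' iA).
by rewrite (bool_irrelevance r0' r0).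
Qed.

Definition OffensiveAlliance (kappa : sgraph -> nat) : param_problem :=
  ParamProblem al_encode_inj
    (fun x => exists S : {set 'I_(num_vertices (al_graph x))},
       offensive_alliance (@edge (al_graph x)) S /\ 1 <= #|S| <= al_size x)
    (fun x => kappa (al_graph x)).

Definition ExactOffensiveAlliance (kappa : sgraph -> nat) : param_problem :=
  ParamProblem al_encode_inj
    (fun x => exists S : {set 'I_(num_vertices (al_graph x))},
       offensive_alliance (@edge (al_graph x)) S /\ #|S| = al_size x)
    (fun x => kappa (al_graph x)).

(* Main.v *)
Require Import Defs.
From mathcomp Require Import all_boot matrix zify.
From mathcomp Require Import boolp.

(** A single polynomial-time reduction from weighted satisfiability of circuits
    of weft 1 and depth [d] serves all eight problems.

    The [k] true inputs of an assignment are listed in increasing order; an input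
    is then true or false according to at most two consecutive entries of the
    list.  Above and including the large gates, a fixed number of additional
    variables (the strategy) holds, for each gate whose value is an existential
    condition on its arguments, an argument that witnesses it.  What remains is a
    conjunction of conditions on functions of at most [2 ^ d] inputs, so that the
    circuit is satisfied iff, for a constant [Q], no [Q] of the variables refute
    it.

    This constraint problem becomes an offensive alliance problem as follows.
    For each [Q]-tuple of variables there is an item for each admissible tuple of
    values.  The size bound allows one item for each tuple, and the number of
    leaves of the chosen items that are adjacent to a "dimension" vertex expresses
    that two tuples agree on a common variable.  Forbidden vertices are neighbours
    of a vertex [z] whose inclusion would exceed the size bound; every alliance
    contains a vertex [y], which makes all dimensions active.  An alliance that
    respects the size bound attains it, so the exact problem is covered as well.

    Without the dimensions, [z] and [y] the graph is a disjoint union of stars,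
    and the number of dimensions depends on [k] and [d] only. *)

Set Implicit Arguments.
Unset Strict Implicit.
Unset Printing Implicit Defensive.

(** * Polynomial-time programs *)

(** Only the number [k + 2 + strat_len d.+1] of blocks is bounded by the parameter, whereas their
    values range up to the circuit size; core vertices indexed by values are therefore ruled out.
    Hence agreement is tested by counting, with one core vertex for each ordered pair of
    occurrences, the two orders giving the two inequalities. The range of the values affects only
    vertices outside the core.

    The strategy is needed because of existential conditions on a large gate: denying one takes
    evidence about every argument, while denying that a named argument witnesses it takes evidence
    about this argument alone. Beyond the large gate, weft 1 leaves gates with at most two
    arguments, where the evidence at most doubles with each level, and an input costs at most two
    blocks. This gives [2 ^ j]; one strategy block for each level on the way down gives the summand
    [j] of the view width, with [j = d.+1]. *)

Class context (T : Type) := Context { word : T -> bitseq; vals : T -> seq nat }.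

#[global] Instance word_context : context bitseq := {| word := id; vals := fun=> [::] |}.

#[global] Instance ext_context (T : Type) (cT : context T) : context (T * nat) :=
  {| word := fun t => word t.1; vals := fun t => t.2 :: vals t.1 |}.

(** The offset keeps the base at least 2, so that constants and sums are absorbed by a larger
    exponent. *)
Definition mag (T : Type) (cT : context T) (t : T) : nat :=
  (size (word t) + sumn (vals t)).+2.

Definition polyb (T : Type) (cT : context T) (B : T -> nat) : Prop :=
  exists k, forall t, B t <= mag cT t ^ k.

Lemma leq_expl m n k : m <= n -> m ^ k <= n ^ k.
Proof. by move=> mn; case: k => // k; rewrite leq_exp2r. Qed.

Section PolyBounds.
Variables (T : Type) (cT : context T).
Implicit Types B : T -> nat.

Lemma mag_gt1 t : 1 < mag cT t. Proof. by []. Qed.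

Lemma leq_mag_exp i j t : i <= j -> mag cT t ^ i <= mag cT t ^ j.
Proof. by move=> ij; rewrite leq_pexp2l. Qed.

Lemma polyb_le B1 B2 : polyb cT B2 -> (forall t, B1 t <= B2 t) -> polyb cT B1.
Proof. by move=> [k B2k] B12; exists k => t; apply: leq_trans (B2k t). Qed.

Lemma polyb_cst n : polyb cT (fun=> n).
Proof.
by exists n => t; apply: leq_trans (ltnW (ltn_expl n (isT : 1 < 2))) (leq_expl _ _).
Qed.

Lemma polyb_mag : polyb cT (mag cT).
Proof. by exists 1 => t; rewrite expn1. Qed.

Lemma polyb_mul B1 B2 : polyb cT B1 -> polyb cT B2 -> polyb cT (fun t => B1 t * B2 t).
Proof.
by move=> [i B1i] [j B2j]; exists (i + j) => t; rewrite expnD leq_mul.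
Qed.

Lemma polyb_exp B k : polyb cT B -> polyb cT (fun t => B t ^ k).
Proof. by move=> [i Bi]; exists (i * k) => t; rewrite expnM leq_expl. Qed.

Lemma polyb_add B1 B2 : polyb cT B1 -> polyb cT B2 -> polyb cT (fun t => B1 t + B2 t).
Proof.
move=> [i B1i] [j B2j]; exists (i + j).+1 => t.
apply: (@leq_trans (mag cT t ^ (i + j) + mag cT t ^ (i + j))).
  by rewrite leq_add // ?(leq_trans (B1i t)) ?(leq_trans (B2j t)) // leq_mag_exp //
    (leq_addr, leq_addl).
by rewrite addnn -mul2n expnS leq_mul2r mag_gt1 orbT.
Qed.

Lemma polyb_ext (B : T * nat -> nat) (b f : T -> nat) :
  polyb (ext_context cT) B -> polyb cT b -> (forall t, f t <= b t) ->
  polyb cT (fun t => B (t, f t)).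
Proof.
move=> [k Bk] pb fb; apply: (polyb_le (polyb_exp k (polyb_add polyb_mag pb))) => t.
apply: leq_trans (Bk _) (leq_expl _ _).
by rewrite /mag /=; have := fb t; lia.
Qed.

End PolyBounds.

Definition input_at (m : memory) (x : bitseq) : Prop :=
  (forall i, m 0 i = nth false x i) /\ m 1 0 = size x.

Definition same_below (o : nat) (m m' : memory) : Prop :=
  forall a i, (a != 2) || (i < o) -> m' a i = m a i.

(* [prog F f]: some program emits the word [F t] and computes the number [f t]
   in time polynomial in [mag t].  Its code depends on the addresses [a] (in
   array 2) of the components of [t] and on the address [o] from which it may
   overwrite array 2; it returns its result in cell [o]. *)
Definition prog (T : Type) (cT : context T) (F : T -> bitseq) (f : T -> nat) : Prop :=
  exists (c : seq nat -> nat -> cmd) (B : T -> nat), polyb cT B /\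
  forall a o t m w, all (ltn^~ o) a -> map (m 2) a = vals t -> input_at m (word t) ->
  exists s m', [/\ exec (c a o) m w s m' (w ++ F t), s <= B t, f t <= B t,
                   same_below o m m' & m' 2 o = f t].

Arguments prog {T cT} F f.

Notation pc f := (prog (fun=> [::]) f).

Lemma same_below_trans o o' m1 m2 m3 : o <= o' ->
  same_below o m1 m2 -> same_below o' m2 m3 -> same_below o m1 m3.
Proof.
move=> oo' H12 H23 a i H; rewrite H23 ?H12 //.
by case/orP: H => [->//|io]; rewrite (leq_trans io oo') orbT.
Qed.

Lemma same_below_update o i n m m' : o <= i ->
  same_below o m m' -> same_below o m (update m' 2 i n).
Proof.
move=> oi H a j jo; rewrite /update -H //; case: eqP jo => //= -> jo.
by case: eqP => // ji; rewrite ji ltnNge oi in jo.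
Qed.

Lemma input_at_same o m m' x : same_below o m m' -> input_at m x -> input_at m' x.
Proof. by move=> H [H0 H1]; split=> [i|]; rewrite H. Qed.

Lemma map_same o a m m' : same_below o m m' -> all (ltn^~ o) a ->
  map (m' 2) a = map (m 2) a.
Proof. by move=> H /allP ao; apply/eq_in_map => i /ao io; rewrite H // io orbT. Qed.

Lemma all_ltn_leq o o' a : o <= o' -> all (ltn^~ o) a -> all (ltn^~ o') a.
Proof. by move=> oo'; apply: sub_all => i /= /leq_trans; apply. Qed.

Lemma updateE m a i n : update m a i n a i = n.
Proof. by rewrite /update !eqxx. Qed.

Lemma update_neq m a i n j : j != i -> update m a i n a j = m a j.
Proof. by rewrite /update => /negPf->; rewrite andbF. Qed.

Section Closure.
Variables (T : Type) (cT : context T).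

Lemma prog_ext F G (f g : T -> nat) :
  prog F f -> F =1 G -> f =1 g -> prog G g.
Proof.
move=> [c [B [pB H]]] FG fg; exists c, B; split=> // a o t m w ao am im.
by have := H a o t m w ao am im; rewrite FG fg.
Qed.

Lemma pc_ext (f g : T -> nat) : pc f -> f =1 g -> pc g.
Proof. by move=> pf fg; apply: prog_ext pf _ fg. Qed.

Lemma pc_expr (x : seq nat -> expr) (f : T -> nat) : polyb cT f ->
  (forall a t m, map (m 2) a = vals t -> input_at m (word t) -> eval m (x a) = f t) ->
  pc f.
Proof.
move=> pf xf; exists (fun a o => Wr 2 (Cst o) (x a)), (fun t => f t + 1).
split=> [|a o t m w ao am im]; first by apply: polyb_add pf (polyb_cst _ _).
exists 1, (update m 2 o (f t)); split; try lia.
- by rewrite cats0 -(xf a t m am im); apply: (ExWr _ (Cst o)).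
- exact: same_below_update.
- exact: updateE.
Qed.

Lemma pc_cst n : pc (fun=> n).
Proof. by apply: (@pc_expr (fun=> Cst n)) => //; apply: polyb_cst. Qed.

Lemma sumn_nth s i : nth 0 s i <= sumn s.
Proof. by elim: s i => [|n s IH] [|i] //=; rewrite ?leq_addr // (leq_trans (IH i)) ?leq_addl. Qed.

Lemma pc_var i : pc (fun t => nth 0 (vals t) i).
Proof.
have pv : polyb cT (fun t => nth 0 (vals t) i).
  apply: polyb_le (polyb_mag cT) _ => t; apply: leq_trans (sumn_nth _ _) _.
  by rewrite /mag; lia.
apply: (@pc_expr (fun a => if i < size a then Rd 2 (Cst (nth 0 a i)) else Cst 0)) => //.
move=> a t m am _; rewrite -am; case: ltnP => [ia|ia] /=; first by rewrite (nth_map 0).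
by rewrite nth_default ?size_map.
Qed.

Lemma pc_size : pc (fun t => size (word t)).
Proof.
apply: (@pc_expr (fun=> Rd 1 (Cst 0))) => [|a t m _ [_ <-]] //.
by apply: polyb_le (polyb_mag cT) _ => t; rewrite /mag; lia.
Qed.

(** The value of [f] stays in cell [o] as a new component of the context, and the second program
    works from [o.+1] on. *)
Lemma prog_let F (f : T -> nat) G (g : T * nat -> nat) :
  prog F f -> prog G g ->
  prog (fun t => F t ++ G (t, f t)) (fun t => g (t, f t)).
Proof.
move=> [c1 [B1 [pB1 H1]]] [c2 [B2 [pB2 H2]]].
exists (fun a o => Seq (c1 a o)
  (Seq (c2 (o :: a) o.+1) (Wr 2 (Cst o) (Rd 2 (Cst o.+1))))),
  (* [f t <= B1 t] is known only during a run, whereas [polyb] concerns all [t]; the minimum is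
     bounded unconditionally. *)
  (fun t => B1 t + (B2 (t, minn (f t) (B1 t)) + 1)); split=> [|a o t m w ao am im].
  apply: polyb_add (pB1) (polyb_add _ (polyb_cst _ _)).
  by apply: polyb_ext pB2 pB1 _ => t; rewrite geq_minr.
have [s1 [m1 [E1 T1 V1 S1 R1]]] := H1 a o t m w ao am im.
have [||| s2 [m2 [E2 T2 V2 S2 R2]]] := H2 (o :: a) o.+1 (t, f t) m1 (w ++ F t).
- by rewrite /= leqnn (all_ltn_leq _ ao).
- by rewrite /= R1 (map_same S1 ao) am.
- exact: input_at_same S1 im.
exists (s1 + (s2 + 1)), (update m2 2 o (g (t, f t))); split.
- rewrite catA; apply: ExSeq E1 _; apply: ExSeq E2 _.
  by rewrite -R2; apply: (ExWr _ (Cst o)).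
- by rewrite (minn_idPl V1) !leq_add.
- by rewrite (minn_idPl V1); apply: leq_trans V2 _; lia.
- exact: same_below_update (leqnn o) (same_below_trans (leqnSn o) S1 S2).
- exact: updateE.
Qed.

Lemma prog_emit (f : T -> nat) : pc f -> prog (fun t => [:: f t != 0]) f.
Proof.
move=> [c [B [pB H]]].
exists (fun a o => Seq (c a o) (Emit (Rd 2 (Cst o)))), (fun t => B t + 1).
split=> [|a o t m w ao am im]; first exact: polyb_add pB (polyb_cst _ _).
have [s [m' [E Ts V S R]]] := H a o t m w ao am im.
exists (s + 1), m'; split=> //; try lia.
rewrite cats0 in E; apply: ExSeq E _; rewrite cats1 -R; exact: (ExEmit (Rd 2 (Cst o))).
Qed.

(** The bound in [prog] presupposes a memory that holds [t]; one is built by placing the components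
    in the first cells of array 2. *)
Lemma pc_bound (f : T -> nat) F : prog F f -> polyb cT f.
Proof.
move=> [c [B [pB H]]]; apply: polyb_le pB _ => t.
pose x := @word T cT t; pose v := @vals T cT t.
pose m : memory := fun b i => match b with
  | 0 => nat_of_bool (nth false x i) | 1 => size x | _ => nth 0 v i end.
have [| | |s [m' [_ _ -> //]]] := H (iota 0 (size v)) (size v) t m [::].
- by apply/allP => i; rewrite mem_iota.
- by rewrite -/(mkseq _ _) mkseq_nth.
- by [].
Qed.

End Closure.

(** A procedure call: the code of the callee is instantiated with the addresses picked by [idx].
    Repeated picks increase the magnitude by a factor of at most [(size idx).+1]. *)
Lemma prog_ren (T U : Type) (cT : context T) (cU : context U) (h : T -> U) (idx : seq nat)
    (F : U -> bitseq) (f : U -> nat) :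
  (forall t, word (h t) = word t) ->
  (forall t, vals (h t) = map (nth 0 (vals t)) idx) ->
  (forall t : T, all (ltn^~ (size (vals t))) idx) ->
  prog F f -> prog (fun t => F (h t)) (fun t => f (h t)).
Proof.
move=> hw hv hidx [c [B [[k Bk] H]]].
exists (fun a o => c (map (nth 0 a) idx) o), (fun t => B (h t)); split=> [|a o t m w ao am im].
  apply: (@polyb_le _ _ _ (fun t => (mag cT t * (size idx).+1) ^ k)) => [|t].
    by apply: polyb_exp; apply: polyb_mul (polyb_mag _) (polyb_cst _ _).
  apply: leq_trans (Bk _) (leq_expl _ _); rewrite /mag hw hv.
  have le_sum: sumn [seq nth 0 (vals t) i | i <- idx] <= size idx * sumn (vals t).
    by elim: idx {hv hidx} => //= i s IH; rewrite mulSn leq_add ?sumn_nth.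
  rewrite mulnS; move: le_sum; set S := sumn (map _ _); set V := sumn _.
  have: size idx * V <= (size (word t) + V).+2 * size idx by rewrite mulnC leq_mul2r; lia.
  by lia.
have sa : size a = size (vals t) by rewrite -am size_map.
apply: H => //; last by rewrite hw.
  apply/allP => _ /mapP [i /(allP (hidx t))/= ii ->].
  by apply: (allP ao); rewrite mem_nth // sa.
rewrite hv -am -map_comp; apply/eq_in_map => i /(allP (hidx t)) /= ii.
by rewrite (nth_map 0) // sa.
Qed.

Lemma prog_weak (T : Type) (cT : context T) (F : T -> bitseq) (f : T -> nat) :
  prog F f -> prog (fun t : T * nat => F t.1) (fun t : T * nat => f t.1).
Proof.
move=> [c [B [[k Bk] H]]].
exists (fun a o => c (behead a) o), (fun t => B t.1).
split=> [|[|x a] o t m w //= /andP[_ ao] [_ am] im].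
  by exists k => t; apply: leq_trans (Bk _) (leq_expl _ _); rewrite /mag /=; lia.
exact: H.
Qed.

Section Loop.
Variables (T : Type) (cT : context T).

(** Cells [o], [o.+1] and [o.+2] hold the accumulator, the counter and the number of rounds; the
    body works from [o.+3] on. The bound [bnd] is a hypothesis because iterating a polynomially
    bounded step, such as doubling, may leave the polynomial range. *)
Lemma prog_loop (n f0 : T -> nat) (G : T * nat * nat -> bitseq) (g : T * nat * nat -> nat)
    (bnd : T -> nat) (acc := fun t i => iteri i (fun j v => g (t, j, v)) (f0 t)) :
  pc n -> pc f0 -> prog G g -> polyb cT bnd ->
  (forall t i, i <= n t -> acc t i <= bnd t) ->
  prog (fun t => flatten [seq G (t, j, acc t j) | j <- iota 0 (n t)])
       (fun t => acc t (n t)).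
Proof.
move=> pn pf [c [B [[k Bk] H]]] pb hb.
have [cn [Bn [pBn Hn]]] := pn; have [cf [Bf [pBf Hf]]] := pf.
pose R i := Rd 2 (Cst i).
pose body a o := Seq (c [:: o, o.+1 & a] o.+3)
  (Seq (Wr 2 (Cst o) (R o.+3)) (Wr 2 (Cst o.+1) (Add (R o.+1) (Cst 1)))).
(* Bounds the time of one round: the counter adds at most [n t] and the accumulator at most [bnd t]
   to the magnitude. *)
pose D t := (mag cT t + n t + bnd t) ^ k.
exists (fun a o => Seq (cn a o.+3) (Seq (Wr 2 (Cst o.+2) (R o.+3))
  (Seq (cf a o.+3) (Seq (Wr 2 (Cst o) (R o.+3)) (Seq (Wr 2 (Cst o.+1) (Cst 0))
  (While (Defs.Sub (R o.+2) (R o.+1)) (body a o))))))),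
  (fun t => Bn t + Bf t + 4 + n t * (D t + 3) + bnd t).
split=> [|a o t m w ao am im].
  have pD : polyb cT D.
    exact: polyb_exp (polyb_add (polyb_add (polyb_mag _) (pc_bound pn)) pb).
  apply: polyb_add (polyb_add (polyb_add (polyb_add pBn pBf) (polyb_cst _ _)) _) pb.
  exact: polyb_mul (pc_bound pn) (polyb_add pD (polyb_cst _ _)).
have o3 : o <= o.+3 by lia.
have [s1 [m1 [E1 T1 V1 S1 R1]]] := Hn a o.+3 t m w (all_ltn_leq o3 ao) am im.
rewrite cats0 in E1; pose m2 := update m1 2 o.+2 (n t).
have S0 m' m'' : same_below o m m' -> same_below o.+3 m' m'' -> same_below o m m''.
  exact: same_below_trans o3.
have S2 : same_below o m m2 by apply: same_below_update (S0 _ _ _ S1); rewrite // !leqW.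
have [||| s3 [m3 [E3 T3 V3 S3 R3]]] := Hf a o.+3 t m2 w.
- exact: all_ltn_leq ao.
- by rewrite (map_same S2).
- exact: input_at_same S2 im.
rewrite cats0 in E3; pose m4 := update m3 2 o (f0 t); pose m5 := update m4 2 o.+1 0.
have S5 : same_below o m m5.
  by do 2![apply: same_below_update; first lia]; apply: S0 S3.
have loop d i mi wi : i + d = n t -> same_below o m mi -> mi 2 o = acc t i ->
    mi 2 o.+1 = i -> mi 2 o.+2 = n t ->
    exists s m', [/\ exec (While (Defs.Sub (R o.+2) (R o.+1)) (body a o)) mi wi s m'
        (wi ++ flatten [seq G (t, j, acc t j) | j <- iota i d]),
        s <= d * (D t + 3) + 1, same_below o m m' & m' 2 o = acc t (n t)].
  elim: d i mi wi => [|d IH] i mi wi.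
    rewrite addn0 => <- Sm Ra Ri Rn; exists 1, mi; split=> //.
    by rewrite cats0; apply: ExWhileEnd; rewrite /= Ri Rn subnn.
  move=> idn Sm Ra Ri Rn.
  have [||| s' [m' [E' T' V' S' R']]] := H [:: o, o.+1 & a] o.+3 (t, i, acc t i) mi wi.
  - by rewrite /= (all_ltn_leq _ ao) // !andbT; lia.
  - by rewrite /= Ra Ri (map_same Sm ao) am.
  - exact: input_at_same Sm im.
  pose m'' := update (update m' 2 o (acc t i.+1)) 2 o.+1 i.+1.
  have [||||| s'' [m3' [E'' T'' S'' R'']]] := IH i.+1 m'' (wi ++ G (t, i, acc t i)).
  - by lia.
  - by do 2![apply: same_below_update; first lia]; apply: S0 S'.
  - by rewrite /m'' update_neq ?updateE //; lia.
  - exact: updateE.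
  - by rewrite /m'' !update_neq ?S' //; lia.
  exists ((s' + (1 + 1)) + s'').+1, m3'; split=> //.
    apply: ExWhile; first by rewrite /= Ri Rn; lia.
      apply: ExSeq E' _; apply: (@ExSeq _ _ _ _ _ (update m' 2 o (acc t i.+1))).
        rewrite /acc iteriS -/(acc t i) -R'; exact: (ExWr _ (Cst o)).
      have := ExWr 2 (Cst o.+1) (Add (R o.+1) (Cst 1)) (update m' 2 o (acc t i.+1)).
      by rewrite /= update_neq ?S' ?Ri ?addn1 //; lia.
    by rewrite /= catA; exact: E''.
  have sD : s' <= D t.
    apply: leq_trans T' _; apply: leq_trans (Bk _) (leq_expl _ _).
    by rewrite /mag /=; have := hb t i; lia.
  by rewrite mulSn; lia.
have [||||| s6 [m6 [E6 T6 S6 R6]]] := loop (n t) 0 m5 w.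
- by [].
- exact: S5.
- by rewrite /m5 update_neq ?/m4 ?updateE //; lia.
- exact: updateE.
- by rewrite /m5 /m4 !update_neq ?S3 /m2 ?updateE //; lia.
exists (s1 + (1 + (s3 + (1 + (1 + s6))))), m6; split=> //.
- apply: ExSeq E1 _; apply: (@ExSeq _ _ _ _ _ m2 w).
    by rewrite /m2 -R1; apply: (ExWr _ (Cst o.+2)).
  apply: ExSeq E3 _; apply: (@ExSeq _ _ _ _ _ m4 w).
    by rewrite /m4 -R3; apply: (ExWr _ (Cst o)).
  by apply: ExSeq E6; apply: (ExWr _ (Cst o.+1) (Cst 0)).
- by lia.
- by have := hb t (n t) (leqnn _); lia.
Qed.

End Loop.

Section Let.
Variables (T : Type) (cT : context T).

Lemma pc_let (f : T -> nat) (g : T * nat -> nat) : pc f -> pc g -> pc (fun t => g (t, f t)).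
Proof. exact: prog_let. Qed.

End Let.

Section Application.
Variables (T : Type) (cT : context T).

Lemma pc_let2 (f1 f2 : T -> nat) (g : T * nat * nat -> nat) :
  pc f1 -> pc f2 -> pc g -> pc (fun t => g (t, f1 t, f2 t)).
Proof.
move=> p1 p2 pg; apply: (@pc_let _ _ _ (fun u => g (u, f2 u.1)) p1).
exact: pc_let (prog_weak p2) pg.
Qed.

Lemma pc_let3 (f1 f2 f3 : T -> nat) (g : T * nat * nat * nat -> nat) :
  pc f1 -> pc f2 -> pc f3 -> pc g -> pc (fun t => g (t, f1 t, f2 t, f3 t)).
Proof.
move=> p1 p2 p3 pg; apply: (@pc_let2 _ _ (fun u => g (u, f3 u.1.1)) p1 p2).
exact: pc_let (prog_weak (prog_weak p3)) pg.
Qed.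

Lemma pc_app1 (F : bitseq -> nat -> nat) (u : T -> nat) :
  pc (fun t : bitseq * nat => F t.1 t.2) -> pc u -> pc (fun t => F (word t) (u t)).
Proof.
move=> pF pu; apply: (@pc_let _ _ _ (fun u => F (word u.1) u.2) pu).
exact: (@prog_ren (T * nat) _ _ _ (fun t => (word t.1, t.2)) [:: 0] _ _ _ _ _ pF).
Qed.

Lemma pc_app2 (F : bitseq -> nat -> nat -> nat) (u v : T -> nat) :
  pc (fun t : bitseq * nat * nat => F t.1.1 t.1.2 t.2) -> pc u -> pc v ->
  pc (fun t => F (word t) (u t) (v t)).
Proof.
move=> pF pu pv; apply: (@pc_let2 _ _ (fun u => F (word u.1.1) u.1.2 u.2) pu pv).
exact: (@prog_ren (T * nat * nat) _ _ _ (fun t => (word t.1.1, t.1.2, t.2))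
  [:: 0; 1] _ _ _ _ _ pF).
Qed.

Lemma pc_app3 (F : bitseq -> nat -> nat -> nat -> nat) (u v w : T -> nat) :
  pc (fun t : bitseq * nat * nat * nat => F t.1.1.1 t.1.1.2 t.1.2 t.2) ->
  pc u -> pc v -> pc w ->
  pc (fun t => F (word t) (u t) (v t) (w t)).
Proof.
move=> pF pu pv pw; apply: (@pc_let3 _ _ _ (fun u => F (word u.1.1.1) u.1.1.2 u.1.2 u.2) pu pv pw).
exact: (@prog_ren (T * nat * nat * nat) _ _ _
  (fun t => (word t.1.1.1, t.1.1.2, t.1.2, t.2)) [:: 0; 1; 2] _ _ _ _ _ pF).
Qed.

End Application.

Lemma polyb_last (T : Type) (cT : context T) : polyb _ (fun t : T * nat => t.2).
Proof. by apply: polyb_le (polyb_mag _) _ => t; rewrite /mag /=; lia. Qed.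

Lemma polyb_weak (T : Type) (cT : context T) (B : T -> nat) :
  polyb _ B -> polyb _ (fun t : T * nat => B t.1).
Proof.
move=> [k Bk]; exists k => t; apply: leq_trans (Bk _) (leq_expl _ _).
by rewrite /mag /=; lia.
Qed.

Section Operations.
Variables (T : Type) (cT : context T).
Implicit Types (f g : T -> nat) (p q : T -> bool).

Lemma pc_add f g : pc f -> pc g -> pc (fun t => f t + g t).
Proof.
move=> pf pg; apply: (@pc_app2 T cT (fun=> addn)) pf pg.
apply: (@pc_expr _ _ (fun a => Add (Rd 2 (Cst (nth 0 a 1))) (Rd 2 (Cst (nth 0 a 0))))).
  by apply: polyb_add (polyb_weak (polyb_last _)) (polyb_last _).
by move=> [|x [|y a]] [[x' u] v] m //= [-> -> _].
Qed.

Lemma pc_sub f g : pc f -> pc g -> pc (fun t => f t - g t).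
Proof.
move=> pf pg; apply: (@pc_app2 T cT (fun=> subn)) pf pg.
apply: (@pc_expr _ _ (fun a => Defs.Sub (Rd 2 (Cst (nth 0 a 1))) (Rd 2 (Cst (nth 0 a 0))))).
  by apply: polyb_le (polyb_weak (polyb_last _)) _ => t; rewrite leq_subr.
by move=> [|x [|y a]] [[x' u] v] m //= [-> -> _].
Qed.

Lemma pc_bit f : pc f -> pc (fun t => nth false (word t) (f t)).
Proof.
move=> pf; apply: (@pc_app1 T cT (nth false)) pf.
apply: (@pc_expr _ _ (fun a => Rd 0 (Rd 2 (Cst (nth 0 a 0))))).
  by apply: polyb_le (polyb_cst _ 1) _ => t; apply: leq_b1.
by move=> [|x a] [x' u] m //= [-> _] [-> _].
Qed.

Lemma pc_iteri n f (g : T * nat * nat -> nat) bnd :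
  pc n -> pc f -> pc g -> polyb _ bnd ->
  (forall t i, i <= n t -> iteri i (fun j v => g (t, j, v)) (f t) <= bnd t) ->
  pc (fun t => iteri (n t) (fun j v => g (t, j, v)) (f t)).
Proof.
move=> pn pf pg pb hb; apply: prog_ext (prog_loop pn pf pg pb hb) _ _ => // t.
by elim: (iota _ _).
Qed.

End Operations.

Section Sums.
Variables (T : Type) (cT : context T).
Implicit Types (f g : T -> nat) (p q : T -> bool).

(** A loop whose accumulator is polynomial without further hypotheses. Products, quotients and
    bounded quantifiers are obtained from it, as the machine only adds and subtracts. *)
Lemma pc_sum n (g : T * nat -> nat) : pc n -> pc g -> pc (fun t => \sum_(i < n t) g (t, i : nat)).
Proof.
move=> pn pg; have [k gk] := pc_bound pg.
have E t i : iteri i (fun j v => v + g (t, j)) 0 = \sum_(j < i) g (t, j : nat).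
  by elim: i => [|i IH]; rewrite ?big_ord0 // iteriS IH big_ord_recr.
apply: pc_ext (E^~ _); apply: (pc_iteri (g := fun t => t.2 + g t.1)
    (bnd := fun t => n t * (mag cT t + n t) ^ k)) => //; first exact: pc_cst.
- by apply: pc_add; [exact: (pc_var _ 0) | exact: prog_weak pg].
- apply: polyb_mul (pc_bound pn) (polyb_exp _ (polyb_add (polyb_mag _) (pc_bound pn))).
move=> t i le_in; rewrite E; apply: (@leq_trans (\sum_(j < i) (mag cT t + n t) ^ k)).
  apply: leq_sum => j _; apply: leq_trans (gk _) (leq_expl _ _).
  by rewrite /mag /=; have := ltn_ord j; lia.
by rewrite sum_nat_const card_ord leq_mul2r le_in orbT.
Qed.

End Sums.

Section Connectives.
Variables (T : Type) (cT : context T).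
Implicit Types (f g : T -> nat) (p q : T -> bool).

Lemma pc_mul f g : pc f -> pc g -> pc (fun t => f t * g t).
Proof.
move=> pf pg; apply: pc_ext (pc_sum pf (prog_weak pg)) _ => t /=.
by rewrite sum_nat_const card_ord.
Qed.

Lemma pc_exp k f : pc f -> pc (fun t => f t ^ k).
Proof.
move=> pf; elim: k => [|k IH]; first exact: pc_cst.
by apply: pc_ext (pc_mul pf IH) _ => t; rewrite expnS.
Qed.

Lemma pc_neg p : pc p -> pc (fun t => ~~ p t).
Proof. by move=> pp; apply: pc_ext (pc_sub (pc_cst _ 1) pp) _ => t; case: (p t). Qed.

Lemma pc_and p q : pc p -> pc q -> pc (fun t => p t && q t).
Proof. by move=> pp pq; apply: pc_ext (pc_mul pp pq) _ => t; case: (p t) (q t) => [] []. Qed.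

Lemma pc_or p q : pc p -> pc q -> pc (fun t => p t || q t).
Proof.
move=> pp pq; apply: pc_ext (pc_neg (pc_and (pc_neg pp) (pc_neg pq))) _ => t.
by rewrite -negb_or negbK.
Qed.

Lemma pc_imp p q : pc p -> pc q -> pc (fun t => p t ==> q t).
Proof.
by move=> pp pq; apply: pc_ext (pc_or (pc_neg pp) pq) _ => t; rewrite implybE.
Qed.

Lemma pc_leq f g : pc f -> pc g -> pc (fun t => f t <= g t).
Proof.
move=> pf pg; apply: pc_ext (pc_sub (pc_cst _ 1) (pc_sub pf pg)) _ => t; lia.
Qed.

Lemma pc_succ f : pc f -> pc (fun t => (f t).+1).
Proof. by move=> pf; apply: pc_ext (pc_add (pc_cst _ 1) pf) _. Qed.

Lemma pc_ltn f g : pc f -> pc g -> pc (fun t => f t < g t).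
Proof. by move=> pf pg; apply: pc_leq (pc_succ pf) pg. Qed.

Lemma pc_eq f g : pc f -> pc g -> pc (fun t => f t == g t).
Proof.
move=> pf pg; apply: pc_ext (pc_and (pc_leq pf pg) (pc_leq pg pf)) _ => t.
by rewrite eqn_leq.
Qed.

Lemma pc_if p f g : pc p -> pc f -> pc g -> pc (fun t => if p t then f t else g t).
Proof.
move=> pp pf pg.
apply: pc_ext (pc_add (pc_mul pp pf) (pc_mul (pc_neg pp) pg)) _ => t.
by case: (p t); lia.
Qed.

Lemma pc_ifb p q (r : T -> bool) : pc p -> pc q -> pc r -> pc (fun t => if p t then q t else r t).
Proof. by move=> pp pq pr; apply: pc_ext (pc_if pp pq pr) _ => t; case: (p t). Qed.

End Connectives.

Section Quantifiers.
Variables (T : Type) (cT : context T).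
Implicit Types (f g : T -> nat) (p q : T -> bool).

Lemma sum_count_iota (a : pred nat) n : \sum_(i < n) (a i : nat) = count a (iota 0 n).
Proof.
elim: n => [|n IH]; first by rewrite big_ord0.
by rewrite big_ord_recr IH -[in RHS]addn1 iotaD count_cat /= addn0.
Qed.

Lemma pc_has n (p : T -> nat -> bool) :
  pc n -> pc (fun u : T * nat => p u.1 u.2) -> pc (fun t => has (p t) (iota 0 (n t))).
Proof.
move=> pn pp; apply: pc_ext (pc_ltn (pc_cst _ 0) (pc_sum pn pp)) _ => t.
by rewrite (sum_count_iota (p t)) has_count.
Qed.

Lemma pc_all n (p : T -> nat -> bool) :
  pc n -> pc (fun u : T * nat => p u.1 u.2) -> pc (fun t => all (p t) (iota 0 (n t))).
Proof.
move=> pn pp; apply: pc_ext (pc_neg (pc_has (p := fun t i => ~~ p t i) pn (pc_neg pp))) _ => t.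
by rewrite -all_predC; congr (nat_of_bool _); apply: eq_all => i /=; rewrite negbK.
Qed.

End Quantifiers.

Lemma sum_leq_mul n y z : 0 < y -> \sum_(j < n) (j.+1 * y <= z) = minn n (z %/ y).
Proof.
move=> y0; elim: n => [|n IH]; first by rewrite big_ord0 min0n.
by rewrite big_ord_recr /= IH -leq_divRL //; lia.
Qed.

Section Division.
Variables (T : Type) (cT : context T).
Implicit Types (f g : T -> nat) (p q : T -> bool).

Lemma pc_div f g : pc f -> pc g -> pc (fun t => f t %/ g t).
Proof.
move=> pf pg.
have ps : pc (fun t => \sum_(j < f t) (j.+1 * g t <= f t)).
  apply: (pc_sum (g := fun u => u.2.+1 * g u.1 <= f u.1)) => //.
  apply: pc_leq (prog_weak pf); apply: pc_mul (prog_weak pg); apply: pc_succ.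
  exact: (pc_var _ 0).
(* For a zero divisor the count would be [f t], whereas [f t %/ 0] is 0. *)
apply: pc_ext (pc_if (pc_eq pg (pc_cst _ 0)) (pc_cst _ 0) ps) _ => t.
case: posnP => [->|g0]; first by rewrite divn0.
by rewrite sum_leq_mul // (minn_idPr (leq_div _ _)).
Qed.

Lemma pc_mod f g : pc f -> pc g -> pc (fun t => f t %% g t).
Proof.
move=> pf pg; apply: pc_ext (pc_sub pf (pc_mul (pc_div pf pg) pg)) _ => t.
by rewrite {1}(divn_eq (f t) (g t)) addKn.
Qed.

End Division.

Lemma prog_cat (T : Type) (cT : context T) F G (f g : T -> nat) :
  prog F f -> prog G g -> prog (fun t => F t ++ G t) g.
Proof. by move=> pf pg; apply: prog_let pf (prog_weak pg). Qed.

Section Output.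
Variables (T : Type) (cT : context T).

Lemma prog_flatten (n : T -> nat) (G : T * nat -> bitseq) g :
  pc n -> prog G g -> prog (fun t => flatten [seq G (t, i) | i <- iota 0 (n t)]) (fun=> 0).
Proof.
move=> pn pG; have pG0 : prog G (fun=> 0).
  by apply: prog_ext (prog_cat pG (pc_cst _ 0)) _ _ => // t; rewrite cats0.
have acc0 (t : T) i : iteri i (fun _ _ => 0) 0 = 0 by case: i.
have le_acc t i : i <= n t -> iteri i (fun _ _ => 0) 0 <= 0 by rewrite (acc0 t).
apply: prog_ext (prog_loop pn (pc_cst _ 0) (prog_weak pG0) (polyb_cst _ 0) le_acc) _ _ => t //.
exact: acc0.
Qed.

Lemma prog_nat (f : T -> nat) : pc f -> prog (fun t => enc_nat (f t)) (fun=> 0).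
Proof.
move=> pf; apply: prog_ext (prog_cat (prog_flatten pf (prog_emit (pc_cst _ 1)))
  (prog_emit (pc_cst _ 0))) _ _ => // t.
rewrite /enc_nat -cats1; congr (_ ++ _).
by rewrite -[in RHS](size_iota 0 (f t)); elim: (iota _ _) => //= _ s ->.
Qed.

End Output.

(** * Composition of programs and of reductions *)

(** Relocating a program by [K] arrays makes it read its input from arrays [K] and [K.+1], clear of
    the memory of a program that ran before. *)
Fixpoint shift_expr (K : nat) (x : expr) : expr :=
  match x with
  | Cst n => Cst n
  | Rd a i => Rd (K + a) (shift_expr K i)
  | Add x y => Add (shift_expr K x) (shift_expr K y)
  | Defs.Sub x y => Defs.Sub (shift_expr K x) (shift_expr K y)
  end.

Fixpoint shift_cmd (K : nat) (c : cmd) : cmd :=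
  match c with
  | Skip => Skip
  | Wr a i x => Wr (K + a) (shift_expr K i) (shift_expr K x)
  | Emit x => Emit (shift_expr K x)
  | Seq c d => Seq (shift_cmd K c) (shift_cmd K d)
  | If x c d => If (shift_expr K x) (shift_cmd K c) (shift_cmd K d)
  | While x c => While (shift_expr K x) (shift_cmd K c)
  end.

Lemma eval_shift K x m M : (forall a i, M (K + a) i = m a i) ->
  eval M (shift_expr K x) = eval m x.
Proof. by move=> H; elim: x => //= [a x ->|x -> y ->|x -> y ->]. Qed.

Lemma exec_shift K c m w t m' w' : exec c m w t m' w' ->
  forall M, (forall a i, M (K + a) i = m a i) ->
  exists2 M', exec (shift_cmd K c) M w t M' w' & forall a i, M' (K + a) i = m' a i.
Proof.
elim=> {c m w t m' w'} /=.
- by move=> m w M H; exists M => //; constructor.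
- move=> a i x m w M H.
  exists (update M (K + a) (eval m i) (eval m x)).
    by rewrite -!(eval_shift _ H); constructor.
  by move=> b j; rewrite /update eqn_add2l H.
- by move=> x m w M H; exists M => //; rewrite -(eval_shift _ H); constructor.
- move=> c1 c2 m w t1 m1 w1 t2 m2 w2 _ IH1 _ IH2 M /IH1[M1 E1 /IH2[M2 E2 H2]].
  by exists M2 => //; apply: ExSeq E1 E2.
- move=> x c1 c2 m w t m' w' _ IH M H; have [M' E H'] := IH M H.
  by exists M' => //; apply: ExIf; rewrite (eval_shift _ H); case: ifP E.
- by move=> x c m w x0 M H; exists M => //; apply: ExWhileEnd; rewrite (eval_shift _ H).
- move=> x c m w t1 m1 w1 t2 m2 w2 x0 _ IH1 _ IH2 M H.
  have [M1 E1 /IH2[M2 E2 H2]] := IH1 M H.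
  by exists M2 => //; apply: ExWhile E1 E2; rewrite (eval_shift _ H).
Qed.

Fixpoint expr_bound (x : expr) : nat :=
  match x with
  | Cst n => 0
  | Rd a i => maxn a.+1 (expr_bound i)
  | Add x y | Defs.Sub x y => maxn (expr_bound x) (expr_bound y)
  end.

Fixpoint cmd_bound (c : cmd) : nat :=
  match c with
  | Skip => 0
  | Wr a i x => maxn a.+1 (maxn (expr_bound i) (expr_bound x))
  | Emit x => expr_bound x
  | Seq c d => maxn (cmd_bound c) (cmd_bound d)
  | If x c d => maxn (expr_bound x) (maxn (cmd_bound c) (cmd_bound d))
  | While x c => maxn (expr_bound x) (cmd_bound c)
  end.

(* Redirects the output to array [K], with its length in cell 0 of array
   [K.+1], as [shift_cmd K] expects its input. *)
Fixpoint redirect (K : nat) (c : cmd) : cmd :=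
  match c with
  | Emit x =>
      Seq (Wr K (Rd K.+1 (Cst 0)) (Defs.Sub (Cst 1) (Defs.Sub (Cst 1) x)))
          (Wr K.+1 (Cst 0) (Add (Rd K.+1 (Cst 0)) (Cst 1)))
  | Seq c d => Seq (redirect K c) (redirect K d)
  | If x c d => If x (redirect K c) (redirect K d)
  | While x c => While x (redirect K c)
  | _ => c
  end.

Definition redirected (K : nat) (m : memory) (w : bitseq) (M : memory) : Prop :=
  (forall a i, a < K -> M a i = m a i) /\
  (forall a i, M (K + a) i = init_memory w a i).

Lemma eval_below K x m M : expr_bound x <= K -> (forall a i, a < K -> M a i = m a i) ->
  eval M x = eval m x.
Proof.
move=> + H; elim: x => //= [a x IH|x IHx y IHy|x IHx y IHy]; rewrite geq_max => /andP[].
- by move=> aK /IH->; rewrite H.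
- by move=> /IHx-> /IHy->.
- by move=> /IHx-> /IHy->.
Qed.

Lemma exec_redirect K c m w t m' w' : exec c m w t m' w' -> cmd_bound c <= K ->
  forall M u, redirected K m w M ->
  exists t' M', [/\ exec (redirect K c) M u t' M' u, t' <= 2 * t & redirected K m' w' M'].
Proof.
elim=> {c m w t m' w'} /=.
- by move=> m w _ M u H; exists 1, M; split=> //; constructor.
- move=> a i x m w; rewrite !geq_max => /and3P[aK iK xK] M u [H1 H2].
  exists 1, (update M a (eval m i) (eval m x)); split=> //.
    by rewrite -(eval_below iK H1) -(eval_below xK H1); constructor.
  split=> [b j bK|b j]; first by rewrite /update H1.
  by rewrite /update [_ == a]gtn_eqF ?H2 // (leq_trans aK) ?leq_addr.
- move=> x m w xK M u [H1 H2].
  pose M1 := update M K (size w) (eval m x != 0).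
  have RK : M K.+1 0 = size w by rewrite -addn1 H2.
  exists (1 + 1), (update M1 K.+1 0 (size w).+1); split=> //.
    apply: (@ExSeq _ _ _ _ _ M1).
      have := ExWr K (Rd K.+1 (Cst 0)) (Defs.Sub (Cst 1) (Defs.Sub (Cst 1) x)) M u.
      (* Double truncated subtraction turns the emitted value into a bit. *)
      rewrite /= RK (eval_below xK H1) (_ : 1 - (1 - eval m x) = (eval m x != 0)); first exact.
      by case: (eval m x).
    have := ExWr K.+1 (Cst 0) (Add (Rd K.+1 (Cst 0)) (Cst 1)) M1 u.
    by rewrite /= (_ : M1 K.+1 0 = size w) ?addn1 // /M1 /update gtn_eqF.
  split=> [a i aK|a i]; rewrite /M1 /update.
    by rewrite (ltn_eqF aK) (ltn_eqF (leqW aK)) H1.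
  rewrite (_ : (K + a == K.+1) = (a == 1)); last lia.
  rewrite (_ : (K + a == K) = (a == 0)) ?H2; last lia.
  case: a => [|[|a]] //=; last by case: i; rewrite ?size_rcons.
  by rewrite nth_rcons; case: ltngtP => // /ltnW iw; rewrite nth_default.
- move=> c1 c2 m w t1 m1 w1 t2 m2 w2 _ IH1 _ IH2.
  rewrite geq_max => /andP[/IH1 {}IH1 /IH2 {}IH2] M u /(IH1 _ u)[s1 [M1 [E1 T1]]].
  move=> /(IH2 _ u)[s2 [M2 [E2 T2 H2]]].
  by exists (s1 + s2), M2; split=> //; [apply: ExSeq E1 E2 | lia].
- move=> x c1 c2 m w t m' w' _ IH; rewrite !geq_max => /and3P[xK c1K c2K] M u H.
  have [|s [M' [E Ts H']]] := IH _ M u H; first by case: ifP.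
  exists s.+1, M'; split=> //; last lia.
  by apply: ExIf; rewrite (eval_below xK H.1); case: ifP E.
- move=> x c m w x0; rewrite !geq_max => /andP[xK cK] M u H.
  by exists 1, M; split=> //; apply: ExWhileEnd; rewrite (eval_below xK H.1).
- move=> x c m w t1 m1 w1 t2 m2 w2 x0 _ IH1 _ IH2 xcK M u H.
  have := xcK; rewrite geq_max => /andP[xK /IH1 {}IH1].
  have [s1 [M1 [E1 T1 /(IH2 xcK _ u)[s2 [M2 [E2 T2 H2]]]]]] := IH1 M u H.
  exists (s1 + s2).+1, M2; split=> //; last lia.
  by apply: ExWhile E1 E2; rewrite (eval_below xK H.1).
Qed.

Lemma outputs_comp (p q : cmd) : exists r, forall x t y s z,
  outputs_in p x t y -> outputs_in q y s z ->
  exists2 t', t' <= 2 * t + s & outputs_in r x t' z.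
Proof.
(* At least 2, so that the arrays from [K] on are initially zero, which is the memory image of the
   empty output. *)
pose K := (cmd_bound p).+2.
exists (Seq (redirect K p) (shift_cmd K q)) => x t y s z [m1 E1] [m2 E2].
have [||t' [M1 [E1' T1 H1]]] := exec_redirect (K := K) E1 _ (M := init_memory x) [::].
- by rewrite /K; lia.
- by split=> // a i; case: a => [|[|a]] /=; rewrite ?nth_nil //; case: i.
have [M2 E2' _] := exec_shift E2 H1.2.
by exists (t' + s); [lia | exists M2; apply: ExSeq E1' E2'].
Qed.

Lemma outputs_size p x t y : outputs_in p x t y -> size y <= t.
Proof.
case=> m E; have: size y <= size (Nil bool) + t; last by [].
elim: E => //= *; rewrite ?size_rcons; lia.
Qed.

Lemma prog_outputs (F : bitseq -> bitseq) f : prog F f ->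
  exists p k, forall x, exists2 t, t <= (size x).+2 ^ k & outputs_in p x t (F x).
Proof.
move=> [c [B [[k Bk] H]]]; exists (c [::] 0), k => x.
have [|||s [m [E Ts _ _ _]]] := H [::] 0 x (init_memory x) [::] => //.
exists s; last by exists m.
by apply: leq_trans Ts (leq_trans (Bk _) _); rewrite /mag /= addn0.
Qed.

Lemma pc_computable (F : bitseq -> nat) : pc F -> computable (fun n => F (enc_nat n)).
Proof.
move=> /prog_nat/prog_outputs[p [k H]]; exists p => n.
by have [t _ E] := H (enc_nat n); exists t.
Qed.

Lemma computable_comp f g : computable f -> computable g -> computable (g \o f).
Proof.
move=> [p Hp] [q Hq]; have [r Hr] := outputs_comp p q; exists r => n.
have [t E] := Hp n; have [s E'] := Hq (f n).
by have [t' _ E''] := Hr _ _ _ _ _ E E'; exists t'.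
Qed.

Lemma size_enc_nat n : size (enc_nat n) = n.+1.
Proof. by rewrite size_rcons size_nseq. Qed.

(** Monotonicity of the parameter bound is required because the parameter of the intermediate
    instance is only bounded by [g1], not equal to it. *)
Lemma fpt_reducible_comp (P Q S : param_problem) (R : instance Q -> instance S)
    (F : bitseq -> bitseq) f (b : bitseq -> nat) :
  fpt_reducible P Q ->
  (forall x, yes x <-> yes (R x)) ->
  prog F f -> (forall x, F (encode x) = encode (R x)) ->
  pc b -> {homo (b \o enc_nat) : i j / i <= j} ->
  (forall x, param (R x) <= b (enc_nat (param x))) ->
  fpt_reducible P S.
Proof.
move=> [R1 [p1 [f1 [g1 [c1 [cf1 cg1 yes1 time1 par1]]]]]] yes2 pF FR pb b_mono par2.
have [p2 [k time2]] := prog_outputs pF.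
have [r Hr] := outputs_comp p1 p2.
(* Put [A = t1 + 2]. The second program reads at most [t1] bits and takes at most [A ^ k] steps;
   [2 * t1 + A ^ k <= A ^ k.+3], and [A] is at most [f1 (param x) + 2] times the power with exponent
   [c1]. *)
exists (R \o R1), r, (fun n => (f1 n).+2 ^ k.+3), (b \o enc_nat \o g1), (c1 * k.+3).
split=> [|||x|x].
- have pe : pc (fun x : bitseq => (size x).+1 ^ k.+3).
    exact: pc_exp (pc_succ (pc_size _)).
  have [q Hq] := computable_comp cf1 (pc_computable pe).
  by exists q => n; have := Hq n; rewrite /= size_enc_nat.
- exact: computable_comp cg1 (pc_computable pb).
- by move=> x; rewrite yes1 yes2.
- have [t1 T1 E1] := time1 x; have [t2 T2 E2] := time2 (encode (R1 x)).
  have [t T E] := Hr _ _ _ _ _ E1 E2; exists t; last by rewrite /= -FR.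
  have y_t1 := outputs_size E1.
  have {}T1 : t1.+2 <= (f1 (param x)).+2 * (size (encode x)).+1 ^ c1.
    have : 0 < (size (encode x)).+1 ^ c1 by rewrite expn_gt0.
    by move: T1; set X := _ ^ c1; nia.
  rewrite expnM -expnMn; apply: leq_trans (leq_expl _ T1).
  have {}T2 : t2 <= t1.+2 ^ k by apply: leq_trans T2 (leq_expl _ _).
  apply: leq_trans T _; rewrite expnS.
  have : t1.+2 ^ k <= t1.+2 ^ k.+2 by rewrite leq_pexp2l // leqW.
  have : t1.+2 ^ 2 <= t1.+2 ^ k.+2 by rewrite leq_pexp2l.
  by move: (t1.+2 ^ k.+2) T2 => X; move: (t1.+2 ^ k) => Y; nia.
- by apply: leq_trans (par2 _) _; apply: b_mono.
Qed.

(** * Circuits of weft 1 as constraint satisfaction *)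

(** Digit [i] of [x] in base [B]. Iterated division keeps all intermediate values at most [x],
    whereas [B ^ i] with variable [i] has no polynomial bound. *)
Definition dig (B x i : nat) : nat := iter i (fun y => y %/ B) x %% B.

Definition undig (B n : nat) (f : nat -> nat) : nat := \sum_(i < n) f i * B ^ i.

Lemma undigS B n f : undig B n.+1 f = f 0 + B * undig B n (fun i => f i.+1).
Proof.
rewrite /undig big_ord_recl muln1 big_distrr; congr (_ + _).
by apply: eq_bigr => i _; rewrite expnS mulnCA.
Qed.

Lemma undig_ltn B n f : (forall i, i < n -> f i < B) -> undig B n f < B ^ n.
Proof.
elim: n f => [|n IH] f fB; first by rewrite /undig big_ord0.
rewrite undigS expnS.
have := fB 0 isT; have := IH (fun i => f i.+1) (fun i => fB i.+1).
by set u := undig _ _ _; set X := B ^ n; nia.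
Qed.

Lemma dig_undig B n f i : (forall i, i < n -> f i < B) -> i < n ->
  dig B (undig B n f) i = f i.
Proof.
rewrite /dig; elim: n f i => [|n IH] f i fB //; rewrite undigS.
have f0 := fB 0 isT; have B0 : 0 < B by apply: leq_ltn_trans f0.
case: i => [|i] i_n; first by rewrite /= addnC mulnC modnMDl modn_small.
rewrite iterSr addnC mulnC divnMDl // divn_small // addn0.
exact: (IH (fun i => f i.+1)) (fun i => fB i.+1) i_n.
Qed.

Lemma dig_ltn B x i : 0 < B -> dig B x i < B.
Proof. by move=> B0; rewrite ltn_mod. Qed.

(* The number of strategy blocks of a node at height [j]: one for the node
   itself, and [strat_len j.-1] for each of at most two arguments. *)
Fixpoint strat_len (j : nat) : nat := if j is i.+1 then (strat_len i + strat_len i).+1 else 0.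

(* [ty], [ar] and [ag] give the type (0: input, 1: not, 2: and, 3: or), the
   arity and the arguments of a node.  A solution assigns a value to each
   block: block 0 holds 0, blocks 1, ..., k hold the successors of the chosen
   inputs in increasing order, block [k.+1] holds [n.+1], and block [k + 2 + o]
   is strategy block [o].  A view shows the values [c q] of the blocks [s q] for
   [q < Q]. *)
Section View.
Variables (ty ar : nat -> nat) (ag : nat -> nat -> nat).
Variables (k Q : nat) (s c : nat -> nat).

Definition known_true (v : nat) : bool :=
  has (fun q => [&& 0 < s q, s q <= k & c q == v.+1]) (iota 0 Q).

(* An input is off if it lies strictly between two consecutive chosen ones. *)
Definition known_false (v : nat) : bool :=
  has (fun q => has (fun r =>
    [&& s r == (s q).+1, s q <= k, c q < v.+1 & v.+1 < c r]) (iota 0 Q)) (iota 0 Q).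

(* Whether having value [b] is a condition on all arguments of the gate [v]. *)
Definition universal (v : nat) (b : bool) : bool := (ty v == 2) == b.

(* The view does not rule out that [v] has value [b]. *)
Fixpoint possible (j v : nat) (b : bool) : bool :=
  if j is i.+1 then
    if ty v == 0 then if b then ~~ known_false v else ~~ known_true v
    else if ty v == 1 then possible i (ag v 0) (~~ b)
    else if universal v b then all (fun l => possible i (ag v l) b) (iota 0 (ar v))
    else has (fun l => possible i (ag v l) b) (iota 0 (ar v))
  else true.

(* As [possible], but at the gates down to the first large one, where all views
   must agree on an argument that makes a non-universal condition true, this
   argument is read from the strategy block [o] of the gate. *)
Fixpoint unrefuted (j v : nat) (b : bool) (o : nat) : bool :=
  if j is i.+1 then
    if ty v == 0 then if b then ~~ known_false v else ~~ known_true v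
    else if ty v == 1 then unrefuted i (ag v 0) (~~ b) o.+1
    else if universal v b then
      if ar v <= 2 then
        ((0 < ar v) ==> unrefuted i (ag v 0) b o.+1) &&
        ((1 < ar v) ==> unrefuted i (ag v 1) b (o.+1 + strat_len i))
      else all (fun l => possible i (ag v l) b) (iota 0 (ar v))
    else all (fun q => (s q == k + 2 + o) ==>
      has (fun l => ag v l == c q) (iota 0 (ar v)) &&
      (if ar v <= 2 then unrefuted i (c q) b o.+1 else possible i (c q) b)) (iota 0 Q)
  else true.

Definition well_placed (n : nat) : bool :=
  all (fun q => [&& (s q == 0) ==> (c q == 0), (s q == k.+1) ==> (c q == n.+1)
                  & (0 < s q) && (s q <= k) ==> (ty (c q).-1 == 0)]) (iota 0 Q) &&
  all (fun q => all (fun r =>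
    (s r == (s q).+1) && (s q <= k) ==> (c q < c r)) (iota 0 Q)) (iota 0 Q).

Definition allowed (j n : nat) : bool := well_placed n && unrefuted j n.-1 true 0.

End View.

Definition covers (Q : nat) (s : nat -> nat) (Z : seq nat) : Prop :=
  forall z, z \in Z -> exists2 q, q < Q & s q = z.

Lemma covers_cat Q s Z1 Z2 : covers Q s (Z1 ++ Z2) -> covers Q s Z1 /\ covers Q s Z2.
Proof. by move=> H; split=> z zZ; apply: H; rewrite mem_cat zZ ?orbT. Qed.

(** * Views against the values of the nodes *)

Section Evaluation.
Variables (ty ar : nat -> nat) (ag : nat -> nat -> nat) (n : nat).
Variables (a val : nat -> bool) (dep wft : nat -> nat).

Definition args (v : nat) : seq nat :=
  if ty v == 0 then [::] else if ty v == 1 then [:: ag v 0] else map (ag v) (iota 0 (ar v)).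

Hypothesis args_ltn : forall v u, v < n -> u \in args v -> u < n.
Hypothesis val_input : forall v, v < n -> ty v = 0 -> val v = a v.
Hypothesis val_not : forall v, v < n -> ty v = 1 -> val v = ~~ val (ag v 0).
Hypothesis val_gate : forall v, v < n -> 1 < ty v ->
  val v = if ty v == 2 then all val (args v) else has val (args v).
Hypothesis dep_args : forall v u, v < n -> u \in args v -> dep u < dep v.
Hypothesis wft_args : forall v u, v < n -> u \in args v ->
  (2 < size (args v)) + wft u <= wft v.
Hypothesis wft_large : forall v, v < n -> (2 < size (args v)) <= wft v.

Lemma args_gate v : 1 < ty v -> args v = map (ag v) (iota 0 (ar v)).
Proof. by rewrite /args; case: (ty v) => [|[|?]]. Qed.

Lemma val_universal v b : v < n -> 1 < ty v -> universal ty v b ->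
  (val v == b) = all (fun u => val u == b) (args v).
Proof.
move=> vn tyv /eqP; rewrite (val_gate vn tyv); case: (ty v == 2) => <- /=.
  by rewrite eqb_id; apply: eq_all => u; rewrite eqb_id.
by rewrite eqbF_neg -all_predC; apply: eq_all => u /=; rewrite eqbF_neg.
Qed.

(** Replacing [b] by its negation exchanges universal and existential conditions, so this is the
    dual of [val_universal]. *)
Lemma val_existential v b : v < n -> 1 < ty v -> ~~ universal ty v b ->
  (val v == b) = has (fun u => val u == b) (args v).
Proof.
move=> vn tyv uv.
have uN : universal ty v (~~ b) by move: uv; rewrite /universal; case: (_ == 2) b => [] [].
have N x : (x == ~~ b) = ~~ (x == b) by case: x b {uv uN} => [] [].
have := val_universal vn tyv uN; rewrite N => E.
by rewrite -[LHS]negbK E -has_predC; apply: eq_has => u /=; rewrite N negbK.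
Qed.

Lemma args_nth v l : 1 < ty v -> l < ar v -> ag v l \in args v.
Proof. by move=> tyv lv; rewrite args_gate // map_f // mem_iota. Qed.

Lemma size_args v : 1 < ty v -> size (args v) = ar v.
Proof. by move=> tyv; rewrite args_gate // size_map size_iota. Qed.

Lemma ty_cases v (P : Prop) : (ty v = 0 -> P) -> (ty v = 1 -> P) -> (1 < ty v -> P) -> P.
Proof. by case: (ty v) => [|[|t]] H0 H1 H2; [apply: H0 | apply: H1 | apply: H2]. Qed.

Definition sound_view (k Q : nat) (s c : nat -> nat) : Prop :=
  (forall v, known_true k Q s c v -> a v) /\ (forall v, known_false k Q s c v -> ~~ a v).

Lemma input_sound k Q s c v b : sound_view k Q s c -> v < n -> ty v = 0 -> val v = b ->
  if b then ~~ known_false k Q s c v else ~~ known_true k Q s c v.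
Proof.
move=> [kt kf] vn tv; rewrite val_input //; case: b => av; apply/negP.
  by move/kf; rewrite av.
by move/kt; rewrite av.
Qed.

Lemma possible_sound k Q s c j v b : sound_view k Q s c ->
  v < n -> val v = b -> possible ty ar ag k Q s c j v b.
Proof.
move=> sv; elim: j v b => [|j IH] v b vn vb //=.
apply: (@ty_cases v) => tv.
- by rewrite tv; apply: input_sound.
- rewrite tv; apply: IH; last by rewrite -vb (val_not vn tv) negbK.
  by apply: (args_ltn vn); rewrite /args tv mem_seq1.
have t0 : (ty v == 0) = false by lia.
have t1 : (ty v == 1) = false by lia.
rewrite t0 t1; move/eqP: vb; case: ifP => uv.
  rewrite val_universal // args_gate // all_map => /allP H; apply/allP => l li.
  apply: IH; last exact/eqP/(H l li).
  by apply: (args_ltn vn); rewrite args_nth //; rewrite mem_iota in li.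
rewrite val_existential ?uv // args_gate // has_map => /hasP[l li /= /eqP H].
apply/hasP; exists l => //; apply: IH H.
by apply: (args_ltn vn); rewrite args_nth //; rewrite mem_iota in li.
Qed.

(** The strategy [e] precedes the view in the order of quantifiers, since it depends on the true
    values only: block [o] of an existential gate names an argument with the required value.
    Agreement with [e] is asked only on the range of this node, so that the strategies of two
    arguments can be glued. *)
Lemma unrefuted_complete k j v b o : v < n -> val v = b ->
  exists e : nat -> nat, (forall i, e i < n) /\
    forall Q s c e', sound_view k Q s c ->
      (forall i, o <= i < o + strat_len j -> e' i = e i) ->
      (forall q i, q < Q -> s q = k + 2 + i -> c q = e' i) ->
      unrefuted ty ar ag k Q s c j v b o.
Proof.
elim: j v b o => [|j IH] v b o vn vb; first by exists (fun=> v).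
have arg_n l : 1 < ty v -> l < ar v -> ag v l < n.
  by move=> tv lv; apply: args_ltn (args_nth tv lv).
apply: (@ty_cases v) => tv.
- by exists (fun=> v); split=> // *; rewrite /= tv; apply: input_sound.
- have [||e [en He]] := IH (ag v 0) (~~ b) o.+1.
  + by apply: (args_ltn vn); rewrite /args tv mem_seq1.
  + by rewrite -vb (val_not vn tv) negbK.
  exists e; split=> // Q s c e' sv ee' ce'; rewrite /= tv /=.
  by apply: He ce' => // i io; apply: ee' => /=; lia.
have t0 : (ty v == 0) = false by lia.
have t1 : (ty v == 1) = false by lia.
case uv: (universal ty v b).
  case: (leqP (ar v) 2) => arv; last first.
    exists (fun=> v); split=> // Q s c e' sv _ _; rewrite /= t0 t1 uv leqNgt arv /=.
    move/eqP: vb; rewrite val_universal // args_gate // all_map => /allP H.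
    apply/allP => l li; apply: possible_sound => //; last exact/eqP/(H l li).
    by apply: arg_n => //; rewrite mem_iota in li.
  have child l o' : exists e : nat -> nat, (forall i, e i < n) /\
      (l < ar v -> forall Q s c e', sound_view k Q s c ->
      (forall i, o' <= i < o' + strat_len j -> e' i = e i) ->
      (forall q i, q < Q -> s q = k + 2 + i -> c q = e' i) ->
      unrefuted ty ar ag k Q s c j (ag v l) b o').
    case: (ltnP l (ar v)) => lv; last by exists (fun=> v).
    have [|e [en He]] := IH (ag v l) b o' (arg_n _ tv lv); last by exists e.
    move/eqP: vb; rewrite val_universal // args_gate // all_map => /allP /(_ l).
    by rewrite mem_iota => /(_ lv) /eqP.
  have [e0 [e0n H0]] := child 0 o.+1.
  have [e1 [e1n H1]] := child 1 (o.+1 + strat_len j).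
  (* The ranges of the two arguments are adjacent and disjoint. *)
  exists (fun i => if i < o.+1 + strat_len j then e0 i else e1 i).
  split=> [i|Q s c e' sv ee' ce']; first by case: ifP.
  rewrite /= t0 t1 uv arv; apply/andP; split; apply/implyP => arl.
    by apply: H0 ce' => // i io; rewrite ee' /=; [rewrite ifT | ]; lia.
  by apply: H1 ce' => // i io; rewrite ee' /=; [rewrite ifF | ]; lia.
move/eqP: vb; rewrite val_existential ?uv // => /hasP[u uv' /eqP vu].
have un := args_ltn vn uv'.
have [e [en He]] := IH u b o.+1 un vu.
exists (fun i => if i == o then u else e i); split=> [i|Q s c e' sv ee' ce'].
  by case: ifP.
rewrite /= t0 t1 uv; apply/allP => q; rewrite mem_iota /= => qQ; apply/implyP => /eqP sq.
have cq : c q = u by rewrite (ce' q o) // ee' ?eqxx //= leqnn; lia.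
rewrite cq; apply/andP; split.
  by move: uv'; rewrite args_gate // => /mapP[l li ->]; apply/hasP; exists l.
case: ifP => _; last exact: possible_sound.
by apply: He ce' => // i io; rewrite ee' /=; [rewrite ifF | ]; lia.
Qed.

Section Refutation.
Variables (k : nat) (V : nat -> nat).
Hypothesis V_true : forall v, v < n -> ty v = 0 -> a v -> exists2 b, 0 < b <= k & V b = v.+1.
Hypothesis V_false : forall v, v < n -> ty v = 0 -> ~~ a v ->
  exists2 b, b <= k & V b < v.+1 < V b.+1.

(* [P] fails in every view that shows [r] suitable blocks below [m]. *)
Definition refuted (m r : nat) (P : nat -> (nat -> nat) -> (nat -> nat) -> bool) : Prop :=
  exists Z, [/\ size Z <= r, all (ltn^~ m) Z &
    forall Q s c, covers Q s Z -> (forall q, q < Q -> c q = V (s q)) -> ~~ P Q s c].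

Lemma refuted_le m m' r r' P (P' : nat -> (nat -> nat) -> (nat -> nat) -> bool) :
  refuted m r P -> m <= m' -> r <= r' ->
  (forall Q s c, P' Q s c -> P Q s c) -> refuted m' r' P'.
Proof.
move=> [Z [Zr Zm H]] mm rr PP; exists Z; split; first exact: leq_trans rr.
  by apply: sub_all Zm => z /= /leq_trans; apply.
by move=> Q s c cov cV; apply: contra (H Q s c cov cV); apply: PP.
Qed.

Lemma input_refuted v b : v < n -> ty v = 0 -> val v != b ->
  refuted (k + 2) 2
    (fun Q s c => if b then ~~ known_false k Q s c v else ~~ known_true k Q s c v).
Proof.
move=> vn tv; rewrite val_input //; case: b => av.
  have [|b bk Vb] := V_false vn tv; first by move: av; case: (a v).
  exists [:: b; b.+1]; split=> //=; first by rewrite !andbT; apply/andP; split; lia.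
  move=> Q s c cov cV; rewrite negbK.
  have [|q qQ sq] := cov b; first by rewrite inE eqxx.
  have [|r rQ sr] := cov b.+1; first by rewrite !inE eqxx orbT.
  apply/hasP; exists q; rewrite ?mem_iota //; apply/hasP; exists r; rewrite ?mem_iota //.
  by rewrite !cV // sq sr eqxx bk.
have [|b bk Vb] := V_true vn tv; first by move: av; case: (a v).
exists [:: b]; split=> //=; first by rewrite andbT; lia.
move=> Q s c cov cV; rewrite negbK; have [|q qQ sq] := cov b; first exact: mem_head.
by apply/hasP; exists q; rewrite ?mem_iota // cV // sq Vb eqxx andbT.
Qed.

(** Denying a universal condition takes one bad argument; denying an existential one takes all
    arguments, at most two because the weft is 0. So the number of blocks at most doubles per level.
    The two blocks of an input fit since [dep v < j] forces [0 < j]. *)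
Lemma possible_refuted j v b : v < n -> dep v < j -> wft v = 0 -> val v != b ->
  refuted (k + 2) (2 ^ j) (fun Q s c => possible ty ar ag k Q s c j v b).
Proof.
elim: j v b => [|j IH] v b vn // dj wv vb.
have argP u : u \in args v -> [/\ u < n, dep u < j & wft u = 0].
  move=> uv; split; first exact: args_ltn uv.
    by have := dep_args vn uv; lia.
  by have := wft_args vn uv; rewrite wv; lia.
apply: (@ty_cases v) => tv.
- apply: refuted_le (input_refuted vn tv vb) _ _ _ => // [|Q s c]; last by rewrite /= tv.
  by rewrite -[X in X <= _]expn1 leq_pexp2l.
- have [|un du wu] := argP (ag v 0); first by rewrite /args tv mem_seq1.
  have [|Z [Zr Zm H]] := IH (ag v 0) (~~ b) un du wu.
    by move: vb; rewrite (val_not vn tv); case: (val _) b => [] [].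
  exists Z; split=> //; first by apply: leq_trans Zr _; rewrite leq_pexp2l.
  by move=> Q s c cov cV; rewrite /= tv /=; apply: H.
have t0 : (ty v == 0) = false by lia.
have t1 : (ty v == 1) = false by lia.
case uv: (universal ty v b).
  move: vb; rewrite val_universal // args_gate // all_map -has_predC => /hasP[l li /= vb].
  have lv : l < ar v by rewrite mem_iota in li.
  have [un du wu] := argP _ (args_nth tv lv).
  have [Z [Zr Zm H]] := IH _ _ un du wu vb.
  exists Z; split=> //; first by apply: leq_trans Zr _; rewrite leq_pexp2l.
  move=> Q s c cov cV; rewrite /= t0 t1 uv -has_predC; apply/hasP; exists l => //.
  exact: H.
have ar2 : ar v <= 2.
  by have := wft_large vn; rewrite wv size_args //; case: ltnP.
have vb' l : l < ar v -> val (ag v l) != b.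
  move=> lv; apply: contra vb => vb; rewrite val_existential ?uv //.
  by apply/hasP; exists (ag v l); first exact: args_nth.
have child l : exists Z, [/\ size Z <= 2 ^ j, all (ltn^~ (k + 2)) Z &
    l < ar v -> forall Q s c, covers Q s Z -> (forall q, q < Q -> c q = V (s q)) ->
    ~~ possible ty ar ag k Q s c j (ag v l) b].
  case: (ltnP l (ar v)) => lv; last by exists [::].
  have [un du wu] := argP _ (args_nth tv lv).
  by have [Z [Zr Zm H]] := IH _ _ un du wu (vb' l lv); exists Z.
have [Z0 [Z0r Z0m H0]] := child 0; have [Z1 [Z1r Z1m H1]] := child 1.
exists (Z0 ++ Z1); split.
- by rewrite size_cat expnS mul2n -addnn leq_add.
- by rewrite all_cat Z0m.
move=> Q s c /covers_cat[cov0 cov1] cV; rewrite /= t0 t1 uv -all_predC.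
apply/allP => l; rewrite mem_iota /= => lv.
by case: l lv => [|[|l]] lv; [apply: H0 | apply: H1 | lia].
Qed.

(** The refutation descends along a single path: to an argument with the wrong value at a universal
    gate, to the argument named by the strategy block at an existential one. Each level adds at most
    that block. Past a large gate the weft is 0 and [possible_refuted] takes over. *)
Lemma unrefuted_refuted j v b o : v < n -> dep v < j -> wft v <= 1 -> val v != b ->
  refuted (k + 2 + (o + strat_len j)) (2 ^ j + j)
    (fun Q s c => unrefuted ty ar ag k Q s c j v b o).
Proof.
elim: j v b o => [|j IH] v b o vn // dj wv vb.
have jS : 2 ^ j <= 2 ^ j.+1 by rewrite leq_pexp2l.
have argP u : u \in args v -> [/\ u < n, dep u < j, wft u <= 1 & 2 < size (args v) -> wft u = 0].
  move=> uv; have := wft_args vn uv; have := dep_args vn uv; move/(args_ltn vn): uv => un.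
  by move=> da wa; split=> //; [lia | lia | move=> sz; move: wa; rewrite sz; lia].
have kl m : k + 2 <= k + 2 + m by lia.
apply: (@ty_cases v) => tv.
- apply: refuted_le (input_refuted vn tv vb) (kl _) _ _ => [|Q s c]; last by rewrite /= tv.
  by have := ltn_expl j.+1 (isT : 1 < 2); lia.
- have [|un du wu _] := argP (ag v 0); first by rewrite /args tv mem_seq1.
  have vb' : val (ag v 0) != ~~ b.
    by move: vb; rewrite (val_not vn tv); case: (val _) b => [] [].
  apply: refuted_le (IH _ _ o.+1 un du wu vb') _ _ _ => [||Q s c]; rewrite /= ?tv //; lia.
have t0 : (ty v == 0) = false by lia.
have t1 : (ty v == 1) = false by lia.
case uv: (universal ty v b).
  move: vb; rewrite val_universal // args_gate // all_map -has_predC => /hasP[l li /= vb].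
  have lv : l < ar v by rewrite mem_iota in li.
  have [un du wu wu0] := argP _ (args_nth tv lv).
  rewrite size_args // in wu0.
  case: (leqP (ar v) 2) => arv; last first.
    apply: refuted_le (possible_refuted un du (wu0 arv) vb) (kl _) _ _ => [|Q s c]; first lia.
    by rewrite /= t0 t1 uv /= => /allP; apply.
  have l2 : l < 2 by apply: leq_trans arv.
  pose o' := if l == 0 then o.+1 else o.+1 + strat_len j.
  have o'j : o' + strat_len j <= o + strat_len j.+1 by rewrite /o' /=; case: ifP; lia.
  apply: refuted_le (IH _ _ o' un du wu vb) _ _ _ => [||Q s c]; [by rewrite leq_add2l | lia |].
  rewrite /= t0 t1 uv /o'.
  by case: l l2 lv {li vb un du wu wu0 o' o'j} => [|[|//]] _ -> /= /andP[].
have vb' u : u \in args v -> val u != b.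
  by move=> uv'; apply: contra vb => vb; rewrite val_existential ?uv //; apply/hasP; exists u.
pose u := V (k + 2 + o).
have uZ Z Q s c : covers Q s (k + 2 + o :: Z) -> (forall q, q < Q -> c q = V (s q)) ->
    (u \in args v -> ~~ (if ar v <= 2 then unrefuted ty ar ag k Q s c j u b o.+1
                         else possible ty ar ag k Q s c j u b)) ->
    ~~ unrefuted ty ar ag k Q s c j.+1 v b o.
  move=> cov cV H; rewrite /= t0 t1 uv -has_predC.
  have [|q qQ sq] := cov (k + 2 + o); first exact: mem_head.
  apply/hasP; exists q; rewrite ?mem_iota //= sq eqxx /= cV // sq -/u.
  apply/negP => /andP[/hasP[l li /eqP agl] Hu].
  have ua : u \in args v by rewrite -agl args_nth //; rewrite mem_iota in li.
  by move: (H ua); rewrite Hu.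
have covI Q s z Z : covers Q s (z :: Z) -> covers Q s Z.
  by move=> cov y yZ; apply: cov; rewrite inE yZ orbT.
(* A strategy block that names no argument of the gate is a refutation by itself. *)
case uv': (u \in args v); last first.
  exists [:: k + 2 + o]; split=> /=; [lia | by rewrite andbT; lia |].
  by move=> Q s c cov cV; apply: uZ cov cV _; rewrite uv'.
have [un du wu wu0] := argP _ uv'.
rewrite size_args // in wu0.
case: (leqP (ar v) 2) => arv.
  have [Z [Zr Zm H]] := IH _ _ o.+1 un du wu (vb' _ uv').
  exists (k + 2 + o :: Z); split=> /=; [lia | |].
    apply/andP; split; first lia.
    by apply: sub_all Zm => z /=; lia.
  by move=> Q s c cov cV; apply: uZ (cov) (cV) _ => _; rewrite arv; apply: H => //; apply: covI cov.
have [Z [Zr Zm H]] := possible_refuted un du (wu0 arv) (vb' _ uv').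
exists (k + 2 + o :: Z); split=> /=; [lia | |].
  apply/andP; split; first lia.
  by apply: sub_all Zm => z /=; lia.
move=> Q s c cov cV; apply: uZ (cov) (cV) _ => _; rewrite leqNgt arv /=; apply: H => //.
exact: covI cov.
Qed.

End Refutation.

End Evaluation.

(** * Values, depth and weft of the nodes of a circuit *)

Lemma sweep_rcons (T : Type) (F : seq T -> gate -> T) C g :
  sweep F (rcons C g) = rcons (sweep F C) (F (sweep F C) g).
Proof. by rewrite /sweep foldl_rcons. Qed.

Lemma size_sweep (T : Type) (F : seq T -> gate -> T) C : size (sweep F C) = size C.
Proof. by elim/last_ind: C => // C g IH; rewrite sweep_rcons !size_rcons IH. Qed.

Lemma nth_sweep (T : Type) (F : seq T -> gate -> T) C x0 v : v < size C ->
  nth x0 (sweep F C) v = F (take v (sweep F C)) (nth Input C v).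
Proof.
elim/last_ind: C => // C g IH; rewrite sweep_rcons !nth_rcons size_rcons size_sweep ltnS.
rewrite leq_eqVlt => /orP[/eqP->|vC].
  by rewrite ltnn eqxx -cats1 take_size_cat ?size_sweep.
by rewrite vC -cats1 take_cat size_sweep vC IH.
Qed.

Lemma last_sweep (T : Type) (F : seq T -> gate -> T) C x0 :
  last x0 (sweep F C) = nth x0 (sweep F C) (size C).-1.
Proof. by rewrite -nth_last size_sweep. Qed.

(** Ties a gate to numeric functions, which will later be read off the encoded word; the reduction
    never builds the circuit as a data structure. *)
Definition gate_spec (g : gate) (t r : nat) (f : nat -> nat) : Prop :=
  match g with
  | Input => t = 0
  | Not i => t = 1 /\ f 0 = i
  | And s => [/\ t = 2, r = size s & forall l, l < size s -> f l = nth 0 s l]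
  | Or s => [/\ t = 3, r = size s & forall l, l < size s -> f l = nth 0 s l]
  end.

Section Circuit.
Variables (C : circuit) (wfC : wf_circuit C).
Variables (ty ar : nat -> nat) (ag : nat -> nat -> nat).
Let n := size C.
Hypothesis spec : forall v, v < n -> gate_spec (nth Input C v) (ty v) (ar v) (ag v).

Lemma gate_argsE v : v < n -> gate_args (nth Input C v) = args ty ar ag v.
Proof.
move=> vn; have := spec vn; rewrite /args.
have nth_args (s : seq nat) : (forall l, l < size s -> ag v l = nth 0 s l) ->
    s = [seq ag v i | i <- iota 0 (size s)].
  move=> H; apply: (@eq_from_nth _ 0); rewrite ?size_map ?size_iota // => l ls.
  by rewrite (nth_map 0) ?size_iota // nth_iota // H.
case: (nth Input C v) => [|i|s|s] /=; first by move=> ->.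
- by move=> [-> ->].
- by move=> [-> -> H]; apply: nth_args.
- by move=> [-> -> H]; apply: nth_args.
Qed.

Lemma args_below v u : v < n -> u \in args ty ar ag v -> u < v.
Proof.
move=> vn; rewrite -gate_argsE // => uv.
by have /andP[_ /allP /(_ v)] := wfC; rewrite mem_iota vn => /(_ isT) /allP; apply.
Qed.

Lemma circuit_size_gt0 : 0 < n.
Proof. by case/andP: wfC. Qed.

Lemma is_inputE v : v < n -> is_input (nth Input C v) = (ty v == 0).
Proof.
by move=> /spec; case: (nth _ _ _) => [->|i [-> _]|s [-> _ _]|s [-> _ _]].
Qed.

Section Values.
Variable a : nat -> bool.
Let eval_gate := fun (vals : seq bool) g =>
    match g with
    | Input => a (size vals)
    | Not i => ~~ nth false vals i
    | And s => all (nth false vals) s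
    | Or s => has (nth false vals) s
    end.

Definition node_value v := nth false (sweep eval_gate C) v.

Lemma node_value_last : circuit_value a C = node_value n.-1.
Proof. exact: last_sweep. Qed.

Lemma node_valueE v : v < n ->
  node_value v = match nth Input C v with
    | Input => a v
    | Not i => ~~ node_value i
    | And s => all node_value s
    | Or s => has node_value s
    end.
Proof.
move=> vn; rewrite {1}/node_value nth_sweep //.
have := args_below vn; rewrite -gate_argsE //.
case: (nth Input C v) => [|i|s|s] /= below.
- by rewrite size_take size_sweep vn.
- by rewrite nth_take // below ?inE.
- by apply: eq_in_all => i /below iv; rewrite nth_take.
- by apply: eq_in_has => i /below iv; rewrite nth_take.
Qed.

Lemma node_value_input v : v < n -> ty v = 0 -> node_value v = a v.
Proof.
move=> vn /eqP; rewrite -is_inputE // node_valueE //.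
by case: (nth _ _ _).
Qed.

Lemma node_value_not v : v < n -> ty v = 1 -> node_value v = ~~ node_value (ag v 0).
Proof.
move=> vn t1; rewrite node_valueE //; have := spec vn; rewrite t1.
by case: (nth _ _ _) => [//|i [_ ->]|s []|s []].
Qed.

Lemma node_value_gate v : v < n -> 1 < ty v ->
  node_value v = if ty v == 2 then all node_value (args ty ar ag v)
                 else has node_value (args ty ar ag v).
Proof.
move=> vn tv; rewrite -gate_argsE // node_valueE //; have := spec vn.
by move: tv; case: (nth _ _ _) => [+ t0|i + [t1 _]|s _ [-> _ _]|s _ [-> _ _]] //;
  rewrite ?t0 ?t1.
Qed.

End Values.

Lemma eq_circuit_value a b : (forall v, v < n -> ty v = 0 -> a v = b v) ->
  circuit_value a C = circuit_value b C.
Proof.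
move=> ab; rewrite !node_value_last.
suff H v : v < n -> node_value a v = node_value b v.
  by apply: H; rewrite prednK ?circuit_size_gt0.
elim/ltn_ind: v => v IH vn.
have below u : u \in args ty ar ag v -> node_value a u = node_value b u.
  by move=> /(args_below vn) uv; apply: IH => //; apply: ltn_trans vn.
have := is_inputE vn; rewrite !node_valueE //; move: below; rewrite -gate_argsE //.
case: (nth Input C v) => [|i|s|s] /= below.
- by move/esym/eqP; apply: ab.
- by move=> _; rewrite below ?inE.
- by move=> _; apply: eq_in_all.
- by move=> _; apply: eq_in_has.
Qed.

Definition node_depth v :=
  nth 0 (sweep (fun vals g => \max_(i <- gate_args g) (nth 0 vals i).+1) C) v.

Definition node_weft v :=
  nth 0 (sweep (fun vals g => is_large g + \max_(i <- gate_args g) nth 0 vals i) C) v.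

Lemma node_depth_args v u : v < n -> u \in args ty ar ag v -> node_depth u < node_depth v.
Proof.
move=> vn uv; rewrite {2}/node_depth nth_sweep // gate_argsE //.
rewrite -/(sweep _ C); set vals := sweep _ C.
have uv' := args_below vn uv.
have -> : node_depth u = nth 0 (take v vals) u by rewrite nth_take; [reflexivity | exact: uv'].
exact: (@leq_bigmax_seq _ _ xpredT (fun i => (nth 0 (take v vals) i).+1) u uv isT).
Qed.

Lemma node_weftE v : v < n -> node_weft v =
  (2 < size (args ty ar ag v)) + \max_(i <- args ty ar ag v) node_weft i.
Proof.
move=> vn; rewrite {1}/node_weft nth_sweep // /is_large gate_argsE //; congr (_ + _).
by apply: eq_big_seq => i /(args_below vn) iv; rewrite nth_take.
Qed.

Lemma node_weft_args v u : v < n -> u \in args ty ar ag v ->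
  (2 < size (args ty ar ag v)) + node_weft u <= node_weft v.
Proof. by move=> vn uv; rewrite (node_weftE vn) leq_add2l; apply: leq_bigmax_seq. Qed.

Lemma node_weft_large v : v < n -> (2 < size (args ty ar ag v)) <= node_weft v.
Proof. by move=> vn; rewrite node_weftE // leq_addr. Qed.

Variables (k d : nat).
Hypothesis depth_d : circuit_depth C <= d.
Hypothesis weft_1 : circuit_weft C <= 1.

Let j := d.+1.
Let Q := 2 ^ j + j.
Let m := k + 2 + strat_len j.
Let N := n + 2.

(** [sigma] encodes the blocks of a view and [gamma] their values. The [n + 2] values comprise
    nodes, their successors and the sentinels 0 and [n.+1]; [j] exceeds [d] because
    [unrefuted_refuted] asks for [dep v < j]. *)
Definition circuit_csp (V : nat -> nat) : Prop :=
  forall sigma, sigma < m ^ Q -> exists gamma, [/\ gamma < N ^ Q,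
    forall q, q < Q -> dig N gamma q = V (dig m sigma q) &
    allowed ty ar ag k Q (dig m sigma) (dig N gamma) j n].

Let m_gt0 : 0 < m. Proof. by rewrite /m; lia. Qed.
Let last_n : n.-1 < n. Proof. by rewrite prednK ?circuit_size_gt0. Qed.

Lemma csp_complete : (exists a, weight a C = k /\ circuit_value a C) -> exists V, circuit_csp V.
Proof.
move=> [a [wa va]].
pose T := filter (fun i => is_input (nth Input C i) && a i) (iota 0 n).
have sT : size T = k by rewrite size_filter.
have T_sorted : sorted ltn T by apply: sorted_filter (iota_ltn_sorted _ _); apply: ltn_trans.
have T_n i : i < k -> nth 0 T i < n.
  rewrite -sT => /(mem_nth 0); rewrite mem_filter mem_iota => /andP[_ /andP[_]]; exact.
have T_input i : i < k -> ty (nth 0 T i) = 0.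
  move=> ik; apply/eqP; rewrite -is_inputE ?T_n //.
  by move: ik; rewrite -sT => /(mem_nth 0); rewrite mem_filter => /andP[/andP[]].
(* [a] may be true at gates that are not inputs; [a'] is not, as the soundness of [known_false] at
   all nodes requires. *)
pose a' v := v \in T.
have va' : node_value a' n.-1 = true.
  rewrite -node_value_last -va; apply: eq_circuit_value => v vn tv.
  by rewrite /a' mem_filter is_inputE // tv mem_iota /= add0n vn andbT.
have [e [en He]] := unrefuted_complete (fun v u vn uv => ltn_trans (args_below vn uv) vn)
  (node_value_input a') (node_value_not a') (node_value_gate a') k j 0 last_n va'.
(* Thanks to the sentinels 0 and [n.+1], inputs before the first and after the last chosen one lie
   between consecutive blocks too. *)
pose V b := if b == 0 then 0 else if b <= k then (nth 0 T b.-1).+1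
            else if b == k.+1 then n.+1 else e (b - (k + 2)).
have V_N b : V b < N.
  rewrite /V /N; case: b => [|b] /=; first lia.
  case: (ltnP b k) => [bk|_]; first by have := T_n _ bk; lia.
  by case: ifP => _; [|have := en (b.+1 - (k + 2))]; lia.
have V_mono b b' : b < b' -> b' <= k.+1 -> V b < V b'.
  move=> bb'; rewrite /V; case: b' bb' => // b' bb'; rewrite ltnS => b'k /=.
  case: b bb' => [|b] /= bb'; first by do 2!case: ifP => // *; lia.
  have bk : b < k by lia.
  rewrite bk; case: (ltnP b' k) => b'k'; last first.
    by rewrite ifT; [have := T_n _ bk | ]; lia.
  by rewrite ltnS; apply: (sorted_ltn_nth ltn_trans) => //; rewrite ?inE ?sT.
exists V => sigma sigma_m.
set s := dig m sigma.
have VsN q : q < Q -> V (s q) < N by move=> _; apply: V_N.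
exists (undig N Q (V \o s)).
have cV q : q < Q -> dig N (undig N Q (V \o s)) q = V (s q) by apply: dig_undig.
split=> //; first exact: undig_ltn.
move: (dig N _) cV => c cV.
have mem_q q : q \in iota 0 Q -> q < Q by rewrite mem_iota.
apply/andP; split.
  apply/andP; split; apply/allP => q /mem_q qQ.
    rewrite cV //; apply/and3P; split; apply/implyP.
    - by move=> /eqP->.
    - by move=> /eqP->; rewrite /V /= ltnn eqxx.
    - by move=> /andP[]; rewrite /V; case: (s q) => // b _ bk; rewrite bk /= T_input.
  apply/allP => r /mem_q rQ; rewrite !cV //.
  by apply/implyP => /andP[/eqP-> sk]; apply: V_mono.
apply: (He Q s c e) => //; last first.
  move=> q i qQ sq; rewrite cV // /V sq.
  by rewrite !ifF; [congr e | ..]; lia.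
split=> v.
  case/hasP => q /mem_q qQ /and3P[]; rewrite cV // /V; case: (s q) => // b _ bk.
  by rewrite bk eqSS => /eqP <-; rewrite /a' mem_nth // sT.
case/hasP => q /mem_q qQ /hasP[r /mem_q rQ /and4P[/eqP sr sq]].
rewrite !cV // sr => Vq Vr; apply/negP => /(nthP 0) [i]; rewrite sT => ik vi.
have Vi : V i.+1 = v.+1 by rewrite /V /= ik vi.
(* The chosen node sits in block [i.+1], and monotonicity leaves no room for it strictly between two
   consecutive blocks. *)
case: (ltngtP (s q) i.+1) => h.
- have : V (s q).+1 <= V i.+1.
    move: h; rewrite leq_eqVlt => /orP[/eqP->//|h]; apply/ltnW/V_mono => //; lia.
  by lia.
- have : V i.+1 < V (s q) by apply: V_mono => //; lia.
  by lia.
- by move: Vq; rewrite h Vi ltnn.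
Qed.

Lemma csp_sound : (exists V, circuit_csp V) -> exists a, weight a C = k /\ circuit_value a C.
Proof.
move=> [V HV].
(* A list of at most [Q] blocks is padded to a full view with block 0, the default of [nth]. *)
have view Z : size Z <= Q -> all (ltn^~ m) Z -> exists s c, [/\ covers Q s Z,
    forall q, q < Q -> c q = V (s q) & allowed ty ar ag k Q s c j n].
  move=> ZQ Zm; have nth_m i : i < Q -> nth 0 Z i < m.
    case: (ltnP i (size Z)) => iZ _; last by rewrite nth_default.
    by apply: (allP Zm); rewrite mem_nth.
  have [gamma [_ gV al]] := HV _ (undig_ltn nth_m).
  exists (dig m (undig m Q (nth 0 Z))), (dig N gamma); split=> // z /(nthP 0) [i iZ <-].
  by exists i; rewrite ?(dig_undig nth_m) //; apply: leq_trans ZQ.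
have Q2 : 1 < Q by rewrite /Q /j; have := ltn_expl d.+1 (isT : 1 < 2); lia.
have placed b : b <= k.+1 -> [/\ b = 0 -> V b = 0, b = k.+1 -> V b = n.+1
    & 0 < b <= k -> ty (V b).-1 = 0].
  move=> bk; have [|| s [c [cov cV /andP[/andP[/allP H _] _]]]] := view [:: b].
  - exact: ltnW.
  - by rewrite /= andbT /m; lia.
  have [|q qQ sq] := cov b; first exact: mem_head.
  have := H q; rewrite mem_iota cV // sq => /(_ qQ) /and3P[/implyP H1 /implyP H2 /implyP H3].
  by split=> [/eqP/H1/eqP|/eqP/H2/eqP|/H3/eqP].
have V_step b : b <= k -> V b < V b.+1.
  move=> bk; have [|| s [c [cov cV /andP[/andP[_ /allP H] _]]]] := view [:: b; b.+1].
  - exact: Q2.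
  - by rewrite /= andbT /m; lia.
  have [|q qQ sq] := cov b; first exact: mem_head.
  have [|r rQ sr] := cov b.+1; first by rewrite !inE eqxx orbT.
  have := H q; rewrite mem_iota => /(_ qQ) /allP /(_ r); rewrite mem_iota => /(_ rQ).
  by rewrite !cV // sq sr eqxx bk.
have V0 : V 0 = 0 by have [->] := placed 0 isT.
have Vk : V k.+1 = n.+1 by have [_ ->] := placed k.+1 (leqnn _).
have V_mono b b' : b < b' -> b' <= k.+1 -> V b < V b'.
  elim: b' => // b' IH; rewrite ltnS leq_eqVlt => /orP[/eqP->|bb'] b'k.
    exact: V_step.
  by apply: ltn_trans (IH bb' (ltnW b'k)) (V_step _ _).
have V_range b : 0 < b -> b <= k -> 0 < V b <= n.
  move=> b0 bk; have := V_mono 0 b b0; have := V_mono b k.+1.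
  by rewrite V0 Vk; lia.
have V_input b : 0 < b -> b <= k -> ty (V b).-1 = 0.
  by move=> b0 bk; have [|_ _ ->] := placed b; rewrite ?b0 //; apply: leqW.
pose a v := has (fun b => V b == v.+1) (iota 1 k).
have mem_k b : b \in iota 1 k -> 0 < b /\ b <= k by rewrite mem_iota; lia.
exists a; split.
  rewrite /weight -size_filter.
  rewrite -[RHS](size_iota 1 k) -[in RHS](size_map (fun b => (V b).-1)); apply: perm_size.
  apply: uniq_perm; first by rewrite filter_uniq ?iota_uniq.
    rewrite map_inj_in_uniq ?iota_uniq // => b b' /mem_k[b0 bk] /mem_k[b'0 b'k] Vbb'.
    have := V_range b b0 bk; have := V_range b' b'0 b'k.
    case: (ltngtP b b') => // h; first by have := V_mono b b' h; lia.
    by have := V_mono b' b h; lia.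
  move=> v; rewrite mem_filter mem_iota /=; apply/idP/mapP.
    case/andP=> /andP[_ /hasP[b bk /eqP Vb]] _; exists b => //.
    by rewrite Vb.
  case=> b bk ->; have [b0 bk'] := mem_k _ bk; have Vr := V_range b b0 bk'.
  rewrite is_inputE ?V_input //=; last lia.
  rewrite andbC -/n; apply/andP; split; first lia.
  by apply/hasP; exists b => //; apply/eqP; lia.
rewrite node_value_last; case E: (node_value a n.-1) => //.
have V_true v : v < n -> ty v = 0 -> a v -> exists2 b, 0 < b <= k & V b = v.+1.
  by move=> _ _ /hasP[b /mem_k[b0 bk] /eqP Vb]; exists b; rewrite ?b0.
have V_false v : v < n -> ty v = 0 -> ~~ a v -> exists2 b, b <= k & V b < v.+1 < V b.+1.
  move=> vn _ av; have ex : exists b, v.+1 < V b.+1 by exists k; rewrite Vk; lia.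
  (* By minimality block [b] holds at most [v.+1], and it does not hold [v.+1] because [v] is not
     chosen. *)
  have bk := ex_minnP ex; case: bk => b vb minb.
  have bk : b <= k by apply: minb; rewrite Vk; lia.
  exists b => //; rewrite vb andbT.
  case: b minb bk {vb} => [|b] minb bk; first by rewrite V0.
  rewrite ltn_neqAle; apply/andP; split.
    by apply: contra av => /eqP Vb; apply/hasP; exists b.+1; rewrite ?Vb // mem_iota; lia.
  by rewrite leqNgt; apply/negP => /minb; rewrite ltnn.
(* If the output were false, its refuting blocks would fit into one view, and [V] satisfies every
   view. *)
have [|||Z [ZQ Zm HZ]] := unrefuted_refuted (fun v u vn uv => ltn_trans (args_below vn uv) vn)
  (node_value_input a) (node_value_not a) (node_value_gate a)
  node_depth_args node_weft_args node_weft_large V_true V_false (j := j) (b := true) 0 last_n.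
- by rewrite ltnS; apply: leq_trans depth_d; rewrite /circuit_depth last_sweep.
- by apply: leq_trans weft_1; rewrite /circuit_weft last_sweep.
- by rewrite E.
have [|s [c [cov cV /andP[_ H]]]] := view Z ZQ; first by rewrite /m -[strat_len j]add0n.
by move: (HZ Q s c cov cV); rewrite H.
Qed.

End Circuit.

(** * Decoding circuits *)

Definition zeros (x : bitseq) (p : nat) : nat := \sum_(q < p) ~~ nth false x q.

(** In the unary code, number [i] is the number of ones preceded by exactly [i] delimiters, so that
    decoding is a bounded sum. *)
Definition token (x : bitseq) (i : nat) : nat :=
  \sum_(p < size x) (nth false x p && (zeros x p == i)).

Definition token_count (x : bitseq) : nat := zeros x (size x).

Lemma zerosE x p : p <= size x -> zeros x p = count negb (take p x).
Proof.
move=> px; rewrite /zeros (sum_count_iota (fun q => ~~ nth false x q)).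
by rewrite -(map_nth_iota0 false px) count_map.
Qed.

Lemma tokenE x i : token x i =
  count (fun p => nth false x p && (count negb (take p x) == i)) (iota 0 (size x)).
Proof.
rewrite /token (sum_count_iota (fun p => nth false x p && (zeros x p == i))).
by apply: eq_in_count => p; rewrite mem_iota => /andP[_ /ltnW px]; rewrite zerosE.
Qed.

Lemma count_nseq_true n : count negb (nseq n true) = 0.
Proof. by rewrite count_nseq. Qed.

Lemma token_cat n x i : token (enc_nat n ++ x) i = if i is j.+1 then token x j else n.
Proof.
pose w := nseq n true ++ false :: x.
have -> : enc_nat n ++ x = w by rewrite /enc_nat cat_rcons.
have sw : size w = n.+1 + size x by rewrite size_cat size_nseq /= addnS.
have low p : p <= n -> count negb (take p w) = 0 /\ nth false w p = (p < n).
  move=> pn; rewrite /w take_cat nth_cat size_nseq; case: ltngtP pn => // [pn|->] _.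
    by rewrite take_nseq ?(ltnW pn) // count_nseq_true nth_nseq pn.
  by rewrite subnn take0 cats0 count_nseq_true.
have high p : count negb (take (n.+1 + p) w) = (count negb (take p x)).+1 /\
              nth false w (n.+1 + p) = nth false x p.
  rewrite /w take_cat nth_cat size_nseq ltnNge addSnnS leq_addr /= addKn /=.
  by rewrite count_cat count_nseq_true.
rewrite !tokenE sw iotaD count_cat add0n -{2}[n.+1]addn0 iotaDl count_map.
rewrite -{1}addn1 iotaD count_cat add0n -addnA addnC.
rewrite (@eq_in_count _ _ (fun=> i == 0) (iota 0 n)); last first.
  move=> p; rewrite mem_iota add0n => /andP[_ pn]; have [-> ->] := low p (ltnW pn).
  by rewrite pn eq_sym.
have [cn nn] := low n (leqnn n); rewrite /= cn nn ltnn /= !add0n.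
rewrite (@eq_count _ _ (fun p => nth false x p && ((count negb (take p x)).+1 == i))).
  case: i => [|i] /=; last by rewrite count_pred0 addn0 tokenE.
  by rewrite count_predT size_iota (@eq_count _ _ pred0) ?count_pred0 // => p; rewrite andbF.
by move=> p; have [/= -> ->] := high p.
Qed.

Lemma token_enc l i : token (enc_nats l) i = nth 0 l i.
Proof.
elim: l i => [|n l IH] i; first by rewrite nth_nil /token big_ord0.
by rewrite [enc_nats _]/(enc_nat n ++ enc_nats l) token_cat; case: i.
Qed.

Lemma token_count_enc l : token_count (enc_nats l) = size l.
Proof.
rewrite /token_count zerosE // take_size; elim: l => // n l IH.
rewrite [enc_nats _]/(enc_nat n ++ enc_nats l) count_cat IH.
by rewrite /enc_nat -cats1 count_cat count_nseq_true.
Qed.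

Lemma size_enc_nats l : size l <= size (enc_nats l).
Proof.
elim: l => // n l IH.
by rewrite [enc_nats _]/(enc_nat n ++ enc_nats l) size_cat size_enc_nat /=; lia.
Qed.

Lemma token_size x i : token x i <= size x.
Proof.
by rewrite tokenE (leq_trans (count_size _ _)) // size_iota.
Qed.

(* [gate_pos x v] is the position of the code of node [v] among the numbers
   that [x] encodes; number 0 is the weight. *)
Definition gate_pos (x : bitseq) (v : nat) : nat :=
  iteri v (fun _ p => p + if token x p <= 1 then (token x p).+1 else token x p.+1 + 2) 1.

(** Positions increase, so the nodes are those whose position lies within the encoded numbers, and
    [size x] bounds their number. *)
Definition gate_count (x : bitseq) : nat := \sum_(v < size x) (gate_pos x v < token_count x).
Definition gate_type (x : bitseq) (v : nat) : nat := token x (gate_pos x v).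
Definition gate_arity (x : bitseq) (v : nat) : nat := token x (gate_pos x v).+1.
Definition gate_arg (x : bitseq) (v l : nat) : nat :=
  token x (gate_pos x v + (if gate_type x v == 1 then 1 else 2) + l).

Section Parse.
Variables (k : nat) (C : circuit).
Let x := enc_nats (k :: flatten (map gate_code C)).

Lemma token_weight : token x 0 = k.
Proof. by rewrite /x token_enc. Qed.

Lemma nth_gate_code v i : v < size C -> i < size (gate_code (nth Input C v)) ->
  nth 0 (flatten (map gate_code C)) (size (flatten (map gate_code (take v C))) + i) =
  nth 0 (gate_code (nth Input C v)) i.
Proof.
move=> vC iv; rewrite -{1}(cat_take_drop v C) map_cat flatten_cat nth_cat.
rewrite ltnNge leq_addr /= addKn (drop_nth Input) //= nth_cat iv //.
Qed.

Lemma gate_posE v : v <= size C ->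
  gate_pos x v = (size (flatten (map gate_code (take v C)))).+1.
Proof.
elim: v => [|v IH] vC; first by rewrite take0.
rewrite /gate_pos iteriS -/(gate_pos x v) IH ?(ltnW vC) //.
rewrite (take_nth Input) // map_rcons flatten_rcons size_cat addSn; congr (_.+1); congr (_ + _).
rewrite /x !token_enc /=.
set p := size _; have := nth_gate_code (v := v) (i := 0) vC; rewrite addn0 -/p.
have := nth_gate_code (v := v) (i := 1) vC; rewrite addn1 -/p.
case: (nth Input C v) => [|i|s|s] /=.
- by move=> _ ->.
- by move=> _ ->.
- by move=> -> // -> //=; rewrite addn2.
- by move=> -> // -> //=; rewrite addn2.
Qed.

Lemma gate_spec_parse v : v < size C ->
  gate_spec (nth Input C v) (gate_type x v) (gate_arity x v) (gate_arg x v).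
Proof.
move=> vC; rewrite /gate_arity /gate_arg.
have tk i : i < size (gate_code (nth Input C v)) ->
    token x (gate_pos x v + i) = nth 0 (gate_code (nth Input C v)) i.
  move=> iv; rewrite gate_posE ?(ltnW vC) // /x token_enc addSn /=.
  exact: nth_gate_code.
have -> : gate_type x v = nth 0 (gate_code (nth Input C v)) 0.
  by rewrite -tk ?addn0 //; case: (nth _ _ _).
rewrite -[(gate_pos x v).+1]addn1.
case: (nth Input C v) tk => [|i|s|s] /= tk; rewrite ?tk //.
- by split=> //; rewrite addn0 tk.
- by split=> // l ls; rewrite -addnA tk //= !ltnS.
- by split=> // l ls; rewrite -addnA tk //= !ltnS.
Qed.

Lemma gate_countE : gate_count x = size C.
Proof.
have posC v : (gate_pos x v < token_count x) = (v < size C).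
  have -> : token_count x = (size (flatten (map gate_code C))).+1.
    by rewrite /x token_count_enc.
  case: (ltnP v (size C)) => vC.
    rewrite gate_posE ?(ltnW vC) // ltnS -{2}(cat_take_drop v C) map_cat flatten_cat size_cat.
    rewrite (drop_nth Input) //= size_cat; case: (nth Input C v) => *; rewrite /=; lia.
  have pos_mono d : gate_pos x (size C) <= gate_pos x (size C + d).
    elim: d => [|d IH]; first by rewrite addn0.
    by rewrite addnS {2}/gate_pos iteriS -/(gate_pos x _); apply: leq_trans IH (leq_addr _ _).
  apply/negbTE; rewrite -leqNgt -(subnKC vC); apply: leq_trans (pos_mono _).
  by rewrite gate_posE // take_size.
rewrite /gate_count (eq_bigr (fun v : 'I_(size x) => (v.+1 * 1 <= size C) : nat)).
  rewrite (sum_leq_mul (size x) (size C) (isT : 0 < 1)) divn1; apply/minn_idPr.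
  apply: leq_trans (size_enc_nats _); rewrite /=; apply: leqW.
  by elim: (C) => // g s IH; rewrite /= size_cat; case: g => *; rewrite /=; lia.
by move=> v _; rewrite posC muln1.
Qed.

End Parse.

Lemma pc_pred (T : Type) (cT : context T) (f : T -> nat) : pc f -> pc (fun t => (f t).-1).
Proof. by move=> pf; apply: pc_ext (pc_sub pf (pc_cst _ 1)) _ => t; rewrite subn1. Qed.

Lemma pc_eqb (T : Type) (cT : context T) (p q : T -> bool) :
  pc p -> pc q -> pc (fun t => p t == q t).
Proof.
by move=> pp pq; apply: pc_ext (pc_eq pp pq) _ => t; case: (p t) (q t) => [] [].
Qed.

Ltac pc_var := first [ exact (pc_var _ 0) | exact (pc_var _ 1) | exact (pc_var _ 2)
  | exact (pc_var _ 3) | exact (pc_var _ 4) | exact (pc_var _ 5) ].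

(* The patterns are syntactic: [apply] alone would unfold the functions. *)
Ltac pc_step := cbv beta; lazymatch goal with
  | |- prog _ (fun _ => ?n) => exact (pc_cst _ n)
  | |- prog _ (fun t => (@?f t).+1) => apply: pc_succ
  | |- prog _ (fun t => (@?f t).-1) => apply: pc_pred
  | |- prog _ (fun t => @?f t + @?g t) => apply: pc_add
  | |- prog _ (fun t => @?f t - @?g t) => apply: pc_sub
  | |- prog _ (fun t => @?f t * @?g t) => apply: pc_mul
  | |- prog _ (fun t => @?f t %/ @?g t) => apply: pc_div
  | |- prog _ (fun t => @?f t %% @?g t) => apply: pc_mod
  | |- prog _ (fun t => @?f t ^ ?k) => apply: pc_exp
  | |- prog _ (fun t => size _) => exact: pc_size
  | |- prog _ (fun t => if _ then _ else _) => apply: pc_if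
  | |- prog _ (fun t => nat_of_bool (@?p t ==> @?q t)) => apply: pc_imp
  | |- prog _ (fun t => nat_of_bool (~~ @?p t)) => apply: pc_neg
  | |- prog _ (fun t => nat_of_bool (@?p t && @?q t)) => apply: pc_and
  | |- prog _ (fun t => nat_of_bool (@?p t || @?q t)) => apply: pc_or
  | |- prog _ (fun t => nat_of_bool (@?f t <= @?g t)) => apply: pc_leq
  | |- prog _ (fun t => nat_of_bool (@eq_op _ (@?f t) (@?g t))) =>
      first [apply: pc_eq | apply: pc_eqb]
  | |- prog _ (fun t => nat_of_bool (if _ then _ else _)) => apply: pc_ifb
  | |- prog _ (fun t => nat_of_bool (nth false _ (@?f t))) => apply: pc_bit
  | |- prog _ (fun t => nat_of_bool (has (@?p t) (iota 0 (@?n t)))) => apply: pc_has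
  | |- prog _ (fun t => nat_of_bool (all (@?p t) (iota 0 (@?n t)))) => apply: pc_all
  | _ => pc_var
  end.

Lemma pc_dig (T : Type) (cT : context T) (B y i : T -> nat) : pc B -> pc y -> pc i ->
  pc (fun t => dig (B t) (y t) (i t)).
Proof.
move=> pB py pi; apply: pc_mod => //.
have iterE (t : T) n : iteri n (fun _ v => v %/ B t) (y t) = iter n (fun v => v %/ B t) (y t).
  by elim: n => //= n ->.
apply: pc_ext (fun t => iterE t (i t)).
apply: (pc_iteri (g := fun u => u.2 %/ B u.1.1) pi py _ (pc_bound py)) => [|t n _].
  by apply: pc_div; [exact: (pc_var _ 0) | apply: prog_weak (prog_weak pB)].
by rewrite iterE; elim: n => //= n IH; apply: leq_trans (leq_div _ _) IH.
Qed.

Lemma pc_zeros : pc (fun t : bitseq * nat => zeros t.1 t.2).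
Proof.
apply: (pc_sum (g := fun t => ~~ nth false t.1.1 t.2)); first exact: (pc_var _ 0).
by apply: pc_neg; apply: (pc_bit (f := fun t => t.2)); exact: (pc_var _ 0).
Qed.

Lemma pc_token : pc (fun t : bitseq * nat => token t.1 t.2).
Proof.
apply: (pc_sum (n := fun t => size t.1)
  (g := fun t => nth false t.1.1 t.2 && (zeros t.1.1 t.2 == t.1.2))).
  exact: (pc_size _).
apply: pc_and; first by apply: (pc_bit (f := fun t => t.2)); exact: (pc_var _ 0).
by apply: pc_eq; [apply: (pc_app1 pc_zeros); exact: (pc_var _ 0) | exact: (pc_var _ 1)].
Qed.

Lemma pc_token_count : pc token_count.
Proof. by apply: (pc_app1 pc_zeros); exact: (pc_size _). Qed.

Lemma pc_gate_pos : pc (fun t : bitseq * nat => gate_pos t.1 t.2).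
Proof.
apply: (pc_iteri (n := fun t => t.2) (f := fun=> 1) (g := fun u =>
    u.2 + if token u.1.1.1 u.2 <= 1 then (token u.1.1.1 u.2).+1 else token u.1.1.1 u.2.+1 + 2)
    (bnd := fun t => 1 + t.2 * (size t.1 + 2))).
- by repeat pc_step.
- by repeat pc_step.
- repeat lazymatch goal with
  | |- prog _ (fun t => token _ (@?i t)) => apply: (pc_app1 pc_token)
  | _ => pc_step end.
- by apply: pc_bound; repeat pc_step.
move=> t i le_i; apply: (@leq_trans (1 + i * (size t.1 + 2))); last first.
  by rewrite leq_add2l leq_mul2r le_i orbT.
elim: i {le_i} => // i IH; rewrite iteriS /= mulSn.
set p := iteri _ _ _ in IH *.
by have := token_size t.1 p; have := token_size t.1 p.+1; case: ifP; lia.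
Qed.

Lemma pc_gate_count : pc gate_count.
Proof.
apply: (pc_sum (g := fun t => gate_pos t.1 t.2 < token_count t.1)); first exact: pc_size.
apply: pc_ltn; first exact: pc_gate_pos.
exact: (prog_weak pc_token_count).
Qed.

Ltac pc_parse := repeat lazymatch goal with
  | |- prog _ (fun t => token _ (@?i t)) => apply: (pc_app1 pc_token)
  | |- prog _ (fun t => gate_pos _ (@?v t)) => apply: (pc_app1 pc_gate_pos)
  | _ => pc_step
  end.

Lemma pc_gate_type : pc (fun t : bitseq * nat => gate_type t.1 t.2).
Proof. by rewrite /gate_type; pc_parse. Qed.

Lemma pc_gate_arity : pc (fun t : bitseq * nat => gate_arity t.1 t.2).
Proof. by rewrite /gate_arity; pc_parse. Qed.

Lemma pc_gate_arg : pc (fun t : bitseq * nat * nat => gate_arg t.1.1 t.1.2 t.2).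
Proof. by rewrite /gate_arg /gate_type; pc_parse. Qed.

(** * Programs that evaluate views *)

Definition view_width (d : nat) : nat := 2 ^ d.+1 + d.+1.
Definition block_count (d : nat) (x : bitseq) : nat := token x 0 + 2 + strat_len d.+1.
Definition value_count (x : bitseq) : nat := gate_count x + 2.

Lemma pc_bool_app2 (F : bitseq -> nat -> nat -> bool) (T : Type) (cT : context T)
    (u v : T -> nat) :
  pc (fun t : bitseq * nat * nat => F t.1.1 t.1.2 t.2) -> pc u -> pc v ->
  pc (fun t => F (word t) (u t) (v t)).
Proof. exact: (@pc_app2 _ _ (fun x i j => F x i j)). Qed.

Lemma pc_bool_app3 (F : bitseq -> nat -> nat -> nat -> bool) (T : Type) (cT : context T)
    (u v w : T -> nat) :
  pc (fun t : bitseq * nat * nat * nat => F t.1.1.1 t.1.1.2 t.1.2 t.2) ->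
  pc u -> pc v -> pc w ->
  pc (fun t => F (word t) (u t) (v t) (w t)).
Proof. exact: (@pc_app3 _ _ (fun x i j k => F x i j k)). Qed.

Section WordView.
Variable d : nat.

Definition view_block x s q := dig (block_count d x) s q.
Definition view_value x c q := dig (value_count x) c q.

Definition known_true_word x s c v :=
  known_true (token x 0) (view_width d) (view_block x s) (view_value x c) v.
Definition known_false_word x s c v :=
  known_false (token x 0) (view_width d) (view_block x s) (view_value x c) v.
Definition possible_word j b x s c v :=
  possible (gate_type x) (gate_arity x) (gate_arg x) (token x 0) (view_width d)
    (view_block x s) (view_value x c) j v b.
Definition unrefuted_word j b o x s c v :=
  unrefuted (gate_type x) (gate_arity x) (gate_arg x) (token x 0) (view_width d)
    (view_block x s) (view_value x c) j v b o.
Definition allowed_word x s c :=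
  allowed (gate_type x) (gate_arity x) (gate_arg x) (token x 0) (view_width d)
    (view_block x s) (view_value x c) d.+1 (gate_count x).

Lemma pc_block_count (T : Type) (cT : context T) : pc (fun t : T => block_count d (word t)).
Proof. by rewrite /block_count; pc_parse. Qed.

Lemma pc_gate_count_at (T : Type) (cT : context T) : pc (fun t : T => gate_count (word t)).
Proof.
apply: (@pc_app1 _ _ (fun x _ => gate_count x)) (pc_cst _ 0).
exact: prog_weak pc_gate_count.
Qed.

Lemma pc_value_count (T : Type) (cT : context T) : pc (fun t : T => value_count (word t)).
Proof. by apply: pc_add (pc_gate_count_at _) (pc_cst _ _). Qed.

Lemma pc_view_block : pc (fun t : bitseq * nat * nat => view_block t.1.1 t.1.2 t.2).
Proof. by apply: pc_dig (pc_block_count _) _ _; pc_var. Qed.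

Lemma pc_view_value : pc (fun t : bitseq * nat * nat => view_value t.1.1 t.1.2 t.2).
Proof. by apply: pc_dig (pc_value_count _) _ _; pc_var. Qed.

Ltac pc_view := repeat lazymatch goal with
  | |- prog _ (fun t => token _ (@?i t)) => apply: (pc_app1 pc_token)
  | |- prog _ (fun t => gate_type _ (@?i t)) => apply: (pc_app1 pc_gate_type)
  | |- prog _ (fun t => gate_arity _ (@?i t)) => apply: (pc_app1 pc_gate_arity)
  | |- prog _ (fun t => gate_arg _ (@?i t) (@?j t)) => apply: (pc_app2 pc_gate_arg)
  | |- prog _ (fun t => gate_count _) => apply: pc_gate_count_at
  | |- prog _ (fun t => view_block _ (@?s t) (@?q t)) => apply: (pc_app2 pc_view_block)
  | |- prog _ (fun t => view_value _ (@?s t) (@?q t)) => apply: (pc_app2 pc_view_value)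
  | H : prog _ (fun t => nat_of_bool (?F _ _ _ _)) |-
    prog _ (fun t => nat_of_bool (?F _ (@?s t) (@?c t) (@?v t))) => apply: (pc_bool_app3 H)
  | _ => pc_step
  end.

Lemma pc_known_true :
  pc (fun t : bitseq * nat * nat * nat => known_true_word t.1.1.1 t.1.1.2 t.1.2 t.2).
Proof. by rewrite /known_true_word /known_true; pc_view. Qed.

Lemma pc_known_false :
  pc (fun t : bitseq * nat * nat * nat => known_false_word t.1.1.1 t.1.1.2 t.1.2 t.2).
Proof. by rewrite /known_false_word /known_false; pc_view. Qed.

(** The recursion over words, true by computation, in a form whose calls [pc_view] recognizes by
    their head symbols. *)
Lemma possible_wordS j b x s c v : possible_word j.+1 b x s c v =
  if gate_type x v == 0 then
    if b then ~~ known_false_word x s c v else ~~ known_true_word x s c v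
  else if gate_type x v == 1 then possible_word j (~~ b) x s c (gate_arg x v 0)
  else if (gate_type x v == 2) == b then
    all (fun l => possible_word j b x s c (gate_arg x v l)) (iota 0 (gate_arity x v))
  else has (fun l => possible_word j b x s c (gate_arg x v l)) (iota 0 (gate_arity x v)).
Proof. by []. Qed.

Lemma unrefuted_wordS j b o x s c v : unrefuted_word j.+1 b o x s c v =
  if gate_type x v == 0 then
    if b then ~~ known_false_word x s c v else ~~ known_true_word x s c v
  else if gate_type x v == 1 then unrefuted_word j (~~ b) o.+1 x s c (gate_arg x v 0)
  else if (gate_type x v == 2) == b then
    if gate_arity x v <= 2 then
      ((0 < gate_arity x v) ==> unrefuted_word j b o.+1 x s c (gate_arg x v 0)) &&
      ((1 < gate_arity x v) ==>
         unrefuted_word j b (o.+1 + strat_len j) x s c (gate_arg x v 1))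
    else all (fun l => possible_word j b x s c (gate_arg x v l)) (iota 0 (gate_arity x v))
  else all (fun q => (view_block x s q == token x 0 + 2 + o) ==>
    has (fun l => gate_arg x v l == view_value x c q) (iota 0 (gate_arity x v)) &&
    (if gate_arity x v <= 2 then unrefuted_word j b o.+1 x s c (view_value x c q)
     else possible_word j b x s c (view_value x c q))) (iota 0 (view_width d)).
Proof. by []. Qed.

Lemma allowed_wordE x s c : allowed_word x s c =
  well_placed (gate_type x) (token x 0) (view_width d) (view_block x s) (view_value x c)
    (gate_count x) &&
  unrefuted_word d.+1 true 0 x s c (gate_count x).-1.
Proof. by []. Qed.

(** Since [j] is a constant, the recursion is unrolled into nested code. *)
Lemma pc_possible j b :
  pc (fun t : bitseq * nat * nat * nat => possible_word j b t.1.1.1 t.1.1.2 t.1.2 t.2).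
Proof.
elim: j b => [|j IH] b; first exact: pc_cst.
apply: pc_ext (fun t => congr1 nat_of_bool (esym (possible_wordS j b _ _ _ _))).
have IHb := IH b; have IHn := IH (~~ b).
have pkt := pc_known_true; have pkf := pc_known_false.
by pc_view.
Qed.

Lemma pc_unrefuted j b o :
  pc (fun t : bitseq * nat * nat * nat => unrefuted_word j b o t.1.1.1 t.1.1.2 t.1.2 t.2).
Proof.
elim: j b o => [|j IH] b o; first exact: pc_cst.
apply: pc_ext (fun t => congr1 nat_of_bool (esym (unrefuted_wordS j b o _ _ _ _))).
have I1 := IH b o.+1; have I2 := IH b (o.+1 + strat_len j); have I3 := IH (~~ b) o.+1.
have I4 := pc_possible j b.
have pkt := pc_known_true; have pkf := pc_known_false.
by pc_view.
Qed.

Lemma pc_allowed :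
  pc (fun t : bitseq * nat * nat => allowed_word t.1.1 t.1.2 t.2).
Proof.
apply: pc_ext (fun t => congr1 nat_of_bool (esym (allowed_wordE _ _ _))).
have IH := pc_unrefuted d.+1 true 0.
by rewrite /well_placed; pc_view.
Qed.

End WordView.

(** * The graph *)

Section Gadget.
Variables (m Q N : nat) (al : nat -> nat -> bool).

(* A solution [V] maps [m] blocks to values below [N].  A class is the base-[m]
   code of a [Q]-tuple of blocks, a choice the base-[N] code of a [Q]-tuple of
   values, an item a pair of a class and a choice.  An occurrence is a pair of a
   class and a position in its tuple. *)
Definition class_count := m ^ Q.
Definition choice_count := N ^ Q.
Definition item_count := class_count * choice_count.
Definition occ_count := class_count * Q.
Definition dim_count := occ_count * occ_count.
Definition target := N.-1.
Definition leaf_count := Q * occ_count * target.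
(** The cost of [y], of all mirrors, and of one center with its leaves for each class. *)
Definition budget := 1 + item_count * leaf_count + class_count * leaf_count.+1.
Definition col_count := 2 * budget.+1.
Definition center_count := item_count + col_count.
Definition z_row := center_count + dim_count.
Definition y_row := z_row.+1.
Definition row_count := y_row.+1.
Definition vertex_count := 5 * (row_count * col_count).

(* A vertex is given by a tag, a row and a column.  Column 0 of tag 4 holds the
   special vertices: centers of items (those in rows at least [item_count] are
   never allowed), dimensions, [z] and [y].  All edges go from a vertex to a
   special one:
   - tag 0: pendant vertices of the center in the same row;
   - tag 1: leaf [t] of item [h], adjacent to its center and its dimension;
   - tag 2: mirror of leaf [t] of item [h], adjacent to [y] and its dimension;
   - tag 3: padding, adjacent to [z] and a dimension;
   - unused triples: pendant vertices of [y], since isolated vertices would be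
     alliances.
   No vertex of an alliance within the budget is [z] or a neighbour of [z]. *)
Definition vertex_tag u := u %/ (row_count * col_count).
Definition vertex_row u := u %/ col_count %% row_count.
Definition vertex_col u := u %% col_count.

Definition occ_block o := dig m (o %/ Q) (o %% Q).
Definition occ_value h i := dig N (h %% choice_count) i.

(* Leaf [t] of item [h] is the [l]-th one for its occurrence [o] and an
   occurrence [p].  If the occurrences [a] and [b] show the same block with
   values [v] and [w], then dimension [a * occ_count + b] gets [v] leaves from
   [a] and [target - w] from [b], hence reaches [target] iff [w <= v]. *)
Definition leaf_dim h t :=
  let l := t %% target in
  let p := t %/ target %% occ_count in
  let i := t %/ target %/ occ_count in
  let o := h %/ choice_count * Q + i in
  if (occ_block o == occ_block p) && (occ_value h i <= l)
  then p * occ_count + o else o * occ_count + p.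

Definition item_ok h := (h < item_count) && al (h %/ choice_count) (h %% choice_count).

Definition hub_at g h t k : bool :=
  if g == 0 then if h < center_count then k == h else k == y_row
  else if g == 1 then
    if (h < item_count) && (t < leaf_count)
    then (k == h) || (k == center_count + leaf_dim h t) else k == y_row
  else if g == 2 then
    if (h < item_count) && (t < leaf_count)
    then (k == y_row) || (k == center_count + leaf_dim h t) else k == y_row
  else if g == 3 then
    if (h < dim_count) && (t < (2 * target).-1)
    then (k == z_row) || (k == center_count + h) else k == y_row
  else if t != 0 then k == y_row
  else if h < center_count then ~~ item_ok h && (k == z_row)
  else (h < z_row) && ((k == z_row) || (k == y_row)).

Definition hub u k := hub_at (vertex_tag u) (vertex_row u) (vertex_col u) k.

Definition special u := (vertex_tag u == 4) && (vertex_col u == 0).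

Definition up_edge u v := special v && hub u (vertex_row v).

Definition gadget_edge u v := up_edge u v || up_edge v u.

Lemma col_count_gt0 : 0 < col_count. Proof. by []. Qed.
Lemma row_count_gt0 : 0 < row_count. Proof. by []. Qed.
Lemma vertex_count_gt0 : 0 < vertex_count. Proof. by []. Qed.
Hint Resolve col_count_gt0 row_count_gt0 : core.

(** Total on natural numbers by means of a default vertex; the coordinates are meaningful only
    within the ranges assumed in [Fields]. *)
Definition vx g h t : 'I_vertex_count :=
  insubd (Ordinal vertex_count_gt0) ((g * row_count + h) * col_count + t).

Lemma vertex_row_ltn u : vertex_row u < row_count.
Proof. exact: ltn_pmod. Qed.

Lemma vertex_col_ltn u : vertex_col u < col_count.
Proof. exact: ltn_pmod. Qed.

Lemma vertex_tag_ltn (u : 'I_vertex_count) : vertex_tag u < 5.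
Proof. by rewrite ltn_divLR ?muln_gt0 ?col_count_gt0 //; apply: ltn_ord. Qed.

Section Fields.
Variables (g h t : nat).
Hypotheses (g5 : g < 5) (hrow : h < row_count) (tcol : t < col_count).

Lemma val_vx : val (vx g h t) = (g * row_count + h) * col_count + t.
Proof.
rewrite val_insubd ifT //; rewrite /vertex_count.
move: row_count col_count hrow tcol => R P hR tP.
have : (g * R + h).+1 * P <= 5 * R * P.
  by rewrite leq_mul2r; apply/orP; right; nia.
by rewrite mulnA mulSn; lia.
Qed.

Lemma vx_tag : vertex_tag (vx g h t) = g.
Proof.
rewrite /vertex_tag val_vx mulnC -mulnC mulnDl -addnA -mulnA divnMDl ?muln_gt0 //.
rewrite divn_small ?addn0 //.
move: row_count col_count hrow tcol => R P hR tP.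
have : h.+1 * P <= R * P by rewrite leq_mul2r hR orbT.
by rewrite mulSn; lia.
Qed.

Lemma vx_row : vertex_row (vx g h t) = h.
Proof.
by rewrite /vertex_row val_vx divnMDl // divn_small // addn0 modnMDl modn_small.
Qed.

Lemma vx_col : vertex_col (vx g h t) = t.
Proof. by rewrite /vertex_col val_vx modnMDl modn_small. Qed.

End Fields.

Lemma vx_fields (u : 'I_vertex_count) :
  vx (vertex_tag u) (vertex_row u) (vertex_col u) = u.
Proof.
apply: val_inj; rewrite val_vx ?vertex_tag_ltn ?vertex_row_ltn ?vertex_col_ltn //=.
rewrite [in RHS](divn_eq u col_count); congr (_ * _ + _).
have -> : vertex_tag u = u %/ col_count %/ row_count by rewrite /vertex_tag mulnC divnMA.
by rewrite /vertex_row -divn_eq.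
Qed.

Lemma vertexP (u : 'I_vertex_count) : exists g h t,
  [/\ g < 5, h < row_count, t < col_count & u = vx g h t].
Proof.
exists (vertex_tag u), (vertex_row u), (vertex_col u).
by rewrite vx_fields vertex_tag_ltn vertex_row_ltn vertex_col_ltn.
Qed.

Lemma sum_ord_mul (F : nat -> nat) a b :
  \sum_(u < a * b) F u = \sum_(i < a) \sum_(j < b) F (i * b + j).
Proof.
elim: a => [|a IH]; first by rewrite !big_ord0.
rewrite big_ord_recr -IH -!(big_mkord xpredT F) mulSnr.
rewrite (@big_cat_nat _ _ _ (a * b)) ?leq_addr //=; congr (_ + _).
rewrite -{1}[a * b]add0n big_addn addKn big_mkord.
by apply: eq_bigr => i _; rewrite addnC.
Qed.

Lemma sum_vertices (F : 'I_vertex_count -> nat) :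
  \sum_u F u = \sum_(g < 5) \sum_(h < row_count) \sum_(t < col_count) F (vx g h t).
Proof.
pose F' u := F (insubd (Ordinal vertex_count_gt0) u).
have -> : \sum_u F u = \sum_(u < vertex_count) F' u.
  by apply: eq_bigr => u _; rewrite /F' valKd.
rewrite sum_ord_mul; apply: eq_bigr => g _.
rewrite (sum_ord_mul (fun u => F' (g * (row_count * col_count) + u))).
apply: eq_bigr => h _; apply: eq_bigr => t _.
by rewrite /F' /vx; congr (F (insubd _ _)); rewrite mulnDl mulnA addnA.
Qed.

Lemma sum_narrow a b (F : nat -> nat) : a <= b -> (forall i, a <= i < b -> F i = 0) ->
  \sum_(i < b) F i = \sum_(i < a) F i.
Proof.
move=> ab F0; rewrite -!(big_mkord xpredT F) (@big_cat_nat _ _ _ a) //=.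
by rewrite [X in _ + X]big_nat_cond [X in _ + X]big1 ?addn0 // => i /andP[/F0].
Qed.

Lemma sum_indic a k (F : nat -> nat) : k < a -> \sum_(i < a) (i == k :> nat) * F i = F k.
Proof.
move=> ka; rewrite (bigD1 (Ordinal ka)) //= eqxx mul1n big1 ?addn0 // => i ik.
by rewrite -(inj_eq val_inj) /= in ik; rewrite (negPf ik).
Qed.

Definition sp k := vx 4 k 0.
Local Notation e := (fun u v : 'I_vertex_count => gadget_edge u v).

Lemma hub_vx g h t k : g < 5 -> h < row_count -> t < col_count ->
  hub (vx g h t) k = hub_at g h t k.
Proof. by move=> g5 hr tc; rewrite /hub vx_tag ?vx_row ?vx_col. Qed.

Lemma special_vx g h t : g < 5 -> h < row_count -> t < col_count ->
  special (vx g h t) = (g == 4) && (t == 0).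
Proof. by move=> g5 hr tc; rewrite /special vx_tag ?vx_col. Qed.

Lemma sp_row k : k < row_count -> vertex_row (sp k) = k.
Proof. by move=> kr; rewrite vx_row. Qed.

Lemma special_sp k : k < row_count -> special (sp k).
Proof. by move=> kr; rewrite special_vx. Qed.

Lemma specialE (v : 'I_vertex_count) : special v -> v = sp (vertex_row v).
Proof. by case/andP=> /eqP g4 /eqP t0; rewrite -{1}(vx_fields v) g4 t0. Qed.

Lemma edgeC (u v : 'I_vertex_count) : e u v = e v u.
Proof. by rewrite /gadget_edge orbC. Qed.

Lemma edge_sp (u : 'I_vertex_count) k : ~~ special u -> k < row_count -> e u (sp k) = hub u k.
Proof.
by move=> su kr; rewrite /gadget_edge /up_edge special_sp // sp_row // (negPf su) orbF.
Qed.

Lemma edge_nonspecial (u v : 'I_vertex_count) : ~~ special u -> e u v ->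
  v = sp (vertex_row v) /\ hub u (vertex_row v).
Proof.
move=> su; rewrite /gadget_edge /up_edge (negPf su) /= orbF => /andP[sv huv].
by split=> //; apply: specialE.
Qed.

Lemma row_bounds : [/\ item_count <= center_count, center_count <= z_row, z_row < y_row,
  y_row < row_count & center_count + dim_count = z_row].
Proof. by split; rewrite /row_count /y_row /z_row /center_count; lia. Qed.

Lemma edge_irr u : gadget_edge u u = false.
Proof.
rewrite /gadget_edge orbb; apply/negP => /andP[/andP[/eqP g4 /eqP t0]].
rewrite /hub /hub_at g4 t0 /=; have [_ cz zy _ _] := row_bounds.
move: zy; rewrite /y_row => zy; case: ltnP => h; first by case/andP => _ /eqP; lia.
by case/andP => hz /orP[] /eqP; rewrite /y_row; lia.
Qed.

Lemma deg_inE (A : {set 'I_vertex_count}) v : deg_in e A v = \sum_u (u \in A) * e v u.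
Proof.
rewrite /deg_in -sum1dep_card big_mkcond /=; apply: eq_bigr => u _.
by case: (u \in A) (gadget_edge v u) => [] [].
Qed.

Lemma sum_narrow2 a a' b b' (F : nat -> nat -> nat) : a <= a' -> b <= b' ->
  (forall i j, ~~ ((i < a) && (j < b)) -> F i j = 0) ->
  \sum_(i < a') \sum_(j < b') F i j = \sum_(i < a) \sum_(j < b) F i j.
Proof.
move=> aa bb F0; rewrite (sum_narrow (F := fun i => \sum_(j < b') F i j) aa).
  apply: eq_bigr => i _; rewrite (sum_narrow (F := F i) bb) // => j /andP[bj _].
  by apply: F0; rewrite ltn_ord -leqNgt.
by move=> i /andP[ai _]; apply: big1 => j _; apply: F0; rewrite ltnNge ai.
Qed.

Hypotheses (m_gt0 : 0 < m) (Q_gt0 : 0 < Q) (N_gt1 : 1 < N).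

Lemma class_count_gt0 : 0 < class_count. Proof. by rewrite expn_gt0 m_gt0. Qed.
Lemma choice_count_gt0 : 0 < choice_count. Proof. by rewrite expn_gt0 (ltnW N_gt1). Qed.
Lemma occ_count_gt0 : 0 < occ_count. Proof. by rewrite muln_gt0 class_count_gt0. Qed.
Lemma target_gt0 : 0 < target. Proof. by rewrite /target; lia. Qed.

Lemma leaf_count_target : target <= leaf_count.
Proof. by rewrite /leaf_count leq_pmull // muln_gt0 Q_gt0 occ_count_gt0. Qed.

Lemma leaf_count_gt0 : 0 < leaf_count.
Proof. exact: leq_trans target_gt0 leaf_count_target. Qed.

Lemma leaf_count_col : leaf_count < col_count.
Proof.
rewrite /col_count /budget; have := class_count_gt0.
by move: class_count leaf_count (item_count * _) => c l I c0; nia.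
Qed.

Lemma pad_count_col : (2 * target).-1 < col_count.
Proof.
have := leaf_count_target; rewrite /col_count /budget; have := class_count_gt0.
by move: class_count target leaf_count (item_count * _) => c tt l I c0; nia.
Qed.

Lemma leaf_dim_ltn h t : h < item_count -> t < leaf_count -> leaf_dim h t < dim_count.
Proof.
move=> hi tl.
have p_occ : t %/ target %% occ_count < occ_count by rewrite ltn_mod occ_count_gt0.
have i_Q : t %/ target %/ occ_count < Q.
  rewrite ltn_divLR ?occ_count_gt0 // ltn_divLR ?target_gt0 //.
have c_cl : h %/ choice_count < class_count by rewrite ltn_divLR ?choice_count_gt0.
rewrite /leaf_dim; set o := _ * Q + _; have o_occ : o < occ_count.
  have : (h %/ choice_count).+1 * Q <= class_count * Q by rewrite leq_mul2r c_cl orbT.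
  by rewrite mulSn; apply: leq_trans; rewrite /o addnC ltn_add2r.
have pair a b : a < occ_count -> b < occ_count -> a * occ_count + b < dim_count.
  move=> aO bO; have : a.+1 * occ_count <= occ_count * occ_count by rewrite leq_mul2r aO orbT.
  by rewrite mulSn; apply: leq_trans; rewrite addnC ltn_add2r.
by case: ifP => _; apply: pair.
Qed.

Lemma edge_dim j g h t : j < dim_count -> g < 5 -> h < row_count -> t < col_count ->
  e (sp (center_count + j)) (vx g h t) =
  if g == 0 then false
  else if (g == 1) || (g == 2) then
    (h < item_count) && (t < leaf_count) && (leaf_dim h t == j)
  else if g == 3 then (h == j) && (t < (2 * target).-1)
  else (t == 0) && ((h == z_row) || (h == y_row)).
Proof.
move=> jd g5 hr tc; have [ic cz zy yr cdz] := row_bounds.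
have kr : center_count + j < row_count by lia.
have yz : y_row = z_row.+1 by [].
case sg: (special (vx g h t)); last first.
  rewrite edgeC edge_sp ?sg // hub_vx // /hub_at.
  move: sg; rewrite special_vx //.
  case: g g5 => [|[|[|[|[|//]]]]] /= _ sg.
  - by case: ifP => hc; apply/negbTE; lia.
  - by case: ifP => [/andP[hi tl]|_]; rewrite ?eqn_add2l ?[j == _]eq_sym /=; [|apply/negbTE; lia];
      have -> : (center_count + j == h) = false by lia.
  - by case: ifP => [/andP[hi tl]|_]; rewrite ?eqn_add2l ?[j == _]eq_sym /=; [|apply/negbTE; lia];
      have -> : (center_count + j == y_row) = false by lia.
  - case: ifP => [/andP[hd tt]|h_out].
      rewrite eqn_add2l [j == _]eq_sym tt andbT.
      by have -> : (center_count + j == z_row) = false by lia.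
    have -> : (center_count + j == y_row) = false by lia.
    by symmetry; apply/negP => /andP[/eqP hj tt]; rewrite hj jd tt in h_out.
  - by rewrite sg /=; lia.
move: sg; rewrite special_vx // => /andP[/eqP-> /eqP->] /=.
rewrite /gadget_edge /up_edge -/(sp h) !special_sp // !sp_row // !hub_vx // /hub_at /=.
have -> : (center_count + j < center_count) = false by lia.
have -> : center_count + j < z_row by lia.
have -> : (center_count + j == z_row) = false by lia.
have -> : (center_count + j == y_row) = false by lia.
by rewrite !andbF if_same orbF.
Qed.

Definition leaf_degree (f : nat -> nat -> nat) j :=
  \sum_(h < item_count) \sum_(t < leaf_count) f h t * (leaf_dim h t == j).

Lemma sum5 (X : nat -> nat) : \sum_(g < 5) X g = X 0 + X 1 + X 2 + X 3 + X 4.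
Proof. by rewrite !big_ord_recr big_ord0. Qed.

Lemma deg_in_dim (A : {set 'I_vertex_count}) j : j < dim_count ->
  deg_in e A (sp (center_count + j)) =
  leaf_degree (fun h t => vx 1 h t \in A) j + leaf_degree (fun h t => vx 2 h t \in A) j +
  \sum_(t < (2 * target).-1) (vx 3 j t \in A) + (sp z_row \in A) + (sp y_row \in A).
Proof.
move=> jd; have [ic cz zy yr cdz] := row_bounds.
pose F g h t := (vx g h t \in A) * e (sp (center_count + j)) (vx g h t).
rewrite deg_inE sum_vertices (sum5 (fun g => \sum_(h < row_count) \sum_(t < col_count) F g h t)).
have tag12 g : (g == 1) || (g == 2) ->
    \sum_(h < row_count) \sum_(t < col_count) F g h t =
    leaf_degree (fun h t => vx g h t \in A) j.
  move=> g12; pose F' h t :=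
    (vx g h t \in A) * ((h < item_count) && (t < leaf_count) && (leaf_dim h t == j)).
  transitivity (\sum_(h < row_count) \sum_(t < col_count) F' h t).
    apply: eq_bigr => h _; apply: eq_bigr => t _; rewrite /F edge_dim //;
      last by case/orP: g12 => /eqP->.
    by rewrite g12 (_ : (g == 0) = false) //; case/orP: g12 => /eqP->.
  rewrite (@sum_narrow2 item_count _ leaf_count); first last.
  - by move=> h t /negPf out; rewrite /F' out muln0.
  - exact/ltnW/leaf_count_col.
  - by lia.
  apply: eq_bigr => h _; apply: eq_bigr => t _.
  by rewrite /F' !ltn_ord.
have tag0 : \sum_(h < row_count) \sum_(t < col_count) F 0 h t = 0.
  by apply: big1 => h _; apply: big1 => t _; rewrite /F edge_dim // muln0.
have tag3 : \sum_(h < row_count) \sum_(t < col_count) F 3 h t =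
    \sum_(t < (2 * target).-1) (vx 3 j t \in A).
  transitivity (\sum_(h < row_count) (h == j :> nat) *
      \sum_(t < col_count) (vx 3 h t \in A) * (t < (2 * target).-1)).
    apply: eq_bigr => h _; rewrite big_distrr; apply: eq_bigr => t _; rewrite /F edge_dim //=.
    by rewrite -mulnb mulnCA.
  rewrite (sum_indic (k := j)
    (fun h => \sum_(t < col_count) (vx 3 h t \in A) * (t < (2 * target).-1))); last lia.
  rewrite (sum_narrow (a := (2 * target).-1)
    (F := fun t => (vx 3 j t \in A) * (t < (2 * target).-1))) ?(ltnW pad_count_col) //.
    by apply: eq_bigr => t _; rewrite ltn_ord muln1.
  by move=> t /andP[tt _]; rewrite ltnNge tt muln0.
have tag4 : \sum_(h < row_count) \sum_(t < col_count) F 4 h t =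
    (sp z_row \in A) + (sp y_row \in A).
  transitivity (\sum_(h < row_count)
      ((h == z_row :> nat) * (sp h \in A) + (h == y_row :> nat) * (sp h \in A))).
    apply: eq_bigr => h _.
    transitivity (\sum_(t < col_count) (t == 0 :> nat) *
        ((vx 4 h t \in A) * ((h == z_row :> nat) || (h == y_row :> nat)))).
      by apply: eq_bigr => t _; rewrite /F edge_dim //= -mulnb mulnCA.
    rewrite (sum_indic (k := 0) (fun t =>
      (vx 4 h t \in A) * ((h == z_row :> nat) || (h == y_row :> nat)))) //.
    rewrite -mulnDl mulnC; congr (_ * _).
    by case: eqP => [->|_] //=; rewrite ltn_eqF.
  rewrite big_split; congr (_ + _).
    by rewrite (sum_indic (k := z_row) (fun h => sp h \in A)) //; lia.
  by rewrite (sum_indic (k := y_row) (fun h => sp h \in A)).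
by rewrite tag0 (tag12 1) // (tag12 2) // tag3 tag4 add0n !addnA.
Qed.

Lemma vx_inj g h t g' h' t' : g < 5 -> h < row_count -> t < col_count ->
  g' < 5 -> h' < row_count -> t' < col_count ->
  vx g h t = vx g' h' t' -> [/\ g = g', h = h' & t = t'].
Proof.
move=> g5 hr tc g5' hr' tc' eqv.
split; first by rewrite -(vx_tag g5 hr tc) eqv vx_tag.
  by rewrite -(vx_row g5 hr tc) eqv vx_row.
by rewrite -(vx_col g5 hr tc) eqv vx_col.
Qed.

Lemma edge_center_pend h t : h < center_count -> t < col_count -> e (sp h) (vx 0 h t).
Proof.
move=> hc tc; have [ic cz zy yr cdz] := row_bounds.
have hr : h < row_count by lia.
by rewrite edgeC edge_sp ?special_vx // hub_vx // /hub_at /= hc.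
Qed.

Lemma edge_y_pend t : t < col_count -> e (sp y_row) (vx 0 z_row t).
Proof.
move=> tc; have [ic cz zy yr cdz] := row_bounds.
have zr : z_row < row_count by lia.
by rewrite edgeC edge_sp ?special_vx // hub_vx // /hub_at /= ltnNge cz eqxx.
Qed.

Lemma edge_z_center h : h < center_count -> ~~ item_ok h -> e (sp z_row) (sp h).
Proof.
move=> hc okh; have [ic cz zy yr cdz] := row_bounds.
have zr : z_row < row_count by lia.
have hr : h < row_count by lia.
rewrite /gadget_edge /up_edge !special_sp // !sp_row // !hub_vx // /hub_at /= hc okh eqxx.
by rewrite orbT.
Qed.

Lemma edge_z_dim j : j < dim_count -> e (sp z_row) (sp (center_count + j)).
Proof.
move=> jd; have [ic cz zy yr cdz] := row_bounds.
by rewrite edgeC edge_dim ?eqxx //; lia.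
Qed.

Lemma edge_y_dim j : j < dim_count -> e (sp y_row) (sp (center_count + j)).
Proof.
move=> jd; have [ic cz zy yr cdz] := row_bounds.
by rewrite edgeC edge_dim // !eqxx orbT.
Qed.

Lemma edge_leaf h t (v : 'I_vertex_count) : h < item_count -> t < leaf_count ->
  e (vx 1 h t) v = (v == sp h) || (v == sp (center_count + leaf_dim h t)).
Proof.
move=> hi tl; have [ic cz zy yr cdz] := row_bounds.
have hr : h < row_count by lia.
have tc : t < col_count by have := leaf_count_col; lia.
have dj := leaf_dim_ltn hi tl.
have kr : center_count + leaf_dim h t < row_count by lia.
have ns : ~~ special (vx 1 h t) by rewrite special_vx.
have hub1 k : hub (vx 1 h t) k = (k == h) || (k == center_count + leaf_dim h t).
  by rewrite hub_vx // /hub_at /= hi tl.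
apply/idP/orP.
  move/(edge_nonspecial ns) => [ev]; rewrite hub1.
  by case/orP => /eqP rv; [left | right]; rewrite ev rv.
by case=> /eqP->; rewrite edge_sp // hub1 eqxx ?orbT.
Qed.

Lemma edge_mirror h t (v : 'I_vertex_count) : h < item_count -> t < leaf_count ->
  e (vx 2 h t) v = (v == sp y_row) || (v == sp (center_count + leaf_dim h t)).
Proof.
move=> hi tl; have [ic cz zy yr cdz] := row_bounds.
have hr : h < row_count by lia.
have tc : t < col_count by have := leaf_count_col; lia.
have dj := leaf_dim_ltn hi tl.
have kr : center_count + leaf_dim h t < row_count by lia.
have ns : ~~ special (vx 2 h t) by rewrite special_vx.
have hub2 k : hub (vx 2 h t) k = (k == y_row) || (k == center_count + leaf_dim h t).
  by rewrite hub_vx // /hub_at /= hi tl.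
apply/idP/orP.
  move/(edge_nonspecial ns) => [ev]; rewrite hub2.
  by case/orP => /eqP rv; [left | right]; rewrite ev rv.
by case=> /eqP->; rewrite edge_sp // hub2 eqxx ?orbT.
Qed.

Lemma edge_z_pad j t : j < dim_count -> t < (2 * target).-1 -> e (sp z_row) (vx 3 j t).
Proof.
move=> jd tt; have [ic cz zy yr cdz] := row_bounds.
have jr : j < row_count by lia.
have tc : t < col_count by have := pad_count_col; lia.
have zr : z_row < row_count by lia.
by rewrite edgeC edge_sp ?special_vx // hub_vx // /hub_at /= jd tt eqxx.
Qed.

Lemma leq_leaf_degree (f f' : nat -> nat -> nat) j :
  (forall h t, h < item_count -> t < leaf_count -> leaf_dim h t = j -> f h t <= f' h t) ->
  leaf_degree f j <= leaf_degree f' j.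
Proof.
move=> ff; apply: leq_sum => h _; apply: leq_sum => t _.
by case: eqP => [/ff|_]; rewrite ?muln0 // leq_mul2r => ->; rewrite ?orbT.
Qed.

Lemma eq_leaf_degree (f f' : nat -> nat -> nat) j :
  (forall h t, h < item_count -> t < leaf_count -> f h t = f' h t) ->
  leaf_degree f j = leaf_degree f' j.
Proof.
by move=> ff; apply/eqP; rewrite eqn_leq; apply/andP; split; apply: leq_leaf_degree => h t hi tl _;
  rewrite ff.
Qed.

Lemma leaf_degree_add (f f' : nat -> nat -> nat) j :
  leaf_degree f j + leaf_degree f' j = leaf_degree (fun h t => f h t + f' h t) j.
Proof.
rewrite /leaf_degree -big_split; apply: eq_bigr => h _; rewrite -big_split.
by apply: eq_bigr => t _; rewrite mulnDl.
Qed.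

Lemma leq_sum_widen a b (F : nat -> nat) : a <= b -> \sum_(i < a) F i <= \sum_(i < b) F i.
Proof.
move=> ab; rewrite -!(big_mkord xpredT F) [X in _ <= X](@big_cat_nat _ _ _ a) //=.
exact: leq_addr.
Qed.

(** * What an alliance within the budget must contain *)

Section FromAlliance.
Variable S : {set 'I_vertex_count}.
Hypotheses (allianceS : offensive_alliance e S) (S_small : #|S| <= budget).

Lemma deg_in_budget v : deg_in e S v <= budget.
Proof.
by apply: leq_trans S_small; apply: subset_leq_card; apply/subsetP => u; rewrite inE => /andP[].
Qed.

Lemma alliance_deg (u v : 'I_vertex_count) : u \in S -> e v u -> v \notin S ->
  deg_in e (~: S) v < deg_in e S v.
Proof.
move=> uS evu vS; rewrite -addn1; apply: allianceS.2; rewrite inE vS.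
by apply/existsP; exists u; rewrite uS edgeC.
Qed.

(* Twice the budget is less than [col_count], so a vertex outside [S] with that
   many neighbours cannot have a neighbour in [S]. *)
Lemma high_degree (v : 'I_vertex_count) (f : nat -> 'I_vertex_count) u :
  (forall t, t < col_count -> e v (f t)) ->
  (forall t t', t < col_count -> t' < col_count -> f t = f t' -> t = t') ->
  u \in S -> e v u -> v \in S.
Proof.
move=> ef finj uS evu; apply/negPn/negP => vS.
have := alliance_deg uS evu vS; have := deg_in_budget v.
pose D := [set f t | t : 'I_col_count].
have cD : #|D| = col_count.
  by rewrite card_imset ?card_ord // => t t' /(finj _ _ (ltn_ord t) (ltn_ord t')) /val_inj.
have De x : x \in D -> e v x by case/imsetP => t _ ->; apply: ef.
have D1 : #|D :&: S| <= deg_in e S v.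
  by apply: subset_leq_card; apply/subsetP => x; rewrite !inE => /andP[/De-> ->].
have D2 : #|D :\: S| <= deg_in e (~: S) v.
  by apply: subset_leq_card; apply/subsetP => x; rewrite !inE => /andP[-> /De->].
have le_col : col_count <= deg_in e S v + deg_in e (~: S) v.
  by rewrite -cD -(cardsID S D) leq_add.
by move: le_col; rewrite /col_count; lia.
Qed.

Lemma center_high h u : h < center_count -> u \in S -> e (sp h) u -> sp h \in S.
Proof.
move=> hc; have [ic cz zy yr cdz] := row_bounds; have hr : h < row_count by lia.
apply: (@high_degree _ (vx 0 h)) => [t tc|t t' tc tc' /vx_inj]; first exact: edge_center_pend.
by case.
Qed.

Lemma y_high u : u \in S -> e (sp y_row) u -> sp y_row \in S.
Proof.
have [ic cz zy yr cdz] := row_bounds; have zr : z_row < row_count by lia.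
apply: (@high_degree _ (vx 0 z_row)) => [t tc|t t' tc tc' /vx_inj]; first exact: edge_y_pend.
by case.
Qed.

Lemma item_okN t : ~~ item_ok (item_count + t).
Proof. by rewrite /item_ok ltnNge leq_addr. Qed.

Lemma sp_inj h h' : h < row_count -> h' < row_count -> sp h = sp h' -> h = h'.
Proof. by move=> hr hr' /vx_inj []. Qed.

Lemma z_high u : u \in S -> e (sp z_row) u -> sp z_row \in S.
Proof.
have [ic cz zy yr cdz] := row_bounds.
apply: (@high_degree _ (fun t => sp (item_count + t))) => [t tc|t t' tc tc' /sp_inj].
  by apply: edge_z_center; [rewrite /center_count ltn_add2l | apply: item_okN].
have cc : center_count = item_count + col_count by [].
by move=> H; apply/(@addnI item_count)/H; lia.
Qed.

(** The [col_count] centers from row [item_count] on are never allowed, hence adjacent to [z], and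
    each has [col_count] pendant neighbours. Together with [z] all of them would lie in [S], beyond
    the budget. *)
Lemma z_notin : sp z_row \notin S.
Proof.
apply/negP => zS; have [ic cz zy yr cdz] := row_bounds.
pose D := [set sp (item_count + t) | t : 'I_col_count].
have cD : #|D| = col_count.
  have cc : center_count = item_count + col_count by [].
  rewrite card_imset ?card_ord // => t t' /sp_inj H; apply/val_inj/(@addnI item_count)/H;
    by have := ltn_ord t; have := ltn_ord t'; lia.
suff DS : D \subset S.
  by have := leq_trans (subset_leq_card DS) S_small; rewrite cD /col_count; lia.
apply/subsetP => _ /imsetP[t _ ->].
have tc : item_count + t < center_count by rewrite ltn_add2l.
by apply: center_high zS _ => //; rewrite edgeC; apply: edge_z_center => //; apply: item_okN.
Qed.

Lemma z_nbr_notin u : e (sp z_row) u -> u \notin S.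
Proof. by move=> ezu; apply/negP => uS; move: z_notin; rewrite (z_high uS ezu). Qed.

Lemma center_item_ok h : h < center_count -> sp h \in S -> item_ok h.
Proof.
by move=> hc; apply: contraTT => okh; apply: z_nbr_notin; apply: edge_z_center.
Qed.

Lemma dim_notin j : j < dim_count -> sp (center_count + j) \notin S.
Proof. by move=> jd; apply: z_nbr_notin; apply: edge_z_dim. Qed.

(** A vertex of degree two outside [S] with one neighbour on each side is a tie, whereas an alliance
    demands a strict majority. *)
Lemma forced_in (u a b : 'I_vertex_count) : a \in S -> b \notin S ->
  (forall v : 'I_vertex_count, e u v = (v == a) || (v == b)) -> u \in S.
Proof.
move=> aS bS eu; apply/negPn/negP => uS.
have := alliance_deg aS (_ : e u a) uS; rewrite eu eqxx => /(_ isT).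
have dS : deg_in e S u <= 1.
  rewrite -(cards1 a); apply: subset_leq_card; apply/subsetP => v; rewrite !inE eu.
  by case/andP=> vS /orP[//|/eqP vb]; rewrite vb (negPf bS) in vS.
have dSc : 0 < deg_in e (~: S) u.
  by apply/card_gt0P; exists b; rewrite !inE bS eu eqxx orbT.
by move=> lt_deg; have := leq_trans (leq_ltn_trans dSc lt_deg) dS; rewrite ltnn.
Qed.

Lemma leaf_inE h t : h < item_count -> t < leaf_count ->
  (vx 1 h t \in S) = (sp h \in S).
Proof.
move=> hi tl; have [ic cz zy yr cdz] := row_bounds.
apply/idP/idP => [lS|hS].
  by apply: center_high lS _; rewrite 1?edgeC ?edge_leaf ?eqxx //; apply: leq_trans ic.
by apply: (forced_in hS (dim_notin (leaf_dim_ltn hi tl))) => v; apply: edge_leaf.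
Qed.

(* If [y] is not in [S], then the mirrors outnumber the leaves around a dimension. *)
Lemma leaf_y h t : h < item_count -> t < leaf_count -> vx 1 h t \in S -> sp y_row \in S.
Proof.
move=> hi tl lS; apply/negPn/negP => yS; have jd := leaf_dim_ltn hi tl.
have mirS h' t' : h' < item_count -> t' < leaf_count -> vx 2 h' t' \notin S.
  move=> hi' tl'; apply: contra yS => mS; apply: y_high mS _.
  by rewrite edgeC edge_mirror // eqxx.
have := alliance_deg lS (_ : e (sp (center_count + leaf_dim h t)) (vx 1 h t)) (dim_notin jd).
rewrite edgeC edge_leaf // eqxx orbT => /(_ isT).
rewrite !deg_in_dim // (negPf z_notin) (negPf yS) !addn0.
rewrite [\sum_(t < _) (_ \in S)]big1 => [|t' _]; last first.
  by rewrite (negPf (z_nbr_notin (edge_z_pad _ _))).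
have -> : leaf_degree (fun h t => vx 2 h t \in S) (leaf_dim h t) = 0.
  by apply: big1 => h' _; apply: big1 => t' _; rewrite (negPf (mirS _ _ _ _)).
rewrite ltnNge !addn0; case/negP.
apply: leq_trans (_ : _ <= leaf_degree (fun h t => vx 2 h t \in ~: S) _) _.
  by apply: leq_leaf_degree => h' t' hi' tl' _; rewrite inE mirS // leq_b1.
by lia.
Qed.

Lemma center_y h : h < center_count -> sp h \in S -> sp y_row \in S.
Proof.
move=> hc hS; have /andP[hi _] := center_item_ok hc hS.
by apply: (leaf_y hi leaf_count_gt0); rewrite leaf_inE // leaf_count_gt0.
Qed.

(** Nonemptiness suffices: a pendant vertex of a center drags in the center, a center its leaves,
    and a leaf [y]. The vertex [z] and its neighbours are excluded, and all remaining vertices are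
    [y] or adjacent to it. *)
Lemma y_in : sp y_row \in S.
Proof.
have [ic cz zy yr cdz] := row_bounds.
have [/set0Pn[u uS] _] := allianceS; have [g [h [t [g5 hr tc uE]]]] := vertexP u.
have [su|su] := boolP (special u).
  move: uS; rewrite (specialE su); move: (vertex_row u) (vertex_row_ltn u) => k kr kS.
  case: (ltnP k center_count) => kc; first exact: center_y kS.
  case: (ltnP k z_row) => kz.
    by have := dim_notin (j := k - center_count); rewrite subnKC // kS; lia.
  have [kz'|ky] : k = z_row \/ k = y_row by move: kr; rewrite /row_count /y_row; lia.
    by move: z_notin; rewrite -kz' kS.
  by rewrite -ky.
have ynbr : hub u y_row -> sp y_row \in S.
  by move=> hy; apply: y_high uS _; rewrite edgeC edge_sp.
rewrite uE hub_vx // in ynbr; move: ynbr; rewrite /hub_at.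
case: g g5 uE => [|[|[|[|[|//]]]]] _ uE /=.
- case: ifP => [hc _|_]; last by apply; rewrite eqxx.
  apply: (center_y hc); apply: (center_high hc uS).
  by rewrite uE; apply: edge_center_pend hc tc.
- case: ifP => [/andP[hi tl] _|_]; last by apply; rewrite eqxx.
  by apply: (leaf_y hi tl); rewrite -uE.
- by case: ifP => _; apply; rewrite eqxx.
- case: ifP => [/andP[jd tt] _|_]; last by apply; rewrite eqxx.
  by have := z_nbr_notin (edge_z_pad jd tt); rewrite -uE uS.
- have -> : t != 0 by move: su; rewrite uE special_vx.
  by apply; rewrite eqxx.
Qed.

Lemma mirror_in h t : h < item_count -> t < leaf_count -> vx 2 h t \in S.
Proof.
move=> hi tl; apply: (forced_in y_in (dim_notin (leaf_dim_ltn hi tl))) => v.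
exact: edge_mirror.
Qed.

(** All mirrors and [y] lie in [S], and each chosen center brings its leaves; the rest of the budget
    pays for [class_count] such centers. *)
Lemma chosen_count : \sum_(h < item_count) (sp h \in S) <= class_count.
Proof.
have [ic cz zy yr cdz] := row_bounds.
set c := \sum_(h < _) _.
have sumS : \sum_u (u \in S : nat) = #|S| by rewrite -sum1_card [RHS]big_mkcond.
suff : 1 + item_count * leaf_count + c * leaf_count.+1 <= #|S|.
  move/leq_trans => /(_ _ S_small); rewrite /budget leq_add2l leq_mul2r; exact.
pose F g h t := (vx g h t \in S : nat).
rewrite -sumS sum_vertices (sum5 (fun g => \sum_(h < row_count) \sum_(t < col_count) F g h t)).
have widen g : \sum_(h < item_count) \sum_(t < leaf_count) F g h t <=
    \sum_(h < row_count) \sum_(t < col_count) F g h t.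
  apply: leq_trans (_ : _ <= \sum_(h < item_count) \sum_(t < col_count) F g h t) _; last first.
    by apply: (leq_sum_widen (fun h => \sum_(t < col_count) F g h t)); lia.
  by apply: leq_sum => h _; apply: leq_sum_widen; apply/ltnW/leaf_count_col.
have t1 : c * leaf_count <= \sum_(h < row_count) \sum_(t < col_count) F 1 h t.
  apply: leq_trans (widen 1); rewrite /c big_distrl; apply: leq_sum => h _.
  case hS: (sp h \in S); last by [].
  rewrite [X in X <= _](mul1n leaf_count) -[leaf_count in X in X <= _]card_ord -sum1_card.
  by apply: leq_sum => t _; rewrite /F leaf_inE // hS.
have t2 : item_count * leaf_count <= \sum_(h < row_count) \sum_(t < col_count) F 2 h t.
  apply: leq_trans (widen 2); rewrite -[item_count in X in X <= _]card_ord -sum_nat_const.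
  apply: leq_sum => h _; rewrite -[leaf_count in X in X <= _]card_ord -sum1_card.
  by apply: leq_sum => t _; rewrite /F mirror_in.
have t4 : 1 + c <= \sum_(h < row_count) \sum_(t < col_count) F 4 h t.
  apply: (@leq_trans (\sum_(h < row_count) F 4 h 0)).
    have -> : \sum_(h < row_count) F 4 h 0 = \sum_(h < y_row) F 4 h 0 + F 4 y_row 0.
      by rewrite /row_count big_ord_recr.
    rewrite {2}/F y_in addnC leq_add2r.
    by apply: (leq_sum_widen (fun h => F 4 h 0)); lia.
  apply: leq_sum => h _.
  by have := leq_sum_widen (F 4 h) (isT : 1 <= col_count); rewrite big_ord1.
by rewrite mulnS; lia.
Qed.

(** Let [a] leaves of chosen and [b] leaves of unchosen items be adjacent to the dimension. Its
    neighbours inside are the [a], all [a + b] mirrors and [y]; those outside are the [b], the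
    [2 * target - 1] padding vertices and [z]. The condition [b + 2 * target < 2 * a + b + 1] says
    [target <= a]. *)
Lemma chosen_target j : j < dim_count -> target <= leaf_degree (fun h _ => sp h \in S) j.
Proof.
move=> jd.
have := alliance_deg y_in (_ : e (sp (center_count + j)) (sp y_row)) (dim_notin jd).
rewrite edgeC edge_y_dim // => /(_ isT).
rewrite !deg_in_dim // y_in (negPf z_notin) !inE y_in (negPf z_notin) /=.
rewrite [\sum_(t < _) (_ \in S)]big1 => [|t' _]; last first.
  by rewrite (negPf (z_nbr_notin (edge_z_pad _ _))).
rewrite [\sum_(t < _) (_ \in ~: S)](eq_bigr (fun=> 1)) => [|t' _]; last first.
  by rewrite inE (z_nbr_notin (edge_z_pad _ _)).
rewrite sum1_card card_ord.
have -> : leaf_degree (fun h t => vx 1 h t \in S) j = leaf_degree (fun h _ => sp h \in S) j.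
  by apply: eq_leaf_degree => h t hi tl; rewrite leaf_inE.
have -> : leaf_degree (fun h t => vx 1 h t \in ~: S) j = leaf_degree (fun h _ => sp h \notin S) j.
  by apply: eq_leaf_degree => h t hi tl; rewrite inE leaf_inE.
have -> : leaf_degree (fun h t => vx 2 h t \in S) j = leaf_degree (fun _ _ => 1) j.
  by apply: eq_leaf_degree => h t hi tl; rewrite mirror_in.
have <- : leaf_degree (fun h _ => sp h \in S) j + leaf_degree (fun h _ => sp h \notin S) j =
    leaf_degree (fun _ _ => 1) j.
  by rewrite leaf_degree_add; apply: eq_leaf_degree => h t _ _; case: (_ \in _).
have := target_gt0; move: (leaf_degree _ j) => a; move: (leaf_degree _ j) => b.
by move: (leaf_degree _ j) => c; lia.
Qed.

End FromAlliance.

(** * The alliance given by a choice of items *)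

Section ToAlliance.
Variable ch : nat -> bool.
Hypothesis ch_ok : forall h, h < item_count -> ch h -> item_ok h.
Hypothesis ch_count : \sum_(h < item_count) ch h = class_count.
Hypothesis ch_target : forall j, j < dim_count -> target <= leaf_degree (fun h _ => ch h) j.

Definition chosen_at g h t : bool :=
  if g == 1 then [&& h < item_count, t < leaf_count & ch h]
  else if g == 2 then (h < item_count) && (t < leaf_count)
  else [&& g == 4, t == 0 & ((h < item_count) && ch h) || (h == y_row)].

Definition chosen_set : {set 'I_vertex_count} :=
  [set u : 'I_vertex_count | chosen_at (vertex_tag u) (vertex_row u) (vertex_col u)].

Lemma mem_chosen g h t : g < 5 -> h < row_count -> t < col_count ->
  (vx g h t \in chosen_set) = chosen_at g h t.
Proof. by move=> g5 hr tc; rewrite inE vx_tag ?vx_row ?vx_col. Qed.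

Lemma mem_chosen_sp k : k < row_count ->
  (sp k \in chosen_set) = ((k < item_count) && ch k) || (k == y_row).
Proof. by move=> kr; rewrite mem_chosen. Qed.

Lemma card_chosen : #|chosen_set| = budget.
Proof.
have [ic cz zy yr cdz] := row_bounds.
pose F g h t := (vx g h t \in chosen_set : nat).
rewrite -sum1_card big_mkcond /=.
rewrite (eq_bigr (fun u => (u \in chosen_set : nat))); last by move=> u _; case: ifP.
rewrite sum_vertices (sum5 (fun g => \sum_(h < row_count) \sum_(t < col_count) F g h t)).
have zero g : g < 5 -> (forall h t, chosen_at g h t = false) ->
    \sum_(h < row_count) \sum_(t < col_count) F g h t = 0.
  move=> g5 out; apply: big1 => h _; apply: big1 => t _.
  by rewrite /F mem_chosen // out.
have narrow g (G : nat -> nat) : g < 5 ->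
    (forall h t, chosen_at g h t = (h < item_count) && (t < leaf_count) && (G h != 0)) ->
    (forall h, G h <= 1) ->
    \sum_(h < row_count) \sum_(t < col_count) F g h t = (\sum_(h < item_count) G h) * leaf_count.
  move=> g5 gE G1.
  transitivity (\sum_(h < row_count) \sum_(t < col_count) (chosen_at g h t : nat)).
    by apply: eq_bigr => h _; apply: eq_bigr => t _; rewrite /F mem_chosen.
  rewrite (@sum_narrow2 item_count _ leaf_count _ (fun h t => chosen_at g h t)); first last.
  - by move=> h t /negPf out; rewrite gE out.
  - exact/ltnW/leaf_count_col.
  - by lia.
  rewrite big_distrl; apply: eq_bigr => h _.
  rewrite (eq_bigr (fun=> G h)) => [|t _]; first by rewrite sum_nat_const card_ord mulnC.
  by rewrite gE !ltn_ord; have := G1 h; case: (G h) => [|[]].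
rewrite (zero 0) // (zero 3) //.
rewrite (narrow 1 (fun h => ch h)) //; first last.
- by move=> h; case: (ch h).
- by move=> h t; rewrite /chosen_at /= andbA; case: (ch h).
rewrite (narrow 2 (fun=> 1)) //; last by move=> h t; rewrite andbT.
have -> : \sum_(h < row_count) \sum_(t < col_count) F 4 h t = class_count + 1.
  transitivity (\sum_(h < row_count) (((h < item_count) && ch h) + (h == y_row :> nat) * 1)).
    apply: eq_bigr => h _.
    transitivity (\sum_(t < col_count) (t == 0 :> nat) *
        (((h < item_count) && ch h) || (h == y_row :> nat))).
      by apply: eq_bigr => t _; rewrite /F mem_chosen // /chosen_at /= mulnb.
    rewrite (sum_indic (fun _ => ((h < item_count) && ch h) || (h == y_row :> nat) : nat)) //.
    by case: eqP => [->|_]; rewrite ?orbF ?addn0 // ltnNge; have -> : item_count <= y_row by lia.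
  rewrite big_split; congr (_ + _); last by rewrite (sum_indic (fun=> 1)).
  rewrite (sum_narrow (a := item_count) (F := fun h => (h < item_count) && ch h)) -?ch_count //.
  - by apply: eq_bigr => h _; rewrite ltn_ord.
  - by lia.
  - by move=> h /andP[hi _]; rewrite ltnNge hi.
rewrite sum_nat_const card_ord muln1 ch_count /budget mulnS add0n addn0; lia.
Qed.

Lemma chosen_only_nbr (v : 'I_vertex_count) k : ~~ special v -> k < row_count ->
  sp k \in chosen_set -> hub v k -> (forall l, hub v l -> l = k) ->
  deg_in e (~: chosen_set) v + 1 <= deg_in e chosen_set v.
Proof.
move=> sv kr kS hvk only.
have -> : deg_in e (~: chosen_set) v = 0.
  apply: eq_card0 => w; rewrite in_set in_setC; apply/negP => /andP[wS].
  by case/(edge_nonspecial sv) => we hw; move: wS; rewrite we (only _ hw) kS.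
apply/card_gt0P; exists (sp k); rewrite in_set kS /=.
by have := edge_sp sv kr; rewrite /= => ->.
Qed.

Lemma chosen_dim j : j < dim_count ->
  deg_in e (~: chosen_set) (sp (center_count + j)) + 1 <=
  deg_in e chosen_set (sp (center_count + j)).
Proof.
move=> jd; have [ic cz zy yr cdz] := row_bounds.
have leaf_col t : t < leaf_count -> t < col_count by move=> tl; apply: ltn_trans leaf_count_col.
have item_row h : h < item_count -> h < row_count by lia.
have zr : z_row < row_count by lia.
have yS : sp y_row \in chosen_set by rewrite mem_chosen_sp // eqxx orbT.
have zS : sp z_row \notin chosen_set.
  by rewrite mem_chosen_sp // negb_or; apply/andP; split; lia.
rewrite !deg_in_dim // !in_setC yS (negPf zS).
have -> : \sum_(t < (2 * target).-1) (vx 3 j t \in ~: chosen_set) = (2 * target).-1.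
  rewrite (eq_bigr (fun=> 1)) => [|t _]; first by rewrite sum1_card card_ord.
  have tc := ltn_trans (ltn_ord t) pad_count_col.
  by rewrite in_setC mem_chosen //; lia.
have -> : leaf_degree (fun h t => vx 1 h t \in chosen_set) j = leaf_degree (fun h _ => ch h) j.
  apply: eq_leaf_degree => h t hi tl.
  by rewrite mem_chosen ?item_row ?leaf_col // /chosen_at /= hi tl.
have -> : leaf_degree (fun h t => vx 1 h t \in ~: chosen_set) j =
    leaf_degree (fun h _ => ~~ ch h) j.
  apply: eq_leaf_degree => h t hi tl.
  by rewrite in_setC mem_chosen ?item_row ?leaf_col // /chosen_at /= hi tl.
have -> : leaf_degree (fun h t => vx 2 h t \in chosen_set) j = leaf_degree (fun _ _ => 1) j.
  apply: eq_leaf_degree => h t hi tl.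
  by rewrite mem_chosen ?item_row ?leaf_col // /chosen_at /= hi tl.
have -> : leaf_degree (fun h t => vx 2 h t \in ~: chosen_set) j = 0.
  apply: big1 => h _; apply: big1 => t _.
  by rewrite in_setC mem_chosen ?item_row ?leaf_col // /chosen_at /= !ltn_ord.
have <- : leaf_degree (fun h _ => ch h) j + leaf_degree (fun h _ => ~~ ch h) j =
    leaf_degree (fun _ _ => 1) j.
  by rewrite leaf_degree_add; apply: eq_leaf_degree => h t _ _; case: (ch h).
have := ch_target jd; have := target_gt0.
move: (leaf_degree _ j) => a; move: (leaf_degree _ j) => b.
by move: (\sum_(t < _) _) => c; rewrite /=; lia.
Qed.

(** Chosen centers are allowed, so [z] has no neighbour in the set; the dimensions are the only
    special vertices left to check. *)
Lemma chosen_low_special (u : 'I_vertex_count) k : k < row_count -> u \in chosen_set ->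
  e u (sp k) -> sp k \in chosen_set \/ center_count <= k < z_row.
Proof.
move=> kr uS; have [ic cz zy yr cdz] := row_bounds; have yz : y_row = z_row.+1 by [].
have [g [h [t [g5 hr tc uE]]]] := vertexP u.
move: uS; rewrite uE mem_chosen // /chosen_at.
case: (g =P 1) => [->|_].
  case/and3P => hi tl chh; rewrite edge_leaf // => /orP[] /eqP kE.
    by apply: or_introl; rewrite kE mem_chosen_sp // hi chh.
  have jd := leaf_dim_ltn hi tl.
  by apply: or_intror; rewrite (sp_inj kr _ kE); lia.
case: (g =P 2) => [->|_].
  case/andP => hi tl; rewrite edge_mirror // => /orP[] /eqP kE.
    by apply: or_introl; rewrite kE mem_chosen_sp // eqxx orbT.
  have jd := leaf_dim_ltn hi tl.
  by apply: or_intror; rewrite (sp_inj kr _ kE); lia.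
case/and3P => /eqP-> /eqP-> hS.
rewrite -/(sp h) /gadget_edge /up_edge !special_sp // !sp_row // !hub_vx // /hub_at /=.
move=> eP; suff : center_count <= k < z_row by apply: or_intror.
case/orP: hS eP => [/andP[hi chh]|/eqP->].
  have hc : h < center_count by lia.
  rewrite hc (ch_ok hi chh) /=; case: ltnP => kc; first by case/andP => _ /eqP; lia.
  by case/andP => ->.
have -> : (y_row < center_count) = false by lia.
have -> : (y_row < z_row) = false by lia.
by rewrite /=; case: ltnP => kc; [case/andP => _ /eqP; lia | case/andP => ->].
Qed.

(** A vertex outside the set that is not special but touches the set is a pendant vertex of a chosen
    center or of [y], so its whole neighbourhood is chosen. *)
Lemma chosen_alliance : offensive_alliance e chosen_set.
Proof.
have [ic cz zy yr cdz] := row_bounds; have yz : y_row = z_row.+1 by [].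
split; first by apply/set0Pn; exists (sp y_row); rewrite mem_chosen_sp // eqxx orbT.
move=> v; rewrite in_set => /andP[vS /existsP[u /andP[uS euv]]].
have [sv|sv] := boolP (special v).
  have vE := specialE sv; move: (vertex_row v) (vertex_row_ltn v) vE => k kr vE.
  rewrite vE in vS euv *.
  have [kS|kz] := chosen_low_special kr uS euv; first by rewrite kS in vS.
  have -> : k = center_count + (k - center_count) by lia.
  by apply: chosen_dim; lia.
have [uE huv] := edge_nonspecial sv (etrans (edgeC v u) euv).
move: (vertex_row u) (vertex_row_ltn u) uE huv => k kr uE huv.
have kS : ((k < item_count) && ch k) || (k == y_row) by rewrite -mem_chosen_sp // -uE.
rewrite uE in uS.
apply: (chosen_only_nbr sv kr uS huv) => l hvl.
have [g [h [t [g5 hr tc gE]]]] := vertexP v.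
move: vS huv hvl; rewrite gE mem_chosen // !hub_vx // /hub_at /chosen_at.
case: g g5 gE => [|[|[|[|[|//]]]]] _ gE /=.
- by move=> _; case: ifP => _ /eqP-> /eqP->.
- case: ifP => [/andP[hi tl]|_] => [|_ /eqP-> /eqP->//].
  rewrite hi tl /= => chh /orP[] /eqP kE; last by have := leaf_dim_ltn hi tl; lia.
  by move: kS; rewrite kE hi (negPf chh) /=; lia.
- case: ifP => [/andP[hi tl]|_] => [//|_ /eqP-> /eqP->//].
- case: ifP => [/andP[jd tt] _|_ _ /eqP-> /eqP->//].
  by case/orP => /eqP kE; lia.
have -> : t != 0 by move: sv; rewrite gE special_vx.
by move=> _ /eqP-> /eqP->.
Qed.

End ToAlliance.

(** * Chosen items and solutions of the constraint problem *)

Lemma leq_sum_one n (F : nat -> nat) : (forall i, i < n -> 0 < F i) -> \sum_(i < n) F i <= n ->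
  forall i, i < n -> F i = 1.
Proof.
move=> F0 Fn i i_n; move: Fn; rewrite (bigD1 (Ordinal i_n)) //=.
have : \sum_(j < n | j != Ordinal i_n) 1 <= \sum_(j < n | j != Ordinal i_n) F j.
  by apply: leq_sum => j _; apply: F0.
have : 1 + \sum_(j < n | j != Ordinal i_n) 1 = n.
  rewrite (eq_bigl (mem (predC1 (Ordinal i_n)))) // sum1_card cardC1 card_ord.
  by rewrite add1n prednK //; apply: leq_ltn_trans i_n.
have := F0 i i_n; move: (\sum_(j < n | _) 1) => A; move: (\sum_(j < n | _) F j) => B.
by lia.
Qed.

Lemma sum_geq_ord n c : \sum_(l < n) (c <= l) = n - c.
Proof. by elim: n => [|n IH]; rewrite ?big_ord0 // big_ord_recr IH /=; lia. Qed.

Lemma sum_ltn_ord n c : \sum_(l < n) (l < c) = minn n c.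
Proof. by elim: n => [|n IH]; rewrite ?big_ord0 ?min0n // big_ord_recr IH /=; lia. Qed.

Lemma sum_indic2 a k l (F : nat -> nat -> nat) : k < a -> l < a ->
  \sum_(i < a) \sum_(j < a) (i == k :> nat) * (j == l :> nat) * F i j = F k l.
Proof.
move=> ka la; rewrite -(sum_indic (F k) la).
rewrite -(sum_indic (fun i => \sum_(j < a) (j == l :> nat) * F i j) ka).
apply: eq_bigr => i _; rewrite big_distrr /=; apply: eq_bigr => j _.
by rewrite mulnA.
Qed.

Lemma pair_eq a b c d n : b < n -> d < n ->
  (a * n + b == c * n + d) = (a == c) && (b == d).
Proof.
move=> bn dn; have n0 : 0 < n by apply: leq_ltn_trans bn.
apply/eqP/andP => [E|[/eqP-> /eqP->]//].
have := congr1 (fun x => x %/ n) E; have := congr1 (fun x => x %% n) E.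
by rewrite !modnMDl !modn_small // !divnMDl // !divn_small // !addn0 => -> ->.
Qed.

Definition gadget_csp (V : nat -> nat) : Prop :=
  forall sigma, sigma < class_count -> exists gamma, [/\ gamma < choice_count,
    forall q, q < Q -> dig N gamma q = V (dig m sigma q) & al sigma gamma].

Section Chosen.
Variable gamma : nat -> nat.
Hypothesis gamma_choice : forall sigma, sigma < class_count -> gamma sigma < choice_count.
Let ch h := h %% choice_count == gamma (h %/ choice_count).
Let c o := dig N (gamma (o %/ Q)) (o %% Q).

Lemma item_div sigma g : g < choice_count -> (sigma * choice_count + g) %/ choice_count = sigma.
Proof. by move=> gc; rewrite divnMDl ?choice_count_gt0 // divn_small ?addn0. Qed.

Lemma item_mod sigma g : g < choice_count -> (sigma * choice_count + g) %% choice_count = g.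
Proof. by move=> gc; rewrite modnMDl modn_small. Qed.

Lemma leaf_dimE sigma g i p l : g < choice_count -> i < Q -> p < occ_count -> l < target ->
  leaf_dim (sigma * choice_count + g) ((i * occ_count + p) * target + l) =
  let o := sigma * Q + i in
  if (occ_block o == occ_block p) && (dig N g i <= l)
  then p * occ_count + o else o * occ_count + p.
Proof.
move=> gc iQ po lt; have t0 := target_gt0; have o0 := occ_count_gt0.
rewrite /leaf_dim /occ_value item_div // item_mod // modnMDl (modn_small lt).
rewrite divnMDl // (divn_small lt) addn0 modnMDl (modn_small po).
by rewrite divnMDl // (divn_small po) addn0.
Qed.

Lemma chosen_sum (F : nat -> nat) :
  \sum_(h < item_count) ch h * F h =
  \sum_(sigma < class_count) F (sigma * choice_count + gamma sigma).
Proof.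
rewrite (sum_ord_mul (fun h => ch h * F h)); apply: eq_bigr => sigma _.
have gc := gamma_choice (ltn_ord sigma).
rewrite -(sum_indic (fun g => F (sigma * choice_count + g)) gc).
by apply: eq_bigr => g _; rewrite /ch item_div // item_mod.
Qed.

(** Occurrences of different blocks impose nothing: all [target] leaves of [o] for [o'] then stay at
    the dimension, which is exactly enough. *)
Lemma chosen_leaf_degree o o' : o < occ_count -> o' < occ_count ->
  leaf_degree (fun h _ => ch h) (o * occ_count + o') =
  if occ_block o == occ_block o' then c o + (target - c o') else target.
Proof.
move=> oo oo'; have t0 := target_gt0; have occ0 := occ_count_gt0.
have c_target o1 : c o1 <= target.
  by rewrite /target -ltnS prednK ?dig_ltn; lia.
transitivity (\sum_(O < occ_count) \sum_(p < occ_count) \sum_(l < target)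
   ((if (occ_block O == occ_block p) && (c O <= l)
     then p * occ_count + O else O * occ_count + p) == o * occ_count + o')).
  rewrite /leaf_degree.
  transitivity (\sum_(h < item_count) ch h *
      \sum_(t < leaf_count) (leaf_dim h t == o * occ_count + o')).
    by apply: eq_bigr => h _; rewrite big_distrr.
  rewrite (chosen_sum (fun h => \sum_(t < leaf_count) (leaf_dim h t == o * occ_count + o'))).
  rewrite (sum_ord_mul (fun O => \sum_(p < occ_count) \sum_(l < target)
   ((if (occ_block O == occ_block p) && (c O <= l)
     then p * occ_count + O else O * occ_count + p) == o * occ_count + o'))).
  apply: eq_bigr => sigma _; have gc := gamma_choice (ltn_ord sigma).
  rewrite (sum_ord_mul (fun t =>
    leaf_dim (sigma * choice_count + gamma sigma) t == o * occ_count + o' : nat)).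
  rewrite (sum_ord_mul (fun t => \sum_(l < target)
    (leaf_dim (sigma * choice_count + gamma sigma) (t * target + l) == o * occ_count + o'))).
  apply: eq_bigr => i _; apply: eq_bigr => p _; apply: eq_bigr => l _.
  by rewrite leaf_dimE //= /c divnMDl // (divn_small (ltn_ord i)) addn0 modnMDl modn_small.
(* [A O p] counts the leaves of [O] for [p] that go to dimension [(O, p)], and [B O p] those that go
   to [(p, O)]. *)
pose A O p := if occ_block O == occ_block p then c O else target.
pose B O p := if occ_block O == occ_block p then target - c O else 0.
transitivity (\sum_(O < occ_count) \sum_(p < occ_count)
    ((O == o :> nat) * (p == o' :> nat) * A O p + (O == o' :> nat) * (p == o :> nat) * B O p)).
  apply: eq_bigr => O _; apply: eq_bigr => p _; rewrite /A /B.
  case: eqP => _ /=; last first.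
    rewrite muln0 addn0 (eq_bigr (fun=> (O == o :> nat) * (p == o' :> nat))).
      by rewrite sum_nat_const card_ord mulnC.
    by move=> l _; rewrite pair_eq // mulnb.
  transitivity (\sum_(l < target) ((O == o :> nat) * (p == o' :> nat) * (l < c O) +
      (O == o' :> nat) * (p == o :> nat) * (c O <= l))); last first.
    by rewrite big_split /= -!big_distrr /= sum_ltn_ord sum_geq_ord (minn_idPr _).
  apply: eq_bigr => l _; rewrite ltnNge.
  by case: leqP => _; rewrite pair_eq //= ?muln0 ?muln1 ?addn0 ?add0n mulnb // andbC.
rewrite (eq_bigr (fun O : 'I_occ_count =>
  \sum_(p < occ_count) (O == o :> nat) * (p == o' :> nat) * A O p +
  \sum_(p < occ_count) (O == o' :> nat) * (p == o :> nat) * B O p)); last first.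
  by move=> O _; rewrite big_split.
rewrite big_split /= (sum_indic2 A) // (sum_indic2 B) // /A /B [occ_block o' == _]eq_sym.
by case: eqP; rewrite ?addn0.
Qed.

End Chosen.

Lemma gadget_complete : (exists V, gadget_csp V) ->
  exists S, offensive_alliance e S /\ #|S| = budget.
Proof.
move=> [V HV].
pose P sigma g := all (fun q => dig N g q == V (dig m sigma q)) (iota 0 Q) && al sigma g.
pose gamma sigma := find (P sigma) (iota 0 choice_count).
have gammaP sigma : sigma < class_count -> gamma sigma < choice_count /\ P sigma (gamma sigma).
  move=> /HV[g [gc gV ag]].
  have hasP' : has (P sigma) (iota 0 choice_count).
    apply/hasP; exists g; first by rewrite mem_iota.
    by rewrite /P ag andbT; apply/allP => q; rewrite mem_iota => /gV ->.
  have lt : gamma sigma < choice_count by rewrite -[X in _ < X](size_iota 0) -has_find.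
  by split=> //; have := nth_find 0 hasP'; rewrite nth_iota.
have gc sigma : sigma < class_count -> gamma sigma < choice_count by case/gammaP.
pose ch h := h %% choice_count == gamma (h %/ choice_count).
have count : \sum_(h < item_count) ch h = class_count.
  have := chosen_sum gc (fun=> 1); rewrite sum1_card card_ord => <-.
  by apply: eq_bigr => h _; rewrite muln1.
exists (chosen_set ch); split; last exact: card_chosen.
have hdiv h : h < item_count -> h %/ choice_count < class_count.
  by move=> hi; rewrite ltn_divLR ?choice_count_gt0.
apply: chosen_alliance (count) _ => [h hi /eqP hg|j jd].
  by rewrite /item_ok hi hg; have [_ /andP[]] := gammaP _ (hdiv h hi).
have occ0 := occ_count_gt0.
have oj : j %/ occ_count < occ_count by rewrite ltn_divLR.
have oj' : j %% occ_count < occ_count by rewrite ltn_mod.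
rewrite (divn_eq j occ_count) chosen_leaf_degree //.
case: eqP => // blk; set c1 := dig _ _ _; set c2 := dig _ _ _.
have cV o : o < occ_count -> dig N (gamma (o %/ Q)) (o %% Q) = V (occ_block o).
  move=> oo; have so : o %/ Q < class_count by rewrite ltn_divLR.
  have [_ /andP[/allP H _]] := gammaP _ so; apply/eqP/H.
  by rewrite mem_iota ltn_mod.
(* Both occurrences take the value of [V] at their common block, so the two leaf counts add up to
   [target]. *)
have -> : c1 = c2 by rewrite /c1 /c2 !cV // blk.
have : c2 <= target by rewrite /target -ltnS prednK ?dig_ltn; lia.
lia.
Qed.

Lemma gadget_sound : (exists S, offensive_alliance e S /\ #|S| <= budget) ->
  exists V, gadget_csp V.
Proof.
move=> [S [aS Sb]]; have occ0 := occ_count_gt0; have t0 := target_gt0.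
have c0 := choice_count_gt0.
pose ch h := sp h \in S.
have [ic cz zy yr cdz] := row_bounds.
have ch_ok h : h < item_count -> ch h -> item_ok h.
  by move=> hi; apply: center_item_ok => //; lia.
have item_ltn sigma g : sigma < class_count -> g < choice_count ->
    sigma * choice_count + g < item_count.
  move=> sc gc; have : sigma.+1 * choice_count <= item_count by rewrite leq_mul2r sc orbT.
  by rewrite mulSn; apply: leq_trans; rewrite addnC ltn_add2r.
(* A diagonal dimension [(o, o)] with [o] in class [sigma] receives leaves only from items of this
   class, and it needs at least one. *)
have ch_class sigma : sigma < class_count ->
    has (fun g => ch (sigma * choice_count + g)) (iota 0 choice_count).
  move=> sc; apply/negPn/negP => /hasPn no_ch.
  pose o := sigma * Q.
  have oo : o < occ_count by rewrite /o /occ_count ltn_pmul2r.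
  have jd : o * occ_count + o < dim_count.
    have : o.+1 * occ_count <= dim_count by rewrite leq_mul2r oo orbT.
    by rewrite mulSn; apply: leq_trans; rewrite addnC ltn_add2r.
  have := chosen_target aS Sb jd; rewrite leqNgt; case/negP.
  rewrite /leaf_degree big1 // => h _; apply: big1 => t _; apply/eqP.
  rewrite muln_eq0 !eqb0 -implybE; apply/implyP => chh.
  have hg : h %% choice_count < choice_count by rewrite ltn_mod.
  have hs : h %/ choice_count != sigma.
    apply/eqP => hs; have := no_ch (h %% choice_count).
    by rewrite mem_iota hg => /(_ isT); rewrite -hs -/(ch _) -divn_eq /ch chh.
  have i_Q : t %/ target %/ occ_count < Q.
    by rewrite ltn_divLR // ltn_divLR //; apply: ltn_ord.
  have p_occ : t %/ target %% occ_count < occ_count by rewrite ltn_mod.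
  rewrite /leaf_dim; set O := _ * Q + _.
  have O_occ : O < occ_count.
    have hc : h %/ choice_count < class_count by rewrite ltn_divLR //; apply: ltn_ord.
    have : (h %/ choice_count).+1 * Q <= class_count * Q by rewrite leq_mul2r hc orbT.
    by rewrite mulSn; apply: leq_trans; rewrite /O addnC ltn_add2r.
  have Oo : O != o.
    rewrite /O /o -[sigma * Q]addn0 pair_eq //.
    by rewrite (negPf hs).
  by case: ifP => _; rewrite pair_eq // negb_and Oo ?orbT.
(* Every class has a chosen item, and at most [class_count] items are chosen. *)
have ch_one sigma : sigma < class_count ->
    \sum_(g < choice_count) ch (sigma * choice_count + g) = 1.
  apply: (leq_sum_one (F := fun sigma => \sum_(g < choice_count) ch (sigma * choice_count + g))).
    move=> s /ch_class; rewrite has_count => /leq_trans; apply.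
    by rewrite -sum_count_iota.
  have := chosen_count aS Sb; rewrite -/(class_count) => /(leq_trans _); apply.
  by rewrite (sum_ord_mul (fun h => ch h : nat)).
pose gamma sigma := find (fun g => ch (sigma * choice_count + g)) (iota 0 choice_count).
have gc sigma : sigma < class_count -> gamma sigma < choice_count.
  by move/ch_class; rewrite has_find size_iota.
have ch_gamma sigma : sigma < class_count -> ch (sigma * choice_count + gamma sigma).
  by move=> sc; have := nth_find 0 (ch_class _ sc); rewrite nth_iota ?gc.
have chE h : h < item_count -> ch h = (h %% choice_count == gamma (h %/ choice_count)).
  move=> hi; have hc : h %/ choice_count < class_count by rewrite ltn_divLR.
  have hg : h %% choice_count < choice_count by rewrite ltn_mod.
  apply/idP/eqP => [chh|hg']; last by rewrite (divn_eq h choice_count) hg' ch_gamma.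
  apply/eqP/negPn/negP => ne; have := ch_one _ hc.
  rewrite (bigD1 (Ordinal (gc _ hc))) //= ch_gamma //.
  rewrite (bigD1 (Ordinal hg)) /=; last by rewrite -(inj_eq val_inj).
  by rewrite -divn_eq chh.
pose c o := dig N (gamma (o %/ Q)) (o %% Q).
have c_target o : c o <= target by rewrite /target -ltnS prednK ?dig_ltn; lia.
(* Dimension [(o, o')] receives [c o + (target - c o')] leaves. Exchanging [o] and [o'] will give
   equality. *)
have c_le o o' : o < occ_count -> o' < occ_count -> occ_block o = occ_block o' -> c o' <= c o.
  move=> oo oo' blk.
  have jd : o * occ_count + o' < dim_count.
    have : o.+1 * occ_count <= dim_count by rewrite leq_mul2r oo orbT.
    by rewrite mulSn; apply: leq_trans; rewrite addnC ltn_add2r.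
  have := chosen_target aS Sb jd.
  rewrite (eq_leaf_degree (f' := fun h _ => h %% choice_count == gamma (h %/ choice_count))).
    by rewrite chosen_leaf_degree // blk eqxx -/(c o) -/(c o'); have := c_target o'; lia.
  by move=> h t hi _; rewrite -chE.
have m_class : m <= class_count.
  by rewrite /class_count -{1}[m]expn1 leq_pexp2l.
(* Class [b] encodes the tuple [(b, 0, ..., 0)], so occurrence [b * Q] shows block [b]; consistency
   makes any other occurrence agree with it. *)
exists (fun b => c (b * Q)) => sigma sc; exists (gamma sigma); split; first exact: gc.
  move=> q qQ.
  have -> : dig N (gamma sigma) q = c (sigma * Q + q).
    by rewrite /c divnMDl // divn_small // addn0 modnMDl modn_small.
  have o1 : sigma * Q + q < occ_count.
    have : sigma.+1 * Q <= occ_count by rewrite leq_mul2r sc orbT.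
    by rewrite mulSn; apply: leq_trans; rewrite addnC ltn_add2r.
  have bm : dig m sigma q < m by rewrite dig_ltn.
  have o2 : dig m sigma q * Q < occ_count.
    by rewrite /occ_count ltn_pmul2r //; apply: leq_trans m_class.
  have blk : occ_block (sigma * Q + q) = occ_block (dig m sigma q * Q).
    rewrite /occ_block divnMDl // divn_small // addn0 modnMDl modn_small //.
    by rewrite mulnK // modnMl {2}/dig /= modn_small.
  by apply/eqP; rewrite eqn_leq !c_le.
have /andP[_] := ch_ok _ (item_ltn _ _ sc (gc _ sc)) (ch_gamma _ sc).
by rewrite item_div ?item_mod ?gc.
Qed.

(** * The star forest outside the core *)

Definition core : {set 'I_vertex_count} :=
  [set u : 'I_vertex_count | special u && (center_count <= vertex_row u)].

Definition star_center (u : 'I_vertex_count) : 'I_vertex_count :=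
  if (vertex_tag u == 0) && (vertex_row u < center_count) ||
     [&& vertex_tag u == 1, vertex_row u < item_count & vertex_col u < leaf_count]
  then sp (vertex_row u) else u.

Lemma card_core : #|core| <= dim_count.+2.
Proof.
rewrite -[X in _ <= X]card_ord -cardsT.
apply: leq_trans (leq_imset_card (fun i : 'I_dim_count.+2 => sp (center_count + i)) _).
apply: subset_leq_card; apply/subsetP => u; rewrite inE => /andP[su cu].
have [ic cz zy yr cdz] := row_bounds; have ru := vertex_row_ltn u.
have lt : vertex_row u - center_count < dim_count.+2 by move: ru; rewrite /row_count /y_row; lia.
apply/imsetP; exists (Ordinal lt) => //=.
by rewrite subnKC // -specialE.
Qed.

Lemma star_center_idem u : star_center (star_center u) = star_center u.
Proof.
rewrite {2 3}/star_center; case: ifP => [_|E]; last by rewrite /star_center E.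
by rewrite /star_center vx_tag ?vertex_row_ltn.
Qed.

Lemma star_center_out u : u \notin core -> star_center u \notin core.
Proof.
rewrite /star_center; case: ifP => // E _; have ru := vertex_row_ltn u.
have [ic cz zy yr cdz] := row_bounds.
rewrite inE special_sp // sp_row //= -ltnNge.
by case/orP: E => [/andP[]|/and3P[_ h _]] //; apply: leq_trans ic.
Qed.

(** Outside the core only centers serve as hubs, and only their pendant vertices and leaves are
    attached to them. *)
Lemma hub_star_center (u v : 'I_vertex_count) : v \notin core -> up_edge u v -> star_center u = v.
Proof.
have [ic cz zy yr cdz] := row_bounds; have ru := vertex_row_ltn u.
rewrite inE negb_and => vc /andP[sv huv]; move: vc; rewrite sv /= -ltnNge => vc.
rewrite [v in RHS]specialE //; move: huv; rewrite /hub /hub_at /star_center.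
move: (vertex_row v) vc => k kc; have tu := vertex_tag_ltn u.
case: (vertex_tag u) tu => [|[|[|[|[|//]]]]] _ /=.
- by case: ifP => [_ /eqP->//|_ /eqP]; lia.
- case: ifP => [_|_ /eqP]; last lia.
  by case/orP => /eqP; [move=> -> | lia].
- by case: ifP => _; [case/orP => /eqP; lia | move/eqP; lia].
- by case: ifP => _; [case/orP => /eqP; lia | move/eqP; lia].
case: ifP => _; first by move/eqP; lia.
case: ifP => _; first by case/andP => _ /eqP; lia.
by case/andP => _ /orP[] /eqP; lia.
Qed.

Lemma edge_star_center u v : u \notin core -> v \notin core -> gadget_edge u v ->
  star_center u = v \/ star_center v = u.
Proof.
by move=> uc vc /orP[] h; [left | right]; apply: hub_star_center.
Qed.
End Gadget.

(** * Computing the graph *)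

Section WordGadget.
Variable d : nat.

Definition word_leaf_dim x h t :=
  leaf_dim (block_count d x) (view_width d) (value_count x) h t.
Definition word_hub x u k :=
  hub (block_count d x) (view_width d) (value_count x) (allowed_word d x) u k.
Definition word_edge x u v :=
  gadget_edge (block_count d x) (view_width d) (value_count x) (allowed_word d x) u v.
Definition word_budget x := budget (block_count d x) (view_width d) (value_count x).
Definition word_order x := vertex_count (block_count d x) (view_width d) (value_count x).
Definition word_dims x := dim_count (block_count d x) (view_width d).

(** Convertible to the definition, but spelled out as arithmetic on [u] and [k], which the tactic
    recognizes. *)
Lemma word_hubE x u k : word_hub x u k =
  let m := block_count d x in let Q := view_width d in let N := value_count x in
  let g := u %/ (row_count m Q N * col_count m Q N) in
  let h := u %/ col_count m Q N %% row_count m Q N in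
  let t := u %% col_count m Q N in
  if g == 0 then if h < center_count m Q N then k == h else k == y_row m Q N
  else if g == 1 then
    if (h < item_count m Q N) && (t < leaf_count m Q N)
    then (k == h) || (k == center_count m Q N + word_leaf_dim x h t) else k == y_row m Q N
  else if g == 2 then
    if (h < item_count m Q N) && (t < leaf_count m Q N)
    then (k == y_row m Q N) || (k == center_count m Q N + word_leaf_dim x h t)
    else k == y_row m Q N
  else if g == 3 then
    if (h < dim_count m Q) && (t < (2 * target N).-1)
    then (k == z_row m Q N) || (k == center_count m Q N + h) else k == y_row m Q N
  else if t != 0 then k == y_row m Q N
  else if h < center_count m Q N then
    ~~ ((h < item_count m Q N) &&
        allowed_word d x (h %/ choice_count Q N) (h %% choice_count Q N)) && (k == z_row m Q N)
  else (h < z_row m Q N) && ((k == z_row m Q N) || (k == y_row m Q N)).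
Proof. by []. Qed.

Lemma word_edgeE x u v : word_edge x u v =
  let m := block_count d x in let Q := view_width d in let N := value_count x in
  let R := row_count m Q N in let P := col_count m Q N in
  (v %/ (R * P) == 4) && (v %% P == 0) && word_hub x u (v %/ P %% R) ||
  (u %/ (R * P) == 4) && (u %% P == 0) && word_hub x v (u %/ P %% R).
Proof. by []. Qed.

Ltac pc_gadget := rewrite /vertex_count /row_count /y_row /z_row /center_count /col_count
    /budget /leaf_count /dim_count /occ_count /item_count /choice_count /class_count /target;
  repeat lazymatch goal with
  | |- prog _ (block_count _) => exact: (pc_block_count d word_context)
  | |- prog _ value_count => exact: (pc_value_count word_context)
  | |- prog _ (fun t => block_count _ _) => apply: pc_block_count
  | |- prog _ (fun t => value_count _) => apply: pc_value_count
  | |- prog _ (fun t => dig (@?a t) (@?b t) (@?c t)) => apply: pc_dig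
  | |- prog _ (fun t => nat_of_bool (allowed_word _ _ (@?b t) (@?c t))) =>
      apply: (pc_bool_app2 (@pc_allowed d))
  | H : prog _ (fun t => nat_of_bool (?F _ _ _)) |-
    prog _ (fun t => nat_of_bool (?F _ (@?b t) (@?c t))) => apply: (pc_bool_app2 H)
  | H : prog _ (fun t => ?F _ _ _) |-
    prog _ (fun t => ?F _ (@?b t) (@?c t)) => apply: (pc_app2 H)
  | _ => pc_step
  end.

Lemma pc_word_budget : pc word_budget.
Proof. by rewrite /word_budget; pc_gadget. Qed.

Lemma pc_word_order : pc word_order.
Proof. by rewrite /word_order; pc_gadget. Qed.

Lemma pc_word_leaf_dim : pc (fun t : bitseq * nat * nat => word_leaf_dim t.1.1 t.1.2 t.2).
Proof. by rewrite /word_leaf_dim /leaf_dim /occ_value /occ_block /=; pc_gadget. Qed.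

Lemma pc_word_hub : pc (fun t : bitseq * nat * nat => word_hub t.1.1 t.1.2 t.2).
Proof.
apply: pc_ext (fun t => congr1 nat_of_bool (esym (word_hubE _ _ _))).
by have pl := pc_word_leaf_dim; cbv zeta; pc_gadget.
Qed.

Lemma pc_word_edge : pc (fun t : bitseq * nat * nat => word_edge t.1.1 t.1.2 t.2).
Proof.
apply: pc_ext (fun t => congr1 nat_of_bool (esym (word_edgeE _ _ _))).
by have ph := pc_word_hub; cbv zeta; pc_gadget.
Qed.

Definition word_output x : bitseq :=
  enc_nat (word_budget x) ++ enc_nat (word_order x) ++
  flatten [seq flatten [seq enc_nat (word_edge x u v) | v <- iota 0 (word_order x)]
          | u <- iota 0 (word_order x)].

Lemma prog_word_output : prog word_output (fun=> 0).
Proof.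
apply: prog_cat (prog_nat pc_word_budget) _; apply: prog_cat (prog_nat pc_word_order) _.
apply: (prog_flatten (G := fun t => flatten [seq enc_nat (word_edge t.1 t.2 v)
  | v <- iota 0 (word_order t.1)])) pc_word_order _.
apply: (prog_flatten (G := fun t => enc_nat (word_edge t.1.1 t.1.2 t.2))
  (n := fun t => word_order t.1)) (prog_nat pc_word_edge).
exact: prog_weak pc_word_order.
Qed.

End WordGadget.

(** * Width parameters of graphs with a small core *)

Lemma least_leq (P : nat -> Prop) n : P n -> least P <= n.
Proof.
move=> Pn; rewrite /least; case: pselect => [exP|[]]; last by exists n; apply/asboolP.
by case: ex_minnP => k _; apply; apply/asboolP.
Qed.

(** The property of cycles on which both acyclicity proofs below rest. *)
Lemma cycle_two_nbrs (V : eqType) (e : rel V) c x : ucycle e c -> 2 < size c -> x \in c ->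
  exists y z, [/\ y != z, y \in c, z \in c, e x y & e z x].
Proof.
move=> /andP[ec uc] c3 xc; have [i s rs] := rot_to xc.
have mem_s v : v \in s -> v \in c by move=> vs; rewrite -(mem_rot i) rs inE vs orbT.
move: ec uc c3; rewrite -(rot_cycle i) -(rot_uniq i) -(size_rot i) rs.
case: s {rs} mem_s => [|y s] mem_s //=; rewrite rcons_path => /andP[exy /andP[_ ezx]].
move=> /and3P[_ ys _] s2; exists y, (last y s).
have zs : last y s \in s by case: s s2 {mem_s exy ezx ys} => //= z s _; apply: mem_last.
split=> //; first by apply: contraNneq ys => ->.
  by rewrite mem_s ?mem_head.
by rewrite mem_s // inE zs orbT.
Qed.

Lemma path_rel_sym m : symmetric (@path_rel m).
Proof. by move=> i j; rewrite /path_rel /= orbC. Qed.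

Lemma path_interval_connected m (A : {set 'I_m}) :
  (forall i j k : 'I_m, i \in A -> j \in A -> i <= k <= j -> k \in A) ->
  connected_on (@path_rel m) A.
Proof.
move=> intA; pose r := [rel a b | [&& a \in A, b \in A & @path_rel m a b]].
have r_sym : symmetric r by move=> a b; rewrite /= andbCA path_rel_sym.
suff up_conn n (u v : 'I_m) : u \in A -> v \in A -> u + n = v -> connect r u v.
  move=> u v uA vA; rewrite -/r; case: (leqP u v) => uv; first by
    apply: (up_conn (v - u)) => //; lia.
  by rewrite (sym_connect_sym r_sym); apply: (up_conn (u - v)) => //; lia.
elim: n u => [|n IH] u uA vA uv; first by rewrite (_ : u = v) //; apply: val_inj => /=; lia.
have u1 : u.+1 < m by have := ltn_ord v; lia.
have u1A : Ordinal u1 \in A by apply: (intA u v) => //=; lia.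
apply: connect_trans (IH (Ordinal u1) u1A vA _); last by rewrite /=; lia.
by apply: connect1; rewrite /= uA u1A /path_rel /= eqxx.
Qed.

Lemma path_is_tree m : 0 < m -> is_tree (@path_rel m).
Proof.
move=> m0; split.
- by rewrite card_ord.
- exact: path_rel_sym.
- by move=> i; rewrite /path_rel /=; lia.
- by apply: path_interval_connected => i j k *; rewrite inE.
move=> c _ uc; rewrite ltnNge; apply/negP => c3.
have [x0 x0c] : exists x0, x0 \in c by case: c uc c3 => // x0 c _ _; exists x0; apply: mem_head.
(* Both neighbours of the largest vertex [x] of the cycle would equal [x - 1]. *)
have [x xc xmax] := @arg_maxnP _ x0 (mem c) (@nat_of_ord m) x0c.
have [y [z [yz yc zc]]] := cycle_two_nbrs uc c3 xc; rewrite /path_rel /= => xy zx.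
have yx : y <= x := xmax _ yc; have zx' : z <= x := xmax _ zc.
by move/eqP: yz; case; apply: val_inj => /=; move: xy zx yx zx'; clear; lia.
Qed.

(* Outside [X] the graph is a disjoint union of stars; [p] maps each vertex to
   the centre of its star. *)
Section StarForest.
Variables (G : sgraph) (X : {set 'I_(num_vertices G)}).
Variable p : 'I_(num_vertices G) -> 'I_(num_vertices G).
Let n := num_vertices G.
Hypothesis n_gt0 : 0 < n.
Hypothesis p_idem : forall u, p (p u) = p u.
Hypothesis p_out : forall u, u \notin X -> p u \notin X.
Hypothesis p_edge : forall u v, u \notin X -> v \notin X -> edge u v -> p u = v \/ p v = u.

Let edge_sym : symmetric (@edge G).
Proof. by move=> u v; apply: (eqP (forallP (forallP (adj_sym G) u) v)). Qed.

Let edge_irr : irreflexive (@edge G).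
Proof. by move=> u; apply/negbTE; apply: (forallP (adj_irr G) u). Qed.

Lemma fvs_number_star : fvs_number G <= #|X|.
Proof.
apply: least_leq; exists X => // c cX uc; rewrite ltnNge; apply/negP => c3.
have out v : v \in c -> v \notin X by move/cX; rewrite inE.
(* A vertex that is not its own center has its center as its only neighbour outside [X], so it lies
   on no cycle. *)
suff [x xc px] : exists2 x, x \in c & p x != x.
  have [y [z [yz yc zc xy zx]]] := cycle_two_nbrs uc c3 xc.
  have only v : v \in c -> edge x v -> v = p x.
    move=> vc /(p_edge (out _ xc) (out _ vc)) [//|pv].
    by move: px; rewrite -pv p_idem eqxx.
  by move/eqP: yz; apply; rewrite (only y) // (only z) // edge_sym.
(* A cycle through a center also passes through a neighbour of it, which is not a center. *)
have [x xc] : exists x, x \in c by case: c {cX uc out} c3 => // x c _; exists x; apply: mem_head.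
case: (eqVneq (p x) x) => px; last by exists x.
have [y [_ [_ yc _ xy _]]] := cycle_two_nbrs uc c3 xc.
exists y => //; case: (p_edge (out _ xc) (out _ yc) xy) => [pxy|->].
  by move: xy; rewrite -pxy px edge_irr.
by apply/eqP => yx; move: xy; rewrite yx edge_irr.
Qed.

(* One bag for each pair of a centre [i %/ n] and a vertex [i %% n]. *)
Definition star_bag (i : 'I_(n * n)) : {set 'I_n} :=
  [set v | [|| v \in X, (p v == v) && (v == i %/ n :> nat)
             | (v == i %% n :> nat) && (p v == i %/ n :> nat)]].

Lemma star_decomposition : decomposition (@edge G) (@path_rel (n * n)) star_bag.
Proof.
have code_ltn (a b : 'I_n) : a * n + b < n * n.
  have : a.+1 * n <= n * n by rewrite leq_mul2r ltn_ord orbT.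
  by rewrite mulSn; apply: leq_trans; rewrite addnC ltn_add2r.
pose code a b := Ordinal (code_ltn a b).
have div_code a b : code a b %/ n = a by rewrite /= divnMDl // divn_small ?addn0.
have mod_code a b : code a b %% n = b by rewrite /= modnMDl modn_small.
have own v : v \in star_bag (code (p v) v).
  by rewrite inE div_code mod_code !eqxx !orbT.
split=> [v|u v uv|v].
- by exists (code (p v) v).
- have [uX|uX] := boolP (u \in X); first by exists (code (p v) v); rewrite own andbT inE uX.
  have [vX|vX] := boolP (v \in X); first by exists (code (p u) u); rewrite own inE vX.
  have center w w' : p w = w' -> w' \in star_bag (code (p w) w).
    by move=> pw; rewrite inE div_code -pw p_idem !eqxx orbT.
  have [pu|pv] := p_edge uX vX uv.
    by exists (code (p u) u); rewrite own center.
  by exists (code (p v) v); rewrite own center.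
(* A vertex of [X] is in all bags, a center outside [X] in those whose index has it as quotient, and
   any other vertex in a single bag. *)
apply: path_interval_connected => i j k; rewrite !inE.
case: (v \in X) => //=; case: eqP => [->|_] /=.
  move=> vi vj /andP[ik kj].
  have {}vi : v = i %/ n :> nat by case/orP: vi => [/eqP//|/andP[_ /eqP]].
  have {}vj : v = j %/ n :> nat by case/orP: vj => [/eqP//|/andP[_ /eqP]].
  apply/orP; left; rewrite eqn_leq; apply/andP; split.
    by rewrite vi leq_div2r.
  by rewrite vj leq_div2r.
move=> /andP[/eqP vi /eqP pi] /andP[/eqP vj /eqP pj] ikj.
have ij : i = j :> nat by rewrite (divn_eq i n) (divn_eq j n) -vi -vj -pi -pj.
by have -> : k = i by [apply: val_inj => /=; lia]; rewrite -vi -pi !eqxx.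
Qed.

Lemma star_width : width_le star_bag #|X|.+1.
Proof.
move=> i; have n0 := n_gt0.
have a_ltn : i %/ n < n by rewrite ltn_divLR.
have b_ltn : i %% n < n by rewrite ltn_mod.
apply: (@leq_trans #|X :|: [set Ordinal a_ltn; Ordinal b_ltn]|).
  apply: subset_leq_card; apply/subsetP => v; rewrite !inE -!(inj_eq val_inj) /=.
  by case/or3P => [->|/andP[_ ->]|/andP[-> _]]; rewrite ?orbT.
by apply: leq_trans (leq_card_setU _ _) _; rewrite -addn2 leq_add2l cards2; case: (_ != _).
Qed.

Lemma pathwidth_star : pathwidth G <= #|X|.+1.
Proof.
apply: least_leq; exists (n * n), star_bag.
by split; [exact: star_decomposition | exact: star_width].
Qed.

Lemma treewidth_star : treewidth G <= #|X|.+1.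
Proof.
apply: least_leq; exists (n * n), (@path_rel (n * n)), star_bag.
split; [| exact: star_decomposition | exact: star_width].
by apply: path_is_tree; rewrite muln_gt0 n_gt0.
Qed.

Let xs := enum X.
(** The level in a forest that strings [X] on a path in enumeration order, hangs the centers below
    its end, and the other vertices below their centers. A member of [X] of rank [r] has index
    [r - 1], whence the index [(star_rank v).-2] of a parent; if [X] is empty, the centers have rank
    1 and are roots. *)
Definition star_rank (v : 'I_n) : nat :=
  if v \in X then (index v xs).+1 else if p v == v then #|X|.+1 else #|X|.+2.

Definition star_parent (v : 'I_n) : option 'I_n :=
  if star_rank v == 1 then None
  else if (v \in X) || (p v == v) then Some (nth v xs (star_rank v).-2) else Some (p v).

Lemma star_parent_rank v : 1 < star_rank v ->
  exists2 w, star_parent v = Some w & (star_rank w).+1 = star_rank v.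
Proof.
move=> rv; rewrite /star_parent gtn_eqF //.
have sz : size xs = #|X| by rewrite cardE.
case: ifP => vc.
  exists (nth v xs (star_rank v).-2) => //.
  have lt : (star_rank v).-2 < size xs.
    rewrite sz; move: rv vc; rewrite /star_rank; case: ifP => [vX _ _|_ rv /= pv].
      have : index v xs < size xs by rewrite index_mem mem_enum.
      by rewrite sz; lia.
    by move: rv; rewrite pv; case: #|X| => //=.
  have inX : nth v xs (star_rank v).-2 \in X by rewrite -mem_enum mem_nth.
  by rewrite {1}/star_rank inX index_uniq ?enum_uniq //; lia.
move/negbT: vc; rewrite negb_or => /andP[vX pv]; exists (p v) => //.
by rewrite /star_rank (negPf vX) (negPf pv) (negPf (p_out vX)) p_idem eqxx.
Qed.

Lemma star_rank_gt0 v : 0 < star_rank v.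
Proof. by rewrite /star_rank; do 2?case: ifP. Qed.

Lemma upS (I : Type) (par : I -> option I) k x y : par x = Some y -> up par k.+1 x = up par k y.
Proof. by move=> xy; rewrite /up iterSr /= xy. Qed.

Lemma up_None (I : Type) (par : I -> option I) k x : par x = None -> up par k.+1 x = None.
Proof. by move=> xN; rewrite /up iterSr /= xN; elim: k => //= k ->. Qed.

Lemma star_height : forest_height_le star_parent #|X|.+2.
Proof.
move=> v; have : star_rank v <= #|X|.+2.
  rewrite /star_rank; case: ifP => [vX|_]; last by case: ifP; lia.
  have : index v xs < size xs by rewrite index_mem mem_enum.
  by rewrite -cardE; lia.
move: (#|X|.+2) => k; elim: k v => [|k IH] v rv; first by have := star_rank_gt0 v; lia.
case: (ltnP 1 (star_rank v)) => rv1.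
  have [w pw rw] := star_parent_rank rv1.
  by rewrite (upS _ pw); apply: IH; lia.
by apply: up_None; rewrite /star_parent eqn_leq rv1 star_rank_gt0.
Qed.

(** Each rank up to [#|X|] that occurs in [X] belongs to one vertex only, so climbing from [v] meets
    [x]. *)
Lemma star_ancestor v x : x \in X -> star_rank x < star_rank v -> ancestor star_parent v x.
Proof.
move=> xX; move: {2}(star_rank v) (leqnn (star_rank v)) => k; elim: k v => [|k IH] v; first lia.
move=> vk xv; have x0 := star_rank_gt0 x.
have [|w pw rw] := @star_parent_rank v; first lia.
case: (ltnP (star_rank x) (star_rank w)) => xw.
  have [|i i0 ui] := IH w _ xw; first lia.
  by exists i.+1; rewrite // (upS _ pw).
exists 1 => //; rewrite (upS _ pw); congr Some.
have {xw} : star_rank w = star_rank x by lia.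
have ix : index x xs < size xs by rewrite index_mem mem_enum.
rewrite /star_rank xX; case: ifP => [wX [iw]|_].
  by rewrite -(nth_index x (_ : w \in xs)) ?mem_enum // iw nth_index // mem_enum.
by move: ix; rewrite -cardE => + E; case: ifP E => _ [<-]; rewrite ?ltnn // ltnNge leqnSn.
Qed.

Lemma treedepth_star : treedepth G <= #|X|.+2.
Proof.
apply: least_leq; exists n, star_parent, id; split; [exact: star_height | by [] |].
have rank_out v : v \notin X -> #|X| < star_rank v.
  by move=> vX; rewrite /star_rank (negPf vX); case: ifP.
have rank_in v : v \in X -> star_rank v <= #|X|.
  move=> vX; rewrite /star_rank vX cardE index_mem mem_enum //.
move=> u v uv; have [uX|uX] := boolP (u \in X); have [vX|vX] := boolP (v \in X).
- case: (ltngtP (star_rank u) (star_rank v)) => uv_rank.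
  + by right; apply: star_ancestor.
  + by left; apply: star_ancestor.
  have uv' : u = v.
    move: uv_rank; rewrite /star_rank uX vX => -[iuv].
    by rewrite -(nth_index u (_ : u \in xs)) ?mem_enum // iuv nth_index // mem_enum.
  by move: uv; rewrite uv' edge_irr.
- by right; apply: star_ancestor => //; apply: leq_ltn_trans (rank_in _ uX) (rank_out _ vX).
- by left; apply: star_ancestor => //; apply: leq_ltn_trans (rank_in _ vX) (rank_out _ uX).
have center w w' : w \notin X -> w != w' -> p w = w' -> ancestor star_parent w w'.
  move=> wX ww' pw; exists 1 => //; rewrite /up /= /star_parent {1}/star_rank (negPf wX).
  by have -> : (p w == w) = false; rewrite pw // eq_sym (negPf ww').
have uv' : u != v by apply: contraTneq uv => ->; rewrite edge_irr.
case: (p_edge uX vX uv) => [pu|pv]; first by left; apply: center.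
by right; apply: center; rewrite // eq_sym.
Qed.

End StarForest.

(** * The reduction *)

Lemma enc_nats_flatten ss : enc_nats (flatten ss) = flatten (map enc_nats ss).
Proof.
elim: ss => //= s ss IH; rewrite -IH.
by rewrite /enc_nats map_cat flatten_cat.
Qed.

Section Reduction.
Variable d : nat.

Lemma word_edge_sym x u v : word_edge d x u v = word_edge d x v u.
Proof. exact: orbC. Qed.

Definition word_matrix x : 'M[bool]_(word_order d x) := \matrix_(u, v) word_edge d x u v.

Lemma word_matrix_sym x : [forall u, forall v, word_matrix x u v == word_matrix x v u].
Proof. by apply/forallP => u; apply/forallP => v; rewrite !mxE word_edge_sym. Qed.

Lemma word_matrix_irr x : [forall u, ~~ word_matrix x u u].
Proof. by apply/forallP => u; rewrite mxE /word_edge edge_irr. Qed.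

Definition word_graph x : sgraph := SGraph (word_matrix_sym x) (word_matrix_irr x).

Lemma word_graph_edge x : @edge (word_graph x) = (fun u v => word_edge d x u v).
Proof. by apply/funext => u; apply/funext => v; rewrite /edge mxE. Qed.

Lemma word_budget_gt0 x : 0 < word_budget d x.
Proof. by []. Qed.

Definition reduce (x : wcs_instance 1 d) : alliance_instance :=
  @AllianceInstance (word_graph (wcs_encode x)) _ (word_budget_gt0 (wcs_encode x)).

Lemma reduce_encode x : word_output d (wcs_encode x) = al_encode (reduce x).
Proof.
set w := wcs_encode x.
have adjE : enc_nats (adj_code (word_graph w)) =
    flatten [seq flatten [seq enc_nat (word_edge d w u v) | v <- iota 0 (word_order d w)]
            | u <- iota 0 (word_order d w)].
  rewrite /adj_code enc_nats_flatten word_graph_edge -map_comp -val_enum_ord -map_comp.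
  congr flatten; apply/eq_map => u /=.
  by rewrite /enc_nats -map_comp -map_comp.
by rewrite /word_output -adjE.
Qed.

Let view_width_gt0 : 0 < view_width d. Proof. by rewrite /view_width; lia. Qed.
Let block_count_gt0 x : 0 < block_count d x. Proof. by rewrite /block_count; lia. Qed.
Let value_count_gt1 x : 1 < value_count x. Proof. by rewrite /value_count; lia. Qed.

Lemma reduce_csp (x : wcs_instance 1 d) : wcs_yes x <-> exists V,
  gadget_csp (block_count d (wcs_encode x)) (view_width d) (value_count (wcs_encode x))
    (allowed_word d (wcs_encode x)) V.
Proof.
case: x => C k wfC weftC depthC /=.
set w := wcs_encode _; have wE : w = enc_nats (k :: flatten (map gate_code C)) by [].
have spec v : v < size C ->
    gate_spec (nth Input C v) (gate_type w v) (gate_arity w v) (gate_arg w v).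
  exact: gate_spec_parse.
have nE : gate_count w = size C by rewrite wE gate_countE.
have kE : token w 0 = k by rewrite wE token_weight.
rewrite /block_count /value_count nE kE.
have cspE V : circuit_csp C (gate_type w) (gate_arity w) (gate_arg w) k d V <->
    gadget_csp (k + 2 + strat_len d.+1) (view_width d) (size C + 2) (allowed_word d w) V.
  by rewrite /gadget_csp /allowed_word /view_block /view_value /block_count /value_count nE kE.
split=> [yx|[V /cspE HV]].
  by have [V /cspE HV] := csp_complete wfC spec depthC weftC yx; exists V.
by apply: (csp_sound wfC spec depthC weftC); exists V.
Qed.

Lemma reduce_complete (x : wcs_instance 1 d) : wcs_yes x ->
  exists S : {set 'I_(num_vertices (al_graph (reduce x)))},
    offensive_alliance (@edge (al_graph (reduce x))) S /\ #|S| = al_size (reduce x).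
Proof. by move/reduce_csp => HV; rewrite word_graph_edge; apply: gadget_complete. Qed.

Lemma reduce_sound (x : wcs_instance 1 d) :
  (exists S : {set 'I_(num_vertices (al_graph (reduce x)))},
    offensive_alliance (@edge (al_graph (reduce x))) S /\ #|S| <= al_size (reduce x)) ->
  wcs_yes x.
Proof. by rewrite word_graph_edge => HS; apply/reduce_csp; apply: gadget_sound. Qed.

Lemma reduce_oa (kappa : sgraph -> nat) (x : instance (WCS 1 d)) :
  yes x <-> @yes (OffensiveAlliance kappa) (reduce x).
Proof.
split=> [/reduce_complete [S [aS cS]]|[S [aS /andP[_ cS]]]].
  by exists S; rewrite cS leqnn al_size_gt0.
by apply: reduce_sound; exists S.
Qed.

Lemma reduce_exact (kappa : sgraph -> nat) (x : instance (WCS 1 d)) :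
  yes x <-> @yes (ExactOffensiveAlliance kappa) (reduce x).
Proof.
split=> [/reduce_complete//|[S [aS cS]]].
by apply: reduce_sound; exists S; rewrite cS.
Qed.

Lemma param_bounds x : [/\ fvs_number (word_graph x) <= word_dims d x + 4,
  treewidth (word_graph x) <= word_dims d x + 4,
  pathwidth (word_graph x) <= word_dims d x + 4 &
  treedepth (word_graph x) <= word_dims d x + 4].
Proof.
pose X : {set 'I_(num_vertices (word_graph x))} :=
  @core (block_count d x) (view_width d) (value_count x).
pose p : 'I_(num_vertices (word_graph x)) -> 'I_(num_vertices (word_graph x)) :=
  @star_center (block_count d x) (view_width d) (value_count x).
have c2 : #|X|.+2 <= word_dims d x + 4 by rewrite addn4 !ltnS; apply: card_core.
have c1 := ltnW c2; have c0 := ltnW c1.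
have n0 : 0 < num_vertices (word_graph x) by [].
have p_idem u : p (p u) = p u := star_center_idem u.
have p_out u : u \notin X -> p u \notin X := @star_center_out _ _ _ u.
have p_edge u v : u \notin X -> v \notin X -> edge u v -> p u = v \/ p v = u.
  by rewrite word_graph_edge; apply: edge_star_center.
split.
- exact: leq_trans (fvs_number_star p_idem p_edge) c0.
- exact: leq_trans (treewidth_star n0 p_idem p_edge) c1.
- exact: leq_trans (pathwidth_star n0 p_idem p_edge) c1.
- exact: leq_trans (treedepth_star n0 p_idem p_out p_edge) c2.
Qed.

(** A function of the unary code of the weight, as [pc_computable] expects; [(size w).-1] recovers
    the weight. The summand 4 covers [z], [y] and the two additional levels in the treedepth
    bound. *)
Definition dims_bound (w : bitseq) : nat :=
  let b := (size w).-1 + 2 + strat_len d.+1 in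
  b ^ view_width d * view_width d * (b ^ view_width d * view_width d) + 4.

Lemma pc_dims_bound : pc dims_bound.
Proof.
rewrite /dims_bound; cbv zeta.
by repeat first [exact: (pc_size word_context) | pc_step].
Qed.

Lemma dims_bound_mono : {homo (dims_bound \o enc_nat) : i j / i <= j}.
Proof.
move=> i j ij; rewrite /dims_bound /= !size_enc_nat leq_add2r.
by rewrite leq_mul // leq_mul // leq_expl // !leq_add2r.
Qed.

Lemma dims_boundE (x : wcs_instance 1 d) :
  word_dims d (wcs_encode x) + 4 = dims_bound (enc_nat (wcs_weight x)).
Proof.
rewrite /dims_bound size_enc_nat /word_dims /dim_count /occ_count /class_count /block_count.
by rewrite /wcs_encode /wcs_code token_weight.
Qed.

End Reduction.

(** Membership in W[1] supplies a depth [d] that depends on the problem, hence a reduction is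
    required for every [d]. *)
Lemma W_hard_reduce (Q : param_problem) (R : forall d, instance (WCS 1 d) -> instance Q) :
  (forall d x, yes x <-> yes (R d x)) ->
  (forall d x, word_output d (wcs_encode x) = encode (R d x)) ->
  (forall d x, param (R d x) <= word_dims d (wcs_encode x) + 4) ->
  W_hard 1 Q.
Proof.
move=> yesR encR parR P [d redP].
apply: (fpt_reducible_comp (R := R d) redP (yesR d) (prog_word_output d) (encR d)
  (pc_dims_bound d) (@dims_bound_mono d)) => x.
by rewrite -dims_boundE; apply: parR.
Qed.

Theorem theorem2 :
  [/\ W_hard 1 (OffensiveAlliance fvs_number),
      W_hard 1 (OffensiveAlliance treewidth),
      W_hard 1 (OffensiveAlliance pathwidth)
    & W_hard 1 (OffensiveAlliance treedepth)] /\
  [/\ W_hard 1 (ExactOffensiveAlliance fvs_number),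
      W_hard 1 (ExactOffensiveAlliance treewidth),
      W_hard 1 (ExactOffensiveAlliance pathwidth)
    & W_hard 1 (ExactOffensiveAlliance treedepth)].
Proof.
have bounds d (x : wcs_instance 1 d) := param_bounds d (wcs_encode x).
have oa kappa : (forall d (x : wcs_instance 1 d),
    kappa (word_graph d (wcs_encode x)) <= word_dims d (wcs_encode x) + 4) ->
    W_hard 1 (OffensiveAlliance kappa) /\ W_hard 1 (ExactOffensiveAlliance kappa).
  move=> kappa_le; split.
    exact: (@W_hard_reduce (OffensiveAlliance kappa) reduce
      (fun d => @reduce_oa d kappa) reduce_encode kappa_le).
  exact: (@W_hard_reduce (ExactOffensiveAlliance kappa) reduce
    (fun d => @reduce_exact d kappa) reduce_encode kappa_le).
have [o1 e1] : _ /\ _ := oa fvs_number (fun d x => let: And4 h _ _ _ := bounds d x in h).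
have [o2 e2] : _ /\ _ := oa treewidth (fun d x => let: And4 _ h _ _ := bounds d x in h).
have [o3 e3] : _ /\ _ := oa pathwidth (fun d x => let: And4 _ _ h _ := bounds d x in h).
have [o4 e4] : _ /\ _ := oa treedepth (fun d x => let: And4 _ _ _ h := bounds d x in h).
by [].
Qed.
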